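(* There is a constant $C>0$ (depending at most on the dimension $d$) such that the following holds. Let $K>0$, $h\in(0,1]$, $k,n\in\mathbb{N}^*$, let $P$ be a Borel probability measure supported on $M\subset B(0,K)\subset\mathbb{R}^d$. Assume that we observe $X_1,\dots,X_n$ such that $X_i=Y_i+Z_i$, where $Y_1,\dots,Y_n$ is an i.i.d. $n$-sample from $P$ and the $Z_i$ are sub-Gaussian with variance $\sigma^2$, with $\sigma\le K$, the $X_i$ being i.i.d. with distribution $Q$. Let $Q_n=\frac1n\sum_{i=1}^n\delta_{X_i}$ denote the empirical distribution associated with the $X_i$'s. Then, for any $p>0$, with probability larger than $1-7n^{-p}$, $$\int\left(\mathrm{d}^2_{Q_n,h,k}(u)-\mathrm{d}^2_{Q,h,k}(u)\right)dP(u)\le C\sqrt{k}\,\frac{K^2\left((p+1)\log(n)\right)^{3/2}}{h\sqrt n}+C\frac{K\sigma}{\sqrt h},$$ where $\mathrm{d}_{Q_n,h,k}$ and $\mathrm{d}_{Q,h,k}$ are $k$-PDTMs of $Q_n$ and $Q$.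
   Context: $\mathbb{R}^d$ carries the Euclidean norm; $B(x,r)$ and $\overline{B}(x,r)$ are the open and closed balls. A probability measure $R$ on $\mathbb{R}^d$ is sub-Gaussian with variance $V^2>0$ if $R(B(0,t)^c)\le\exp(-\frac{t^2}{2V^2})$ for all $t>V$; a random variable is sub-Gaussian if its distribution is. For a unit vector $v$ and $c\in\mathbb{R}$, $H(v,c)=\{x:\langle x,v\rangle>c\}$. Conventions: $\inf\emptyset=+\infty$, $\sup\emptyset=-\infty$, $B(x,+\infty)=H(v,-\infty)=\mathbb{R}^d$. For a Borel probability measure $P$ with finite second moment: $\delta_{P,l}(x)=\inf\{r>0: P(\overline{B}(x,r))>l\}$; $c_{P,h}(v)=\sup\{c\in\mathbb{R}: P(H(v,c))>h\}$. Let $\overline{\mathbb{R}}_d=\mathbb{R}^d\cup\{v_\infty: \|v\|=1\}$, where $v_\infty$ is a point at infinity in direction $v$. For $x\in\mathbb{R}^d$, $\mathcal{P}_{x,h}(P)$ is the set of probability measures $P_{x,h}=\frac1h R$ with $R$ a sub-measure of $P$ of total mass $h$, coinciding with $P$ on $B(x,\delta_{P,h}(x))$ and supported on $\overline{B}(x,\delta_{P,h}(x))$. For $x=v_\infty$, $\mathcal{P}_{v_\infty,h}(P)$ is defined in the same way with $H(v,c_{P,h}(v))$ and its closure replacing the open and closed ball. $P_{x,h}$ denotes an element of $\mathcal{P}_{x,h}(P)$; $m(P_{x,h})=\int u\,dP_{x,h}(u)$, $v(P_{x,h})=\int\|u-m(P_{x,h})\|^2dP_{x,h}(u)$. The same notation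 is used for $Q$ and $Q_n$. For a set $A$, $A^{(k)}$ is the set of $k$-tuples of elements of $A$ up to permutation. $\mathcal{O}pt(P,h,k)$ is the set of $t\in\overline{\mathbb{R}}_d^{(k)}$ minimizing $\int\min_{i}(\|u-m(P_{t_i,h})\|^2+v(P_{t_i,h}))\,dP(u)$ (over $t$ and over the choices of $P_{t_i,h}\in\mathcal{P}_{t_i,h}(P)$ when not unique). A $k$-PDTM of $P$ is a nonnegative function $\mathrm{d}_{P,h,k}$ given, for some minimizer $s\in\mathcal{O}pt(P,h,k)$ (with its minimizing choice of $P_{s_i,h}$), by $\mathrm{d}^2_{P,h,k}(x)=\min_{i}\|x-m(P_{s_i,h})\|^2+v(P_{s_i,h})$. *)

(* Defs.v *)
From HB Require Import structures.
From mathcomp Require Import all_boot all_order all_algebra.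
From mathcomp Require Import all_classical all_reals all_analysis.

Set Implicit Arguments.
Unset Strict Implicit.
Unset Printing Implicit Defensive.

Import Order.TTheory GRing.Theory Num.Theory.
Import numFieldNormedType.Exports.

Local Open Scope classical_set_scope.
Local Open Scope ring_scope.

(* Borel sigma-algebra of R^d: the product topology of the row vectors is the
   Euclidean topology. *)
HB.instance Definition _ (R : realType) (d : nat) :=
  @isMeasurable.Build (sigma_display (@open 'rV[R]_d)) 'rV[R]_d
    <<s @open 'rV[R]_d >>
    (@sigma_algebra0 _ setT (@open 'rV[R]_d))
    (@sigma_algebraC _ (@open 'rV[R]_d))
    (@sigma_algebra_bigcup _ setT (@open 'rV[R]_d)).

Section euclidean.
Context {R : realType} {d : nat}.
Implicit Types (x y u v : 'rV[R]_d) (r c : \bar R).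

Definition dotv u v : R := \sum_(i < d) u 0 i * v 0 i.

(* The library norm `|u| on 'rV[R]_d is the sup norm, hence a separate
   Euclidean norm. *)
Definition enorm u : R := Num.sqrt (dotv u u).

(* Radii and levels are extended reals, so that the ball of radius +oo and the
   half-space of level -oo are the whole space. *)
Definition oball x r : set 'rV[R]_d := [set y | ((enorm (y - x))%:E < r)%E].

Definition cball x r : set 'rV[R]_d := [set y | ((enorm (y - x))%:E <= r)%E].

Definition halfspace v c : set 'rV[R]_d := [set y | (c < (dotv y v)%:E)%E].

Definition sub_gaussian (V : R) (mu : set 'rV[R]_d -> \bar R) : Prop :=
  forall t : R, V < t ->
    (mu (~` oball 0 t%:E) <= (expR (- (t ^+ 2 / (2 * V ^+ 2))))%:E)%E.

End euclidean.

(* R^d together with its points at infinity v_oo, for v on the unit sphere. *)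
Inductive epoint (R : realType) (d : nat) : Type :=
| Fin (x : 'rV[R]_d)
| Dir (v : 'rV[R]_d) (unit_v : enorm v = 1).

Section pdtm.
Context {R : realType} {d : nat}.
Local Notation E := 'rV[R]_d.
Implicit Types (P mu : {measure set E -> \bar R}) (h : R).

Definition delta P (l : R) (x : E) : \bar R :=
  ereal_inf [set r%:E | r in [set r : R | 0 < r /\ (l%:E < P (cball x r%:E))%E]].

Definition clevel P h (v : E) : \bar R :=
  ereal_sup [set c%:E | c in [set c : R | (h%:E < P (halfspace v c%:E))%E]].

Definition inner_region P h (x : epoint R d) : set E :=
  match x with
  | Fin x => oball x (delta P h x)
  | Dir v _ => halfspace v (clevel P h v)
  end.

Definition outer_region P h (x : epoint R d) : set E :=
  match x with
  | Fin x => cball x (delta P h x)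
  | Dir v _ => closure (halfspace v (clevel P h v))
  end.

(* [local_measures P h x] is the set of the admissible P_{x,h}. *)
Definition local_measures P h (x : epoint R d) : set (probability E R) :=
  [set mu | exists nu : {measure set E -> \bar R},
     [/\ nu setT = h%:E,
         forall A, measurable A -> (nu A <= P A)%E,
         forall A, measurable A -> A `<=` inner_region P h x -> nu A = P A,
         nu (~` outer_region P h x) = 0%E &
         forall A, measurable A -> mu A = (h^-1%:E * nu A)%E]].

Definition mean mu : E := \row_j \int[mu]_u (u 0 j).

Definition variance mu : R := \int[mu]_u (enorm (u - mean mu) ^+ 2).

Definition power_min (k : nat) (m : 'I_k -> probability E R) (u : E) : \bar R :=
  \big[mine/+oo%E]_(i < k) (enorm (u - mean (m i)) ^+ 2 + variance (m i))%:E.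

Definition admissible P h (k : nat) (t : 'I_k -> epoint R d)
    (m : 'I_k -> probability E R) : Prop :=
  forall i, local_measures P h (t i) (m i).

(* [Opt P h k t m]: t is optimal, with minimizing choice m i of P_{t_i,h}.
   Families are ordered; everything is invariant under a permutation of the
   indices, so this is the same as working with k-tuples up to permutation. *)
Definition Opt P h (k : nat) (t : 'I_k -> epoint R d)
    (m : 'I_k -> probability E R) : Prop :=
  admissible P h t m /\
  forall (t' : 'I_k -> epoint R d) (m' : 'I_k -> probability E R),
    admissible P h t' m' ->
    (\int[P]_u power_min m u <= \int[P]_u power_min m' u)%E.

Definition is_kPDTM P h (k : nat) (f : E -> R) : Prop :=
  (forall x, 0 <= f x) /\
  exists (s : 'I_k -> epoint R d) (m : 'I_k -> probability E R),
    Opt P h s m /\ forall x, ((f x) ^+ 2)%:E = power_min m x.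

End pdtm.

Section empirical.
Context {R : realType} {d n : nat} (x : 'I_n -> 'rV[R]_d).
Local Open Scope ereal_scope.

Definition empirical (A : set 'rV[R]_d) : \bar R :=
  (n%:R^-1)%R%:E * \sum_(i < n) \d_(x i) A.

Let dirac_seq (k : nat) : {measure set 'rV[R]_d -> \bar R} :=
  oapp (fun i : 'I_n => \d_(x i) : {measure set 'rV[R]_d -> \bar R}) mzero
    (insub k).

Let empiricalE : empirical = mscale (n%:R^-1 : R)%R%:nng%R (msum dirac_seq n).
Proof.
apply/funext => A; rewrite /empirical /mscale/= /msum; congr (_ * _).
by apply: eq_bigr => i _; rewrite /dirac_seq valK.
Qed.

Let empirical0 : empirical set0 = 0.
Proof. by rewrite empiricalE measure0. Qed.

Let empirical_ge0 A : 0 <= empirical A.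
Proof. by rewrite empiricalE measure_ge0. Qed.

Let empirical_semi_sigma_additive : semi_sigma_additive empirical.
Proof. by rewrite empiricalE; exact: measure_semi_sigma_additive. Qed.

HB.instance Definition _ := isMeasure.Build _ _ _ empirical
  empirical0 empirical_ge0 empirical_semi_sigma_additive.

End empirical.

Section iid.
Context {dO dT : measure_display} {Omega : measurableType dO}
  {T : measurableType dT} {R : realType} (Pr : probability Omega R) {n : nat}.

Definition mutually_independent (X : 'I_n -> {RV Pr >-> T}) : Prop :=
  forall (J : {set 'I_n}) (A : 'I_n -> set T),
    (forall i, measurable (A i)) ->
    Pr (\bigcap_(i in [set` J]) (X i @^-1` A i)) =
      (\prod_(i in J) Pr (X i @^-1` A i))%E.

Definition iid (X : 'I_n -> {RV Pr >-> T}) (Q : probability T R) : Prop :=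
  mutually_independent X /\
  forall i (A : set T), measurable A -> distribution Pr (X i) A = Q A.

End iid.

(* Main.v *)
(** The criterion only sees a measure [nu] through its mean and second moment:
    [|u - m|^2 + v = |u|^2 - 2 <u, m> + int |y|^2 dnu(y)].  A power cell with
    centroid [c] contributes to the criterion through [int |y - c|^2 dnu(y)]
    alone, and among all submeasures of mass [h] the local measures at [c]
    minimize this integral.  Hence minimizing over local measures is the same
    as minimizing over all submeasures of mass [h].

    Fix optimal local measures of [Q] with densities [f_i].  Reweighting
    the sample by [f_i], and correcting the total mass to exactly [h], gives
    submeasures of [Q_n] whose criterion is close to the optimal one for [Q];
    so an empirical optimum is almost optimal for [Q].  The deviations needed
    concern finitely many functions: the moments of the [f_i], and minima of
    affine functions, discretized on a grid of means and second moments, which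
    Hoeffding's inequality and a union bound control on a ball of radius of
    order [K sqrt ((p + 1) ln n)] that contains the sample.

    Finally, a minimum of functions [om_i - 2 <u, m_i>] is
    [2 max |m_i|]-Lipschitz, and [|m_i|] is at most of order [K / sqrt h], so
    integrating it against [P] instead of [Q] costs [K sigma / sqrt h]. *)

Require Import Defs.
From HB Require Import structures.
From mathcomp Require Import all_boot all_order all_algebra.
From mathcomp Require Import all_classical all_reals all_analysis.
From mathcomp Require Import measurable_realfun zify ring lra.

Set Implicit Arguments.
Unset Strict Implicit.
Unset Printing Implicit Defensive.

Import Order.TTheory GRing.Theory Num.Theory.
Import numFieldNormedType.Exports.

Local Open Scope classical_set_scope.
Local Open Scope ring_scope.

(** The obstacle is that an empirical optimum depends on the sample, so its criterion is not a mean
    of independent terms. A one-sided comparison keeps the random objects simple: optimality is used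
    against a single competitor, built from functions fixed before sampling, and the optimum itself
    enters only through its means and second moments, which the grid covers. With
    [L = (p + 1) ln n], the squared truncation radius is of order [K^2 L] and the relative deviation
    of order [sqrt (k L / n)]. Their product gives the power [3/2] of the logarithm; [sqrt k] comes
    from the cardinality [(n + 1)^((d + 1) k)] of the grid, and [1 / h] from normalizing submeasures
    of mass [h]. Truncation alone only places the means of empirical local measures in the large
    ball. The radius of order [K / sqrt h] needed to pass to [P] comes from the deviation of the
    second moment, up to a cross term that the two final terms absorb. If [7 n^(-p) > 1] the claim
    is void; otherwise [p ln n >= 1], hence [L >= 1]. *)

Section measurable_comparison.
Context {dT : measure_display} {T : measurableType dT} {R : realType} (f g : T -> R).
Hypotheses (mf : measurable_fun setT f) (mg : measurable_fun setT g).

Lemma measurable_set_ler : measurable [set x | f x <= g x].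
Proof.
rewrite -[X in measurable X]setTI.
by have := measurable_fun_ler mf mg measurableT (Y := [set true]) I; apply.
Qed.

Lemma measurable_set_ltr : measurable [set x | f x < g x].
Proof.
rewrite -[X in measurable X]setTI.
by have := measurable_fun_ltr mf mg measurableT (Y := [set true]) I; apply.
Qed.

End measurable_comparison.

(** * Euclidean geometry and measurability *)

Section euclid.
Context {R : realType} {d : nat}.
Local Notation E := 'rV[R]_d.
Implicit Types (u v w : E).

Definition sqnorm u : R := dotv u u.

Lemma dotvC u v : dotv u v = dotv v u.
Proof. by apply: eq_bigr => i _; rewrite mulrC. Qed.

Lemma dotvDl u v w : dotv (u + v) w = dotv u w + dotv v w.
Proof. by rewrite -big_split; apply: eq_bigr => i _; rewrite mxE mulrDl. Qed.

Lemma dotvZl a u v : dotv (a *: u) v = a * dotv u v.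
Proof. by rewrite mulr_sumr; apply: eq_bigr => i _; rewrite mxE mulrA. Qed.

Lemma dotvNl u v : dotv (- u) v = - dotv u v.
Proof. by rewrite -scaleN1r dotvZl mulN1r. Qed.

Lemma dotvDr u v w : dotv w (u + v) = dotv w u + dotv w v.
Proof. by rewrite dotvC dotvDl !(dotvC w). Qed.

Lemma dotvZr a u v : dotv u (a *: v) = a * dotv u v.
Proof. by rewrite dotvC dotvZl dotvC. Qed.

Lemma dotvNr u v : dotv u (- v) = - dotv u v.
Proof. by rewrite dotvC dotvNl dotvC. Qed.

Lemma sqnorm_ge0 u : 0 <= sqnorm u.
Proof. by apply: sumr_ge0 => i _; rewrite -expr2 sqr_ge0. Qed.

Lemma enorm_ge0 u : 0 <= enorm u.
Proof. exact: sqrtr_ge0. Qed.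

Lemma sqr_enorm u : enorm u ^+ 2 = sqnorm u.
Proof. by rewrite sqr_sqrtr// sqnorm_ge0. Qed.

Lemma sqnormB u v : sqnorm (u - v) = sqnorm u - 2 * dotv u v + sqnorm v.
Proof.
by rewrite /sqnorm !(dotvDl, dotvDr, dotvNl, dotvNr) (dotvC v u); ring.
Qed.

Lemma sqnormZ a u : sqnorm (a *: u) = a ^+ 2 * sqnorm u.
Proof. by rewrite /sqnorm dotvZl dotvZr mulrA. Qed.

Lemma sqnorm_eq0 u : sqnorm u = 0 -> u = 0.
Proof.
move=> /psumr_eq0P u0; apply/rowP => i; rewrite mxE.
have /eqP := u0 (fun i _ => sqr_ge0 (u 0 i)) i erefl.
by rewrite mulf_eq0 orbb => /eqP.
Qed.

Lemma dotv0l u : dotv 0 u = 0.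
Proof. by have := dotvZl 0 0 u; rewrite scale0r mul0r. Qed.

Lemma dotv_le u v : `|dotv u v| <= enorm u * enorm v.
Proof.
rewrite -ler_sqr ?nnegrE ?mulr_ge0 ?enorm_ge0//.
rewrite exprMn !sqr_enorm real_normK ?num_real//.
have [/eqP/sqnorm_eq0 ->|v0] := boolP (sqnorm v == 0).
  by rewrite dotvC dotv0l expr0n mulr_ge0// sqnorm_ge0.
have vp : 0 < sqnorm v by rewrite lt_def v0 sqnorm_ge0.
(* The residual of the orthogonal projection of [u] on [v]: its squared norm times [sqnorm v] is the
   Gram determinant. *)
have := sqnorm_ge0 (u - (dotv u v / sqnorm v) *: v).
rewrite sqnormB sqnormZ dotvZr => /mulr_ge0/(_ (ltW vp)).
suff -> : (sqnorm u - 2 * (dotv u v / sqnorm v * dotv u v) +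
   (dotv u v / sqnorm v) ^+ 2 * sqnorm v) * sqnorm v =
  sqnorm u * sqnorm v - dotv u v ^+ 2 by rewrite subr_ge0.
by field.
Qed.

Lemma dotv_ler u v : dotv u v <= enorm u * enorm v.
Proof. exact: le_trans (ler_norm _) (dotv_le u v). Qed.

Lemma enormD u v : enorm (u + v) <= enorm u + enorm v.
Proof.
rewrite -ler_sqr ?nnegrE ?addr_ge0 ?enorm_ge0// sqrrD !sqr_enorm.
rewrite /sqnorm !(dotvDl, dotvDr) (dotvC v u).
by have := dotv_ler u v; lra.
Qed.

Lemma enormN u : enorm (- u) = enorm u.
Proof. by rewrite /enorm dotvNl dotvNr opprK. Qed.

Lemma enormB u v : enorm (u - v) <= enorm u + enorm v.
Proof. by rewrite -(enormN v) enormD. Qed.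

Lemma enorm_le u (b : R) : 0 <= b -> sqnorm u <= b ^+ 2 -> enorm u <= b.
Proof. by move=> b0; rewrite -sqr_enorm ler_sqr// nnegrE enorm_ge0. Qed.

Lemma le_sqnorm u (b : R) : enorm u <= b -> sqnorm u <= b ^+ 2.
Proof.
move=> ub; rewrite -sqr_enorm ler_sqr// nnegrE ?enorm_ge0//.
exact: le_trans (enorm_ge0 u) ub.
Qed.

Lemma sqnormB_le u v : sqnorm (u - v) <= 2 * sqnorm u + 2 * sqnorm v.
Proof.
by have := sqnorm_ge0 (u + v); rewrite -{1}(opprK v) !sqnormB dotvNr
  /sqnorm !(dotvNl, dotvNr); lra.
Qed.

Lemma coord_le u i : `|u 0 i| <= enorm u.
Proof.
rewrite -ler_sqr ?nnegrE ?enorm_ge0// sqr_enorm real_normK ?num_real//.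
rewrite /sqnorm /dotv (bigD1 i)//= -expr2 lerDl.
by apply: sumr_ge0 => j _; rewrite -expr2 sqr_ge0.
Qed.

Lemma enorm_le1 u : enorm u <= (1 + sqnorm u) / 2.
Proof. by rewrite -sqr_enorm; have := sqr_ge0 (enorm u - 1); nra. Qed.

Lemma measurable_coord i : measurable_fun [set: E] (fun u : E => u 0 i).
Proof.
apply: (measurability _ (RGenOInfty.measurableE R)) => _ [_ [x ->] <-].
rewrite setTI; apply: sub_sigma_algebra.
have /continuousP := @coord_continuous R 1 d 0 i.
by apply; rewrite set_itvE; exact: open_gt.
Qed.

Lemma measurable_dotv v : measurable_fun [set: E] (dotv^~ v).
Proof.
apply: (@measurable_sum _ _ _ _ _ _ (fun i (u : E) => u 0 i * v 0 i)) => i.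
by apply: measurable_funM; [exact: measurable_coord|exact: measurable_cst].
Qed.

Lemma measurable_sqnormB v : measurable_fun [set: E] (fun u : E => sqnorm (u - v)).
Proof.
apply: (@measurable_sum _ _ _ _ _ _
  (fun i (u : E) => (u - v) 0 i * (u - v) 0 i)) => i.
have h : measurable_fun [set: E] (fun u : E => (u - v) 0 i).
  rewrite (_ : (fun u : E => (u - v) 0 i) = (fun u => u 0 i - v 0 i)).
    by apply: measurable_funB; [exact: measurable_coord|exact: measurable_cst].
  by apply/funext => u; rewrite !mxE.
exact: measurable_funM.
Qed.

Lemma measurable_sqnorm : measurable_fun [set: E] sqnorm.
Proof.
have := measurable_sqnormB 0.
by congr (measurable_fun _ _); apply/funext => u; rewrite subr0.
Qed.

Lemma measurable_enormB v : measurable_fun [set: E] (fun u : E => enorm (u - v)).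
Proof.
apply: (@measurableT_comp _ _ _ _ _ (measurableTypeR R) (@Num.sqrt R) _
  (fun u => sqnorm (u - v))); last exact: measurable_sqnormB.
by apply: continuous_measurable_fun; exact: sqrt_continuous.
Qed.

Lemma measurable_enorm : measurable_fun [set: E] enorm.
Proof.
have := measurable_enormB 0.
by congr (measurable_fun _ _); apply/funext => u; rewrite subr0.
Qed.

Lemma measurable_oball v r : measurable (oball v r).
Proof.
rewrite (_ : oball v r = [set u | (EFin \o (fun u => enorm (u - v))) u < r]%E)//.
rewrite -[X in measurable X]setTI.
apply: emeasurable_fun_infty_o => //.
by apply/measurable_EFinP; exact: measurable_enormB.
Qed.

Lemma measurable_cball v r : measurable (cball v r).
Proof.
rewrite (_ : cball v r = [set u | (EFin \o (fun u => enorm (u - v))) u <= r]%E)//.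
rewrite -[X in measurable X]setTI.
apply: emeasurable_fun_infty_c => //.
by apply/measurable_EFinP; exact: measurable_enormB.
Qed.

End euclid.

(** * Measures given by a density *)

Section density.
Context {dT : measure_display} {T : measurableType dT} {R : realType}.
Variables (mu : {measure set T -> \bar R}) (g : T -> R).
Hypotheses (mg : measurable_fun [set: T] g) (g0 : forall x, 0 <= g x).
Local Open Scope ereal_scope.

(** The two proofs are arguments so that the measure structure can be attached to the term
    [density mg g0] itself. *)
Definition density of measurable_fun [set: T] g & (forall x, (0 <= g x)%R) :=
  fun A : set T => \int[mu]_(x in A) (g x)%:E.

Local Notation nu := (density mg g0).

Let nu0 : nu set0 = 0.
Proof. exact: integral_set0. Qed.

Let nu_ge0 A : 0 <= nu A.
Proof. by apply: integral_ge0 => x _; rewrite lee_fin. Qed.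

Let nu_sigma_additive : semi_sigma_additive nu.
Proof.
move=> F mF tF mUF; rewrite /density ge0_integral_bigcup//; last 2 first.
- exact/measurable_EFinP/measurable_funTS.
- by move=> x _; rewrite lee_fin.
apply: is_cvg_ereal_nneg_natsum_cond => n _ _.
by apply: integral_ge0 => x _; rewrite lee_fin.
Qed.

HB.instance Definition _ := isMeasure.Build _ _ _ (density mg g0)
  nu0 nu_ge0 nu_sigma_additive.

Import HBNNSimple.

(** Monotone convergence along simple functions reduces the claim to indicators, where it is the
    definition of [density]. *)
Lemma ge0_integral_density (f : T -> \bar R) :
  measurable_fun [set: T] f -> (forall x, 0 <= f x) ->
  \int[nu]_x f x = \int[mu]_x (f x * (g x)%:E).
Proof.
move=> mf f0; pose f_ := nnsfun_approx measurableT mf.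
have gE x : 0 <= (g x)%:E by rewrite lee_fin.
transitivity (limn (fun n => \int[nu]_x (f_ n x)%:E)).
  rewrite -monotone_convergence//=.
  - apply: eq_integral => x _; apply/esym/cvg_lim => //=.
    exact: cvg_nnsfun_approx.
  - by move=> n; exact/measurable_EFinP/measurable_funTS.
  - by move=> n x _; rewrite lee_fin.
  - by move=> x _ a b ab; rewrite lee_fin//; exact/lefP/nd_nnsfun_approx.
transitivity (limn (fun n => \int[mu]_x ((f_ n x)%:E * (g x)%:E))); last first.
  rewrite -monotone_convergence//=.
  - apply: eq_integral => x _; apply/cvg_lim => //=.
    apply: cvgeZr => //; exact: cvg_nnsfun_approx.
  - move=> n; apply: emeasurable_funM; first exact/measurable_EFinP/measurable_funTS.
    exact/measurable_EFinP.
  - by move=> n x _; rewrite mule_ge0// lee_fin.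
  - move=> x _ a b ab; rewrite lee_wpmul2r// lee_fin.
    exact/lefP/nd_nnsfun_approx.
congr (limn _); apply/funext => n.
under [LHS]eq_integral do rewrite fimfunE -fsumEFin//.
rewrite [LHS]ge0_integral_fsum//; last 2 first.
- by move=> r; exact/measurable_EFinP/measurableT_comp.
- by move=> r x _; rewrite EFinM nnfun_muleindic_ge0.
under [RHS]eq_integral.
  move=> x _; rewrite fimfunE -fsumEFin// muleC ge0_mule_fsumr; last first.
    by move=> r; rewrite EFinM nnfun_muleindic_ge0.
  over.
rewrite [RHS]ge0_integral_fsum//; last 2 first.
- move=> r; apply: emeasurable_funM; first exact/measurable_EFinP.
  by apply/measurable_EFinP; do 2 apply/measurableT_comp => //.
- by move=> r x _; rewrite mule_ge0// EFinM nnfun_muleindic_ge0.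
apply: eq_fsbigr => r _; rewrite integralZl_indic_nnsfun// integral_indic// setIT.
rewrite /density.
have [r0|r0] := leP 0%R r; last first.
  rewrite preimage_nnfun0// indic0 measure0 mule0 integral0_eq// => x _.
  by rewrite mulr0 mule0.
under [RHS]eq_integral do rewrite EFinM muleCA.
rewrite ge0_integralZl//; last 2 first.
- apply: emeasurable_funM; first exact/measurable_EFinP.
  exact/measurable_EFinP/measurable_indic.
- by move=> x _; rewrite mule_ge0// lee_fin.
congr (_ * _); rewrite [LHS]integral_mkcond.
by apply: eq_integral => x _; rewrite patchE indicE; case: ifP => xr;
  rewrite ?mule1 ?mule0.
Qed.
End density.

(** * Integration of functions of quadratic growth *)

Section quadratic_growth.
Context {R : realType} {d : nat}.
Local Notation E := 'rV[R]_d.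
Implicit Types (f g : E -> R) (mu nu : {measure set E -> \bar R}).

(** One class for all integrands: integrable against every [unit_mass2] measure, and stable under
    sums, finite minima and bounded factors. *)
Definition qgrowth f := measurable_fun [set: E] f /\
  exists c : R, forall u, `|f u| <= c * (1 + sqnorm u).

(** A predicate on measures rather than a [probability], so that it also applies to
    [empirical x]. *)
Definition unit_mass2 mu :=
  mu setT = 1%E /\ (\int[mu]_u (sqnorm u)%:E < +oo)%E.

Lemma qgrowthD f g : qgrowth f -> qgrowth g -> qgrowth (fun u => f u + g u).
Proof.
move=> [mf [a fa]] [mg [b gb]]; split; first exact: measurable_funD.
exists (a + b) => u; rewrite mulrDl (le_trans (ler_normD _ _))// lerD//.
Qed.

Lemma qgrowthM_bounded f g : qgrowth f -> measurable_fun [set: E] g ->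
  (exists c, forall u, `|g u| <= c) -> qgrowth (fun u => f u * g u).
Proof.
move=> [mf [a fa]] mg [b gb]; split; first exact: measurable_funM.
exists (a * b) => u; rewrite normrM mulrAC.
by apply: ler_pM.
Qed.

Lemma qgrowth_bounded f : measurable_fun [set: E] f ->
  (exists c, forall u, `|f u| <= c) -> qgrowth f.
Proof.
move=> mf [c fc]; split => //; exists c => u; rewrite mulrDr mulr1.
rewrite (le_trans (fc u))// lerDl mulr_ge0 ?sqnorm_ge0//.
exact: le_trans (normr_ge0 (f u)) (fc u).
Qed.

Lemma qgrowth_cst (c : R) : qgrowth (fun=> c).
Proof. by apply: qgrowth_bounded => //; exists `|c|. Qed.

Lemma qgrowth_norm f : qgrowth f -> qgrowth (fun u => `|f u|).
Proof.
move=> [mf [c fc]]; split; first exact: measurableT_comp.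
by exists c => u; rewrite normr_id.
Qed.

Lemma qgrowthZ (c : R) f : qgrowth f -> qgrowth (fun u => c * f u).
Proof.
move=> qf; have : qgrowth (fun u => f u * (fun=> c) u).
  by apply: qgrowthM_bounded => //; exists `|c|.
by congr qgrowth; apply/funext => u; rewrite mulrC.
Qed.

Lemma qgrowthN f : qgrowth f -> qgrowth (fun u => - f u).
Proof.
by move=> /(qgrowthZ (-1)); congr qgrowth; apply/funext => u; rewrite mulN1r.
Qed.

Lemma qgrowthB f g : qgrowth f -> qgrowth g -> qgrowth (fun u => f u - g u).
Proof. by move=> qf qg; apply: qgrowthD => //; exact: qgrowthN. Qed.

Lemma qgrowth_sqnorm : qgrowth sqnorm.
Proof.
split; first exact: measurable_sqnorm.
by exists 1 => u; rewrite mul1r ger0_norm ?sqnorm_ge0// lerDr.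
Qed.

Lemma qgrowth_dotv v : qgrowth (dotv^~ v).
Proof.
split; first exact: measurable_dotv.
exists (enorm v) => u; rewrite (le_trans (dotv_le u v))// mulrC.
rewrite ler_wpM2l ?enorm_ge0//.
by have := enorm_le1 u; have := sqnorm_ge0 u; lra.
Qed.

Lemma qgrowth_coord i : qgrowth (fun u : E => u 0 i).
Proof.
split; first exact: measurable_coord.
exists 1 => u; rewrite mul1r (le_trans (coord_le u i))//.
by have := enorm_le1 u; have := sqnorm_ge0 u; lra.
Qed.

Lemma qgrowth_sqnormB v : qgrowth (fun u => sqnorm (u - v)).
Proof.
have := qgrowthD (qgrowthB qgrowth_sqnorm (qgrowthZ 2 (qgrowth_dotv v)))
  (qgrowth_cst (sqnorm v)).
by congr qgrowth; apply/funext => u; rewrite sqnormB.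
Qed.

Lemma qgrowth_affine v (c : R) : qgrowth (fun u => c - 2 * dotv u v).
Proof. by apply: qgrowthB (qgrowth_cst _) (qgrowthZ _ (qgrowth_dotv _)). Qed.

Section with_measure.
Variable mu : {measure set E -> \bar R}.
Hypothesis mu2 : unit_mass2 mu.

Lemma qgrowth_integrable f : qgrowth f -> mu.-integrable setT (EFin \o f).
Proof.
case: mu2 => mu1 sq_fin [mf [c fc]]; apply/integrableP; split.
  exact/measurable_EFinP.
have c0 : 0 <= c.
  have := le_trans (normr_ge0 _) (fc 0).
  by rewrite pmulr_lge0// ltr_pwDl// sqnorm_ge0.
apply: (@le_lt_trans _ _ (\int[mu]_u (c%:E * (1 + (sqnorm u)%:E)))%E).
  apply: ge0_le_integral => //.
  - by do 2 apply: measurableT_comp => //.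
  - apply: measurable_funeM; apply: emeasurable_funD => //.
    by apply/measurable_EFinP; exact: measurable_sqnorm.
  - by move=> u _ /=; rewrite -EFinD -EFinM lee_fin.
rewrite ge0_integralZl//; last 2 first.
- apply: emeasurable_funD => //; by apply/measurable_EFinP; exact: measurable_sqnorm.
- by move=> u _; rewrite adde_ge0// lee_fin sqnorm_ge0.
rewrite ge0_integralD//; last 2 first.
- by move=> u _; rewrite lee_fin sqnorm_ge0.
- by apply/measurable_EFinP; exact: measurable_sqnorm.
rewrite integral_cst// mu1 mul1e lte_mul_pinfty// lte_add_pinfty//.
by rewrite ltry.
Qed.

Lemma EFin_int f : qgrowth f -> (\int[mu]_u f u)%:E = (\int[mu]_u (f u)%:E)%E.
Proof.
move=> qf; rewrite /Rintegral fineK//; apply: integrable_fin_num => //.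
exact: qgrowth_integrable.
Qed.

Lemma intD f g : qgrowth f -> qgrowth g ->
  \int[mu]_u (f u + g u) = \int[mu]_u f u + \int[mu]_u g u.
Proof. by move=> *; apply: RintegralD => //; exact: qgrowth_integrable. Qed.

Lemma intB f g : qgrowth f -> qgrowth g ->
  \int[mu]_u (f u - g u) = \int[mu]_u f u - \int[mu]_u g u.
Proof. by move=> *; apply: RintegralB => //; exact: qgrowth_integrable. Qed.

Lemma intZ (c : R) f : qgrowth f -> \int[mu]_u (c * f u) = c * \int[mu]_u f u.
Proof. by move=> ?; apply: RintegralZl => //; exact: qgrowth_integrable. Qed.

Lemma int_cst (c : R) : \int[mu]_u c = c.
Proof. by rewrite Rintegral_cst// mu2.1 mulr1. Qed.

Lemma le_int f g : qgrowth f -> qgrowth g -> (forall u, f u <= g u) ->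
  \int[mu]_u f u <= \int[mu]_u g u.
Proof. by move=> qf qg fg; apply: le_Rintegral => //; exact: qgrowth_integrable. Qed.

Lemma int_ge0 f : (forall u, 0 <= f u) -> 0 <= \int[mu]_u f u.
Proof. by move=> f0; exact: Rintegral_ge0. Qed.

Lemma norm_int f : qgrowth f -> `|\int[mu]_u f u| <= \int[mu]_u `|f u|.
Proof. by move=> ?; apply: le_normr_Rintegral => //; exact: qgrowth_integrable. Qed.

Lemma qgrowth_sum (I : Type) (s : seq I) (F : I -> E -> R) :
  (forall i, qgrowth (F i)) -> qgrowth (fun u => \sum_(i <- s) F i u).
Proof.
move=> qF; elim: s => [|i s IH].
  have := qgrowth_cst 0; congr qgrowth.
  by apply/funext => u; rewrite big_nil.
have := qgrowthD (qF i) IH; congr qgrowth.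
by apply/funext => u; rewrite big_cons.
Qed.

Lemma int_sum (I : Type) (s : seq I) (F : I -> E -> R) :
  (forall i, qgrowth (F i)) ->
  \int[mu]_u (\sum_(i <- s) F i u) = \sum_(i <- s) \int[mu]_u F i u.
Proof.
move=> qF; elim: s => [|i s IH].
  by under eq_Rintegral do rewrite big_nil; rewrite int_cst big_nil.
under eq_Rintegral do rewrite big_cons.
by rewrite intD ?IH ?big_cons//; exact: qgrowth_sum.
Qed.

Lemma int_dotv v : \int[mu]_u dotv u v = dotv (mean mu) v.
Proof.
rewrite /dotv int_sum => [|i].
  apply: eq_bigr => i _; rewrite mxE mulrC -intZ; last exact: qgrowth_coord.
  by apply: eq_Rintegral => u _; rewrite mulrC.
have := qgrowthZ (v 0 i) (qgrowth_coord i).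
by congr qgrowth; apply/funext => u; rewrite mulrC.
Qed.

Lemma int_sqnormB v : \int[mu]_u sqnorm (u - v) =
  sqnorm v - 2 * dotv v (mean mu) + \int[mu]_u sqnorm u.
Proof.
under eq_Rintegral do rewrite sqnormB.
rewrite intD ?intB ?intZ ?int_dotv ?int_cst; first by rewrite dotvC; ring.
all: try exact: qgrowth_sqnorm.
all: try exact: qgrowth_dotv.
all: try exact: qgrowth_cst.
- exact/qgrowthZ/qgrowth_dotv.
- by apply: qgrowthB; [exact: qgrowth_sqnorm|exact/qgrowthZ/qgrowth_dotv].
Qed.

Lemma varianceE : Defs.variance mu = \int[mu]_u sqnorm u - sqnorm (mean mu).
Proof.
rewrite /Defs.variance; under eq_Rintegral do rewrite sqr_enorm.
by rewrite int_sqnormB /sqnorm; ring.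
Qed.

Lemma sqnorm_mean_le : sqnorm (mean mu) <= \int[mu]_u sqnorm u.
Proof.
rewrite -subr_ge0 -varianceE; apply: Rintegral_ge0 => u _; exact: sqr_ge0.
Qed.

Lemma power_distE v : enorm (v - mean mu) ^+ 2 + Defs.variance mu =
  sqnorm v - 2 * dotv v (mean mu) + \int[mu]_u sqnorm u.
Proof. by rewrite sqr_enorm varianceE sqnormB; ring. Qed.

End with_measure.

Lemma submeasure_integral_le (h : R) mu nu (f : E -> \bar R) : 0 < h ->
  (forall A, measurable A -> (h%:E * nu A <= mu A)%E) ->
  measurable_fun [set: E] f -> (forall u, 0 <= f u)%E ->
  (h%:E * \int[nu]_u f u <= \int[mu]_u f u)%E.
Proof.
move=> h0 numu mf f0; pose hn := NngNum (ltW h0).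
rewrite -(@ge0_integral_mscale _ _ _ nu _ measurableT hn)//.
by apply: ge0_le_measure_integral => //.
Qed.

Lemma submeasure_unit_mass2 (h : R) mu (nu : probability E R) : 0 < h ->
  (forall A, measurable A -> (h%:E * nu A <= mu A)%E) ->
  unit_mass2 mu -> unit_mass2 nu.
Proof.
move=> h0 numu [mu1 sq_fin]; split; first exact: probability_setT.
have /= := submeasure_integral_le h0 numu
  (f := EFin \o sqnorm) _ (fun u => _).
rewrite -(@lte_pmul2l _ h%:E)//= ?lte_fin// [ltRHS]gt0_muley ?lte_fin//.
move=> h1; apply: le_lt_trans sq_fin; apply: h1.
- by apply/measurable_EFinP; exact: measurable_sqnorm.
- by move=> u /=; rewrite lee_fin sqnorm_ge0.
Qed.

Lemma submeasure_int_le (h : R) mu (nu : probability E R) f : 0 < h ->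
  (forall A, measurable A -> (h%:E * nu A <= mu A)%E) ->
  unit_mass2 mu -> qgrowth f -> (forall u, 0 <= f u) ->
  h * \int[nu]_u f u <= \int[mu]_u f u.
Proof.
move=> h0 numu mu2 qf f0; have nu2 := submeasure_unit_mass2 h0 numu mu2.
rewrite -lee_fin EFinM !EFin_int//.
apply: submeasure_integral_le => //; first by case: qf => /measurable_EFinP.
Qed.

End quadratic_growth.

(** * Local measures and submeasures *)

Section local_measure.
Context {R : realType} {d : nat}.
Local Notation E := 'rV[R]_d.
Implicit Types (P : {measure set E -> \bar R}) (h : R) (x : E).

Definition submeasure h P (mu : probability E R) :=
  forall A, measurable A -> (h%:E * mu A <= P A)%E.

Lemma fine_measureE P A : unit_mass2 P -> measurable A ->
  (fine (P A))%:E = P A.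
Proof.
move=> [P1 _] mA; rewrite fineK// ge0_fin_numE//.
have /le_lt_trans -> // : (P A <= P setT)%E by apply: le_measure; rewrite ?inE.
by rewrite P1 ltry.
Qed.

Lemma int_indic P A : measurable A -> \int[P]_u \1_A u = fine (P A).
Proof. by move=> mA; rewrite /Rintegral integral_indic// setIT. Qed.

Lemma qgrowth_indic (A : set E) : measurable A -> qgrowth (\1_A : E -> R).
Proof.
move=> mA; apply: qgrowth_bounded; first exact: measurable_indic.
by exists 1 => u; rewrite indicE; case: (_ \in _); rewrite ?normr1 ?normr0.
Qed.

(** Continuity from below; with its counterpart from above it evaluates the masses of the open and
    closed balls of radius [delta]. *)
Lemma bigcup_le_level P (F : (set E)^nat) (l : \bar R) :
  (forall n, measurable (F n)) ->
  {homo F : n m / (n <= m)%N >-> n `<=` m} ->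
  (forall n, P (F n) <= l)%E -> (P (\bigcup_n F n) <= l)%E.
Proof.
move=> mF ndF Fl.
have ndF' : {homo F : n m / (n <= m)%N >-> (n <= m)%O}.
  by move=> a b /ndF/subsetPset.
have := @nondecreasing_cvg_mu _ _ _ P F mF (bigcup_measurable (fun n _ => mF n)) ndF'.
by move=> /cvge_to_le; apply; apply: nearW.
Qed.

Lemma le_level_bigcap P (F : (set E)^nat) (l : \bar R) :
  (P setT < +oo)%E -> (forall n, measurable (F n)) ->
  {homo F : n m / (n <= m)%N >-> m `<=` n} ->
  (forall n, l <= P (F n))%E -> (l <= P (\bigcap_n F n))%E.
Proof.
move=> Pfin mF niF Fl.
have niF' : {homo F : n m / (n <= m)%N >-> (m <= n)%O}.
  by move=> a b /niF/subsetPset.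
have F0 : (P (F 0%N) < +oo)%E.
  by apply: le_lt_trans Pfin; apply: le_measure; rewrite ?inE.
have mI : measurable (\bigcap_n F n) by exact: bigcap_measurableType.
have := @nonincreasing_cvg_mu _ _ _ P F F0 mF mI niF'.
by move=> /cvge_to_ge; apply; apply: nearW.
Qed.

(** An infinite [delta] means that no ball has mass above [h], and the balls exhaust the space. *)
Lemma delta_pinfty P h x : unit_mass2 P -> h <= 1 -> delta P h x = +oo%E -> h = 1.
Proof.
move=> [P1 _] h1 deltay; apply/eqP; rewrite eq_le h1 -lee_fin -P1.
have -> : [set: E] = \bigcup_n cball x n.+1%:R%:E.
  apply/esym/seteqP; split => // y _; exists (Num.truncn (enorm (y - x))) => //.
  by rewrite /cball/= lee_fin ltW// truncnS_gt.
apply: bigcup_le_level.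
- by move=> n; exact: measurable_cball.
- by move=> n m nm y /le_trans; apply; rewrite lee_fin ler_nat.
- move=> n; rewrite leNgt; apply/negP => hP.
  suff : (delta P h x <= n.+1%:R%:E)%E by rewrite deltay leye_eq.
  by apply: ereal_inf_lbound; exists n.+1%:R => //=; split.
Qed.

Lemma delta_ge0 P h x : (0 <= delta P h x)%E.
Proof. by apply/le_ereal_inf_tmp => _ [r [r0 _] <-]; rewrite lee_fin ltW. Qed.

(** Closed balls of positive radius below [delta] have mass at most [h], and they increase to the
    open ball. *)
Lemma oball_delta_le P h x : unit_mass2 P -> 0 < h <= 1 ->
  (P (oball x (delta P h x)) <= h%:E)%E.
Proof.
move=> P2 /andP[h0 h1].
have := delta_ge0 P h x; case E : (delta P h x) => [r| |]//= r0; last first.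
  rewrite (delta_pinfty P2 h1 E) -P2.1; apply: le_measure => //.
  by rewrite inE; exact: measurable_oball.
  by rewrite inE.
move: r0; rewrite lee_fin le_eqVlt => /predU1P[<-|r0].
  rewrite (_ : oball x 0%:E = set0) ?measure0 ?lee_fin ?(ltW h0)//.
  by apply/seteqP; split => // y; rewrite /oball/= lte_fin ltNge enorm_ge0.
(* [n.+2] keeps every radius positive, as [delta] only ranges over positive radii. *)
have -> : oball x r%:E = \bigcup_n cball x (r * (1 - n.+2%:R^-1))%:E.
  apply/seteqP; split => [y|y [n _]]; rewrite /oball/cball/= ?lte_fin ?lee_fin.
    move=> yr; pose e := 1 - enorm (y - x) / r.
    have e0 : 0 < e by rewrite subr_gt0 ltr_pdivrMr// mul1r.
    exists (Num.truncn e^-1) => //=; rewrite lee_fin.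
    have : (Num.truncn e^-1).+2%:R^-1 <= e.
      rewrite invf_ple ?posrE// ltW// (lt_trans (truncnS_gt _))//.
      by rewrite ltr_nat.
    have -> : enorm (y - x) = r * (1 - e) by rewrite /e; field; rewrite gt_eqF.
    by move=> ne; rewrite ler_pM2l// lerB.
  by move=> /le_lt_trans; apply; rewrite gtr_pMr// gtrBl invr_gt0.
apply: bigcup_le_level.
- by move=> n; exact: measurable_cball.
- move=> n m nm y /le_trans; apply; rewrite lee_fin ler_pM2l// lerB//.
  by rewrite lef_pV2 ?posrE ?ltr0n// ler_nat.
- move=> n; rewrite leNgt; apply/negP => hP.
  have rn0 : 0 < n.+2%:R^-1 :> R by rewrite invr_gt0.
  have rn1 : n.+2%:R^-1 < 1 :> R by rewrite invf_lt1// ltr1n.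
  suff : (delta P h x <= (r * (1 - n.+2%:R^-1))%:E)%E.
    rewrite E lee_fin; move: (_^-1) rn0 => e e0.
    by have := mulr_gt0 r0 e0; lra.
  apply: ereal_inf_lbound; exists (r * (1 - n.+2%:R^-1)) => //=; split => //.
  by rewrite mulr_gt0// subr_gt0.
Qed.

(** Closed balls of radius slightly above [delta] have mass above [h], and they decrease to the
    closed ball. *)
Lemma cball_delta_ge P h x : unit_mass2 P -> 0 < h <= 1 ->
  (h%:E <= P (cball x (delta P h x)))%E.
Proof.
move=> P2 /andP[h0 h1].
have := delta_ge0 P h x; case E : (delta P h x) => [r| |]//= r0; last first.
  rewrite (_ : cball _ _ = setT) ?P2.1 ?lee_fin//.
  by apply/seteqP; split => // y; rewrite /cball/= leey.
have -> : cball x r%:E = \bigcap_n cball x (r + n.+1%:R^-1)%:E.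
  apply/seteqP; split => [y yr n _|y yn]; rewrite /cball/=.
    by apply: (le_trans yr); rewrite lee_fin lerDl invr_ge0.
  rewrite lee_fin; apply/ler_addgt0Pr => e e0.
  have := yn (Num.truncn e^-1) I; rewrite /cball/= lee_fin => /le_trans; apply.
  by rewrite lerD2l invf_ple ?posrE// ltW// truncnS_gt.
apply: le_level_bigcap.
- by rewrite P2.1 ltry.
- by move=> n; exact: measurable_cball.
- move=> n m nm y /le_trans; apply; rewrite lee_fin lerD2l//.
  by rewrite lef_pV2 ?posrE ?ltr0n// ler_nat.
- move=> n; have n0 : 0 < n.+1%:R^-1 :> R by rewrite invr_gt0.
  have [|_ [s [s0 hs] <-]] := @lb_ereal_inf_adherent R
    [set r%:E | r in [set r : R | 0 < r /\ (h%:E < P (cball x r%:E))%E]] _ n0.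
    by have := E; rewrite /delta => ->.
  have := E; rewrite /delta => ->; rewrite -EFinD lte_fin => sr.
  apply: (le_trans (ltW hs)); apply: le_measure.
  + by rewrite inE; exact: measurable_cball.
  + by rewrite inE; exact: measurable_cball.
  + by move=> y; rewrite /cball/= !lee_fin => /le_trans; apply; exact: ltW.
Qed.

Lemma local_density P h x : unit_mass2 P -> 0 < h <= 1 ->
  exists f : E -> R, [/\ measurable_fun setT f, forall y, 0 <= f y <= 1,
    \int[P]_y f y = h,
    forall y, oball x (delta P h x) y -> f y = 1 &
    forall y, ~ cball x (delta P h x) y -> f y = 0].
Proof.
move=> P2 h01; set o := oball _ _; set c := cball _ _.
have mo : measurable o by exact: measurable_oball.
have mc : measurable c by exact: measurable_cball.
have oc : o `<=` c by move=> y /ltW.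
have bh : fine (P o) <= h.
  by rewrite -lee_fin fine_measureE//; exact: oball_delta_le.
have hc : h <= fine (P c).
  by rewrite -lee_fin fine_measureE//; exact: cball_delta_ge.
(* The constant density on the sphere that supplies the mass missing from the open ball. If the
   sphere is null, division by zero gives [th = 0] and the open ball already has mass [h]. *)
pose th := (h - fine (P o)) / (fine (P c) - fine (P o)).
have [th0 th1] : 0 <= th /\ th <= 1.
  have := le_trans bh hc; rewrite -subr_ge0 le_eqVlt => /predU1P[e|e].
    by rewrite /th -e invr0 mulr0.
  rewrite divr_ge0 ?(ltW e) ?subr_ge0//; split => //.
  by rewrite ler_pdivrMr// mul1r lerB.
exists (fun y => \1_o y + th * (\1_c y - \1_o y)); split.
- apply: measurable_funD; first exact: measurable_indic.
  by apply: measurable_funM => //; apply: measurable_funB; exact: measurable_indic.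
- move=> y; rewrite !indicE; have [/set_mem/oc/mem_set ->|_] := boolP (y \in o).
    by rewrite subrr mulr0 addr0 ler01 lexx.
  by case: (y \in c); rewrite ?subr0 ?mulr1 ?mulr0 add0r ?th0 ?th1 ?lexx ?ler01.
- have qo := qgrowth_indic mo; have qc := qgrowth_indic mc.
  rewrite intD ?intZ ?intB//; last 2 first.
  + exact: qgrowthB.
  + by apply: qgrowthZ; exact: qgrowthB.
  rewrite !int_indic// /th.
  have [e|ne] := eqVneq (fine (P c) - fine (P o)) 0.
    rewrite e mulr0 addr0; apply/eqP; rewrite eq_le bh.
    by move/eqP: e; rewrite subr_eq0 => /eqP <-.
  by rewrite divfK// subrKC.
- by move=> y yo; rewrite !indicE !mem_set//; [rewrite subrr mulr0 addr0|exact: oc].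
- move=> y yc; rewrite !indicE !memNset//; last by move/oc.
  by rewrite subrr mulr0 addr0.
Qed.

End local_measure.

Section weighted.
Context {R : realType} {d : nat}.
Local Notation E := 'rV[R]_d.
Implicit Types (P : {measure set E -> \bar R}) (h : R) (x : E).

(** Makes weights in [[0, 1]] and submeasures of mass [h] interchangeable: integrals against [mu]
    become weighted integrals against [P]. *)
Lemma weighted_probability P (f : E -> R) h (mf : measurable_fun setT f)
    (f0 : forall u, 0 <= f u) :
  unit_mass2 P -> (forall u, f u <= 1) -> 0 < h -> \int[P]_u f u = h ->
  exists mu : probability E R,
  [/\ density P mf f0 setT = h%:E,
    forall A, measurable A -> mu A = (h^-1%:E * density P mf f0 A)%E,
    submeasure h P mu &
    forall g, qgrowth g -> \int[mu]_u g u = h^-1 * \int[P]_u (g u * f u)].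
Proof.
move=> P2 f1 h0 fh.
have qf : qgrowth f.
  by apply: qgrowth_bounded => //; exists 1 => u; rewrite ger0_norm.
have dT : density P mf f0 setT = h%:E by rewrite /density -fh EFin_int.
(* The Dirac mass is the default value of [mnormalize] for a total mass 0 or infinite; here the
   total mass is [h > 0]. *)
pose mu : probability E R := mnormalize (density P mf f0) (\d_(0 : E) : probability E R).
have muE A : measurable A -> mu A = (h^-1%:E * density P mf f0 A)%E.
  move=> mA; change (mnormalize (density P mf f0) (\d_(0%R : E) : probability E R) A =
    h^-1%:E * density P mf f0 A)%E.
  rewrite /mnormalize.
  have dT' : (density P mf f0 : {measure set E -> \bar R}) setT = h%:E by [].
  rewrite dT'/= eqe gt_eqF//= muleC.
  by [].
have submu : submeasure h P mu.
  move=> A mA; rewrite muE// muleA -EFinM divff ?gt_eqF// mul1e.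
  rewrite -[leRHS]mul1e -(integral_cst P mA).
  apply: ge0_le_integral => //.
  - by move=> u _; rewrite lee_fin.
  - by apply/measurable_EFinP; exact: measurable_funTS.
  - by move=> u _; rewrite lee_fin.
have mu2 : unit_mass2 mu := submeasure_unit_mass2 h0 submu P2.
have gE0 g : qgrowth g -> (forall u, 0 <= g u) ->
    \int[mu]_u g u = h^-1 * \int[P]_u (g u * f u).
  move=> qg g0; have qgf : qgrowth (fun u => g u * f u).
    by apply: qgrowthM_bounded => //; exists 1 => u; rewrite ger0_norm.
  apply: EFin_inj; rewrite EFin_int// EFinM EFin_int//.
  have hn0 : 0 <= h^-1 by rewrite invr_ge0 ltW.
  rewrite (eq_measure_integral (mscale (NngNum hn0) (density P mf f0))); last first.
    by move=> A mA _; exact: etrans (muE A mA) _.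
  rewrite ge0_integral_mscale//; last 2 first.
  - by apply/measurable_EFinP; case: qg.
  - by move=> u _; rewrite lee_fin.
  rewrite ge0_integral_density//.
  by apply/measurable_EFinP; case: qg.
exists mu; split => // g qg.
have qng := qgrowth_norm qg.
have qgg := qgrowthD qg qng.
have qM g' : qgrowth g' -> qgrowth (fun u => g' u * f u).
  by move=> q; apply: qgrowthM_bounded => //; exists 1 => u; rewrite ger0_norm.
(* A difference of two nonnegative functions of quadratic growth. *)
transitivity (\int[mu]_u ((g u + `|g u|) - `|g u|)).
  by apply: eq_Rintegral => u _; rewrite addrK.
rewrite intB// !gE0//; last first.
  by move=> u; have := ler_norm (- g u); rewrite normrN; lra.
rewrite -mulrBr -intB//; last 2 first.
- exact: qM.
- exact: qM.
congr (_ * _); apply: eq_Rintegral => u _; ring.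
Qed.

(** Bathtub principle: to minimize [int |u - x|^2] under a cap on the density, fill the space
    outwards from [x] until the mass [h] is reached. *)
Lemma local_measure_exists P h x : unit_mass2 P -> 0 < h <= 1 ->
  exists (f : E -> R) (mu : probability E R),
  [/\ measurable_fun setT f /\ (forall u, 0 <= f u <= 1), \int[P]_u f u = h,
    local_measures P h (Fin x) mu,
    (forall g, qgrowth g -> \int[mu]_u g u = h^-1 * \int[P]_u (g u * f u)) &
    forall nu : probability E R, submeasure h P nu ->
    \int[mu]_u sqnorm (u - x) <= \int[nu]_u sqnorm (u - x)].
Proof.
move=> P2 h01; have /andP[h0 h1] := h01.
have [f [mf f01 fh fin fout]] := local_density x P2 h01.
have f0 u : 0 <= f u by case/andP: (f01 u).
have f1 u : f u <= 1 by case/andP: (f01 u).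
have [mu [dT muE submu gE]] := weighted_probability mf f0 P2 f1 h0 fh.
exists f, mu; split => //.
- exists (density P mf f0); split => //.
  + move=> A mA; have := submu A mA; rewrite muE// muleA -EFinM divff ?gt_eqF//.
    by rewrite mul1e.
  + move=> A mA Ain /=; rewrite -[RHS]mul1e -(integral_cst P mA).
    by apply: eq_integral => u /set_mem/Ain/fin ->.
  + by apply: integral0_eq => u /fout ->.
- move=> nu subnu; have nu2 := submeasure_unit_mass2 h0 subnu P2.
  have qx := qgrowth_sqnormB x; rewrite gE//.
  case E : (delta P h x) fin fout => [r| |] fin fout; last 2 first.
  (* Infinite radius forces [h = 1]. Then [nu <= P] on [A] and on its complement, with equal total
     masses, so [nu = P]. *)
  + have hE := delta_pinfty P2 h1 E.
    have nuP A : measurable A -> nu A = P A.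
      move=> mA; apply/eqP; rewrite eq_le; apply/andP; split.
        by have := subnu A mA; rewrite hE mul1e.
      have /= := subnu _ (measurableC mA); rewrite hE mul1e.
      have PC : (P A + P (~` A) = 1)%E.
        rewrite -P2.1 -measureU ?setUv ?setICr//; exact: measurableC.
      move: PC; rewrite probability_setC// -(fine_measureE P2 mA).
      rewrite -(fine_measureE P2 (measurableC mA)) -(fine_measureE nu2 mA).
      by rewrite -EFinD -EFinB !lee_fin => -[]; lra.
    rewrite hE invr1 mul1r [leRHS](_ : _ = \int[P]_u (sqnorm (u - x))).
      rewrite le_eqVlt; apply/orP; left; apply/eqP; apply: eq_Rintegral => u _.
      by rewrite fin ?mulr1// /oball/= ltry.
    by congr fine; apply: eq_measure_integral => A mA _; exact: nuP.
  + by have := delta_ge0 P h x; rewrite E.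
  have r0 : 0 <= r by have := delta_ge0 P h x; rewrite E lee_fin.
  (* The dual certificate: [|u - x|^2 >= r^2 - g] everywhere, with equality wherever [f] is
     positive, [f = 1] wherever [g > 0], and [h int g dnu <= int g dP]. *)
  pose g u := Num.max 0 (r ^+ 2 - sqnorm (u - x)).
  have qg : qgrowth g.
    have qb := qgrowthB (qgrowth_cst (r ^+ 2)) qx.
    case: (qb) => mb [c bc]; split.
      by apply: measurable_maxr.
    exists c => u; rewrite ger0_norm ?le_max ?lexx//.
    apply: le_trans (bc u); rewrite ge_max normr_ge0; exact: ler_norm.
  have fE u : sqnorm (u - x) * f u = r ^+ 2 * f u - g u.
    rewrite /g; have [ur|ur|ur] := ltgtP (enorm (u - x)) r.
    - rewrite fin /oball/= ?lte_fin// max_r ?mulr1; first by ring.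
      by rewrite subr_ge0 le_sqnorm// ltW.
    - rewrite fout /cball/= ?lee_fin; last by apply/negP; rewrite -ltNge.
      rewrite !mulr0 sub0r max_l ?oppr0// subr_le0.
      by rewrite -sqr_enorm ler_sqr ?nnegrE ?enorm_ge0// ltW.
    - by rewrite -ur sqr_enorm subrr max_l ?subr0.
  under eq_Rintegral do rewrite fE.
  have qf : qgrowth f by apply: qgrowth_bounded => //; exists 1 => u; rewrite ger0_norm.
  rewrite intB//; last exact: qgrowthZ.
  rewrite intZ// fh.
  have g0 u : 0 <= g u by rewrite le_max lexx.
  have := submeasure_int_le h0 subnu P2 qg g0.
  have : \int[nu]_u (r ^+ 2 - g u) <= \int[nu]_u sqnorm (u - x).
    apply: le_int => //; first by apply: qgrowthB => //; exact: qgrowth_cst.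
    by move=> u; rewrite lerBlDl -lerBlDr le_max lexx orbT.
  rewrite intB ?int_cst//; last exact: qgrowth_cst.
  move=> le1 le2; rewrite -(ler_pM2l h0) mulrA divff ?gt_eqF// mul1r.
  by nra.
Qed.
End weighted.

(** * Optimal local measures on power cells *)

Section finite_min.
Context {R : realType} {k : nat}.
Implicit Types (a b : 'I_k -> R).

(** The real value of the minimum in [power_min]. On an empty family [fine] would turn [+oo] into 0,
    hence the hypothesis [k0] below. *)
Definition fmin a : R := fine (\big[mine/+oo%E]_(i < k) (a i)%:E).

Lemma bigmine_attained (s : seq 'I_k) a : s != [::] ->
  exists2 i, i \in s & \big[mine/+oo%E]_(j <- s) (a j)%:E = (a i)%:E.
Proof.
elim: s => // i s IH _; rewrite big_cons.
have [->|sn] := eqVneq s [::]; first by exists i; rewrite ?inE// big_nil min_l// leey.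
have [j js ->] := IH sn; rewrite -EFin_min /Num.min; case: ifP => _.
- by exists i; rewrite // inE eqxx.
- by exists j; rewrite // inE js orbT.
Qed.

Lemma bigmine_le (s : seq 'I_k) a i : i \in s ->
  (\big[mine/+oo%E]_(j <- s) (a j)%:E <= (a i)%:E)%E.
Proof.
elim: s => // j s IH; rewrite inE big_cons ge_min => /predU1P[->|/IH ->].
- by rewrite lexx.
- by rewrite orbT.
Qed.

Hypothesis k0 : (0 < k)%N.

Lemma fmin_attained a : exists i, fmin a = a i.
Proof.
have [|i _ e] := @bigmine_attained (index_enum 'I_k) a.
  by rewrite -size_eq0 /index_enum -enumT size_enum_ord -lt0n.
by exists i; rewrite /fmin e.
Qed.

Lemma EFin_fmin a : (fmin a)%:E = \big[mine/+oo%E]_(i < k) (a i)%:E.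
Proof.
have [|i _ e] := @bigmine_attained (index_enum 'I_k) a.
  by rewrite -size_eq0 /index_enum -enumT size_enum_ord -lt0n.
by rewrite /fmin e.
Qed.

Lemma fmin_le a i : fmin a <= a i.
Proof. by rewrite -lee_fin EFin_fmin; apply: bigmine_le; rewrite mem_index_enum. Qed.

Lemma le_fmin a (c : R) : (forall i, c <= a i) -> c <= fmin a.
Proof. by move=> ca; have [i ->] := fmin_attained a. Qed.

Lemma fminD a (c : R) : fmin (fun i => c + a i) = c + fmin a.
Proof.
apply/eqP; rewrite eq_le; apply/andP; split.
  by have [i ->] := fmin_attained a; exact: (fmin_le (fun i => c + a i)).
by apply: le_fmin => i; rewrite lerD2l fmin_le.
Qed.

Lemma fmin_le_add a b (e : R) : (forall i, a i <= b i + e) ->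
  fmin a <= fmin b + e.
Proof.
move=> ab; have [i ->] := fmin_attained b.
exact: le_trans (fmin_le a i) (ab i).
Qed.

Lemma fmin_norm_le a (c : R) : (forall i, `|a i| <= c) -> `|fmin a| <= c.
Proof. by move=> ac; have [i ->] := fmin_attained a. Qed.

End finite_min.

Section best_local.
Context {R : realType} {d : nat}.
Local Notation E := 'rV[R]_d.
Implicit Types (P : {measure set E -> \bar R}) (h : R) (x : E).

Lemma qgrowth_fmin k (F : 'I_k -> E -> R) : (0 < k)%N ->
  (forall i, qgrowth (F i)) -> qgrowth (fun u => fmin (F^~ u)).
Proof.
move=> k0 qF; split.
  apply/measurable_EFinP.
  rewrite (_ : EFin \o _ = fun u => \big[mine/+oo%E]_(i < k) (F i u)%:E); last first.
    by apply/funext => u /=; rewrite EFin_fmin.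
  elim: (index_enum _) => [|i s IH].
    rewrite (_ : (fun u => _) = cst +oo%E); first exact: measurable_cst.
    by apply/funext => u; rewrite big_nil.
  rewrite (_ : (fun u => _) = fun u =>
    mine (F i u)%:E (\big[mine/+oo%E]_(j <- s) (F j u)%:E)); last first.
    by apply/funext => u; rewrite big_cons.
  by apply: measurable_mine => //; apply/measurable_EFinP; case: (qF i).
have /choice[c cF] i := (qF i).2.
exists (\sum_i `|c i|) => u; apply: fmin_norm_le => // i.
apply: (le_trans (cF i u)); rewrite ler_wpM2r ?addr_ge0 ?sqnorm_ge0//.
rewrite (bigD1 i)//= -[leLHS]addr0 lerD ?ler_norm// sumr_ge0//.
Qed.

Lemma qgrowthM_indic f (A : set E) : measurable A -> qgrowth f ->
  qgrowth (fun u => f u * (\1_A u : R)).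
Proof.
move=> mA qf; apply: (qgrowthM_bounded qf); first exact: measurable_indic.
by exists 1 => u; rewrite indicE; case: (_ \in _); rewrite ?normr1 ?normr0.
Qed.

(* The integral over a cell only depends on the centre (v, w) through its value
   at the mean c of the cell. *)
Lemma cell_integral P (A : set E) : unit_mass2 P -> measurable A ->
  exists (c : E) (s : R), forall (v : E) (w : R),
  \int[P]_u ((sqnorm u - 2 * dotv u v + w) * \1_A u) =
  s + fine (P A) * (sqnorm c - 2 * dotv c v + w).
Proof.
move=> P2 mA; pose a := fine (P A).
have q1 := qgrowth_indic mA.
have qs := qgrowthM_indic mA qgrowth_sqnorm.
have qc i := qgrowthM_indic mA (qgrowth_coord i).
pose b : E := \row_i \int[P]_u (u 0 i * \1_A u).
pose s0 := \int[P]_u (sqnorm u * \1_A u).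
have key v w : \int[P]_u ((sqnorm u - 2 * dotv u v + w) * \1_A u) =
    s0 - 2 * dotv b v + w * a.
  have qd := qgrowthM_indic mA (qgrowth_dotv v).
  transitivity (\int[P]_u (sqnorm u * \1_A u - 2 * (dotv u v * \1_A u) +
      w * \1_A u)).
    by apply: eq_Rintegral => u _; ring.
  rewrite intD//; last 2 first.
  - by apply: qgrowthB => //; exact: qgrowthZ.
  - exact: qgrowthZ.
  rewrite intB//; last exact: qgrowthZ.
  rewrite !intZ// int_indic//; congr (_ - 2 * _ + _).
  transitivity (\int[P]_u (\sum_(i < d) v 0 i * (u 0 i * \1_A u))).
    apply: eq_Rintegral => u _; rewrite mulr_suml.
    by apply: eq_bigr => i _; ring.
  rewrite int_sum//; last by move=> i; exact: qgrowthZ.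
  by apply: eq_bigr => i _; rewrite intZ// mxE mulrC.
(* A null cell has no centroid, but its integral vanishes and any centre will do. *)
have [a0|an0] := eqVneq a 0.
  have z f : qgrowth f -> \int[P]_u (f u * \1_A u) = 0.
    move=> qf; apply: EFin_inj.
    rewrite EFin_int//; last exact: qgrowthM_indic.
    transitivity (\int[P]_(u in A) (f u)%:E)%E; last apply: null_set_integral => //.
    - rewrite [in RHS]integral_mkcond; apply: eq_integral => u _.
      by rewrite patchE indicE; case: ifP => _; rewrite ?mulr1 ?mulr0.
    - by apply/measurable_EFinP/measurable_funTS; case: qf.
    - by rewrite -[LHS](fine_measureE P2 mA) -/a a0.
  exists 0, 0 => v w; rewrite -/a a0 mul0r addr0; apply: z.
  apply: qgrowthD; last exact: qgrowth_cst.
  by apply: qgrowthB; [exact: qgrowth_sqnorm|apply: qgrowthZ; exact: qgrowth_dotv].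
(* The centroid of the cell and its moment of inertia about the centroid. *)
exists (a^-1 *: b), (s0 - a * sqnorm (a^-1 *: b)) => v w.
by rewrite key -/a dotvZl; field.
Qed.

(** Ties go to the smallest index, so that the power cells form a measurable partition. *)
Lemma measurable_first_argmin k (F : 'I_k -> E -> R) (i : 'I_k) :
  (forall j, measurable_fun setT (F j)) ->
  measurable [set u | forall j, F i u <= F j u /\ ((j < i)%N -> F i u < F j u)].
Proof.
move=> mF.
rewrite (_ : mkset _ = \bigcap_(j in [set: 'I_k])
  [set u | F i u <= F j u /\ ((j < i)%N -> F i u < F j u)]); last first.
  by apply/seteqP; split => u /= H j => [_|]; exact: H.
apply: fin_bigcap_measurable => // j _.
have m1 : measurable [set u | F i u <= F j u].
  exact: measurable_set_ler (mF i) (mF j).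
have m2 : measurable [set u | F i u < F j u].
  exact: measurable_set_ltr (mF i) (mF j).
have [ji|ij] := boolP (j < i)%N.
  rewrite (_ : mkset _ = [set u | F i u <= F j u] `&` [set u | F i u < F j u]).
    exact: measurableI.
  by apply/seteqP; split => u /= [? H]; split => //; exact: H.
rewrite (_ : mkset _ = [set u | F i u <= F j u])//.
by apply/seteqP; split => u /= [].
Qed.

Lemma first_argmin_exists k (a : 'I_k -> R) : (0 < k)%N ->
  exists i, forall j, a i <= a j /\ ((j < i)%N -> a i < a j).
Proof.
move=> k0; have [i0 i0E] := fmin_attained k0 a.
have [i /eqP ai im] := @arg_minnP _ i0 (fun i => a i == fmin a) id (introT eqP (esym i0E)).
exists i => j; rewrite ai fmin_le//; split => // ji.
rewrite lt_neqAle fmin_le// andbT eq_sym; apply/negP => /im.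
by rewrite leqNgt ji.
Qed.

Lemma first_argmin_unique k (a : 'I_k -> R) i i' :
  (forall j, a i <= a j /\ ((j < i)%N -> a i < a j)) ->
  (forall j, a i' <= a j /\ ((j < i')%N -> a i' < a j)) -> i = i'.
Proof.
move=> H H'; apply/val_inj; case: (ltngtP i i') => // ii'.
- by have := (H' i).2 ii'; rewrite ltNge (H i').1.
- by have := (H i').2 ii'; rewrite ltNge (H' i).1.
Qed.

Definition power (nu : {measure set E -> \bar R}) (u : E) : R :=
  sqnorm u - 2 * dotv u (mean nu) + \int[nu]_v sqnorm v.

Lemma qgrowth_power nu : qgrowth (power nu).
Proof.
apply: qgrowthD; last exact: qgrowth_cst.
by apply: qgrowthB; [exact: qgrowth_sqnorm|apply: qgrowthZ; exact: qgrowth_dotv].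
Qed.

Lemma power_minE k (m : 'I_k -> probability E R) u : (0 < k)%N ->
  (forall i, unit_mass2 (m i)) ->
  power_min m u = (fmin (fun i => power (m i) u))%:E.
Proof.
move=> k0 m2; rewrite EFin_fmin//; apply: eq_bigr => i _.
by rewrite power_distE.
Qed.

(* By [cell_integral], replacing [nu i] by the local measure at the centroid of
   the i-th power cell of [nu] does not increase the integral over this cell. *)
Lemma best_local_measures P h k (nu : 'I_k -> probability E R) :
    unit_mass2 P -> 0 < h <= 1 -> (0 < k)%N -> (forall i, submeasure h P (nu i)) ->
  exists (x : 'I_k -> E) (f : 'I_k -> E -> R) (mu : 'I_k -> probability E R),
  [/\ forall i, measurable_fun setT (f i) /\ (forall u, 0 <= f i u <= 1),
    forall i, \int[P]_u f i u = h,
    admissible P h (fun i => Fin (x i)) mu,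
    (forall i g, qgrowth g -> \int[mu i]_u g u = h^-1 * \int[P]_u (g u * f i u)) &
    \int[P]_u fmin (fun i => power (mu i) u) <=
    \int[P]_u fmin (fun i => power (nu i) u)].
Proof.
move=> P2 h01 k0 subnu; have /andP[h0 h1] := h01.
pose A i := [set u | forall j, power (nu i) u <= power (nu j) u /\
  ((j < i)%N -> power (nu i) u < power (nu j) u)].
have mA i : measurable (A i).
  by apply: measurable_first_argmin => j; case: (qgrowth_power (nu j)).
have nu2 i := submeasure_unit_mass2 h0 (subnu i) P2.
have /choice[c /choice[s cs]] i := cell_integral P2 (mA i).
have /choice[f /choice[mu H]] i := local_measure_exists (c i) P2 h01.
have mu2 i : unit_mass2 (mu i).
  apply: (submeasure_unit_mass2 h0 _ P2); have [_ _ [la [_ laP _ _ muE]] _ _] := H i.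
  by move=> B mB; rewrite muE// muleA -EFinM divff ?gt_eqF// mul1e; exact: laP.
exists c, f, mu; split.
- by move=> i; case: (H i).
- by move=> i; case: (H i).
- by move=> i; case: (H i).
- by move=> i; case: (H i).
have cellsE (F : 'I_k -> E -> R) u : exists2 i, A i u &
    \sum_(j < k) F j u * (\1_(A j) u : R) = F i u.
  have [i Ai] := first_argmin_exists (fun i => power (nu i) u) k0.
  exists i => //; rewrite (bigD1 i)//= indicE mem_set// mulr1 big1 ?addr0// => j ji.
  rewrite indicE memNset ?mulr0// => Aj; move/eqP: ji; apply.
  exact: (first_argmin_unique Aj Ai).
have cellint (m : 'I_k -> probability E R) :
    \int[P]_u (\sum_(j < k) power (m j) u * (\1_(A j) u : R)) =
    \sum_(j < k) (s j + fine (P (A j)) * power (m j) (c j)).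
  rewrite int_sum//; last by move=> j; apply: qgrowthM_indic => //; exact: qgrowth_power.
  by apply: eq_bigr => j _; rewrite /power cs.
have qsum (m : 'I_k -> probability E R) :
    qgrowth (fun u => \sum_(j < k) power (m j) u * (\1_(A j) u : R)).
  by apply: qgrowth_sum => // j; apply: qgrowthM_indic => //; exact: qgrowth_power.
have qmin (m : 'I_k -> probability E R) : qgrowth (fun u => fmin (fun i => power (m i) u)).
  by apply: qgrowth_fmin => // i; exact: qgrowth_power.
(* Freeze the assignment to the cells of [nu]: this can only increase the criterion of [mu], it
   leaves that of [nu] unchanged, and the two are then compared cell by cell. *)
apply: (@le_trans _ _ (\int[P]_u (\sum_(j < k) power (mu j) u * (\1_(A j) u : R)))).
  apply: le_int => // u.
  by have [i _ ->] := cellsE (fun i => power (mu i)) u; exact: fmin_le.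
apply: (@le_trans _ _ (\int[P]_u (\sum_(j < k) power (nu j) u * (\1_(A j) u : R)))).
  rewrite !cellint; apply: ler_sum => j _; rewrite lerD2l ler_wpM2l//.
  have [_ _ _ _ /(_ _ (subnu j))] := H j.
  by rewrite !int_sqnormB.
apply: le_int => // u.
have [i Ai ->] := cellsE (fun i => power (nu i)) u.
by apply: le_fmin => // j; exact: (Ai j).1.
Qed.

End best_local.

(** * Hoeffding's inequality *)

Section hoeffding.
Context {dO dT : measure_display} {Omega : measurableType dO}
  {T : measurableType dT} {R : realType} (Pr : probability Omega R).

Lemma measurable_prodr (I : Type) (s : seq I) (F : I -> Omega -> R) :
  (forall i, measurable_fun setT (F i)) ->
  measurable_fun setT (fun w => \prod_(i <- s) F i w).
Proof.
move=> mF; elim: s => [|i s IH].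
  rewrite (_ : (fun w => _) = cst 1); first exact: measurable_cst.
  by apply/funext => w; rewrite big_nil.
rewrite (_ : (fun w => _) = fun w => F i w * \prod_(j <- s) F j w).
  exact: measurable_funM.
by apply/funext => w; rewrite big_cons.
Qed.

(** The hypothesis on indicators says that [X] maps the measure of density [W] to [c] times the law
    of [X]; integrating [F] against both sides gives the claim. [W] will be the product of the other
    factors. *)
Lemma integral_mul_comp_RV (X : {RV Pr >-> T}) (W : Omega -> R) (F : T -> R) (c : R) :
  measurable_fun setT W -> (forall w, 0 <= W w) ->
  measurable_fun setT F -> (forall x, 0 <= F x) -> 0 <= c ->
  (forall B, measurable B ->
    \int[Pr]_w (W w * \1_B (X w))%:E = c%:E * Pr (X @^-1` B))%E ->
  (\int[Pr]_w (W w * F (X w))%:E = c%:E * \int[Pr]_w (F (X w))%:E)%E.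
Proof.
move=> mW W0 mF F0 c0 WB.
have mX : measurable_fun setT X by [].
have mEF : measurable_fun setT (EFin \o F) by exact/measurable_EFinP.
have F0' : {in [set: T], forall y, 0 <= (EFin \o F) y}%E.
  by move=> y _; rewrite lee_fin.
transitivity (\int[pushforward (density Pr mW W0) X]_y (F y)%:E)%E.
  rewrite (ge0_integral_pushforward mX)// preimage_setT.
  rewrite ge0_integral_density//=; last 2 first.
  - exact: measurableT_comp.
  - by move=> w; rewrite lee_fin.
  by apply: eq_integral => w _; rewrite -EFinM mulrC.
rewrite (eq_measure_integral (mscale (NngNum c0) (pushforward Pr X))); last first.
  move=> B mB _; transitivity (c%:E * Pr (X @^-1` B))%E; last by [].
  rewrite -WB// /= /pushforward /= /density integral_mkcond.
  apply: eq_integral => w _; rewrite patchE indicE.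
  rewrite (_ : (w \in X @^-1` B) = (X w \in B)); last by apply/idP/idP => /set_mem ?; apply/mem_set.
  by case: ifP => _; rewrite ?mulr1 ?mulr0.
rewrite ge0_integral_mscale//; last by move=> y _; rewrite lee_fin.
by rewrite (ge0_integral_pushforward mX)// preimage_setT.
Qed.

(* The induction replaces the indicators in the definition of independence by
   the functions [F i], one index at a time. *)
Lemma independent_integral_prod n (X : 'I_n -> {RV Pr >-> T})
    (F : 'I_n -> T -> R) (e : 'I_n -> R) :
  mutually_independent X ->
  (forall i, measurable_fun setT (F i)) -> (forall i x, 0 <= F i x) ->
  (forall i, \int[Pr]_w (F i (X i w))%:E = (e i)%:E)%E ->
  (\int[Pr]_w (\prod_i F i (X i w))%:E = (\prod_i e i)%:E)%E.
Proof.
move=> indX mF F0 Fe.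
have e0 i : 0 <= e i.
  by rewrite -lee_fin -Fe; apply: integral_ge0 => w _; rewrite lee_fin.
have mXA i A : measurable A -> measurable (X i @^-1` A).
  by move=> mA; rewrite -[X in measurable X]setTI; exact: measurable_funPT.
have p A : measurable A -> Pr A = (fine (Pr A))%:E.
  by move=> mA; rewrite fineK// fin_num_measure.
(* The first [m] factors are already functions, the others still indicators: [m = 0] is
   independence, [m = n] the claim. *)
suff H m : (m <= n)%N -> forall A : 'I_n -> set T, (forall i, measurable (A i)) ->
   (\int[Pr]_w (\prod_(i < n) (if (i < m)%N then F i (X i w) else \1_(A i) (X i w)))%:E =
    (\prod_(i < n) (if (i < m)%N then e i else fine (Pr (X i @^-1` A i))))%:E)%E.
  have := H n (leqnn n) (fun=> setT) (fun=> measurableT).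
  under eq_integral do (under eq_bigr do rewrite ltn_ord).
  by under [in RHS]eq_bigr do rewrite ltn_ord.
elim: m => [_ A mA|m IH mn A mA].
  have := indX [set: 'I_n]%SET A mA; set cap := \bigcap_(i in _) _ => capE.
  have mcap : measurable cap by apply: fin_bigcap_measurable => // i _; exact: mXA.
  transitivity (Pr cap).
    rewrite -[cap]setIT -integral_indic//; apply: eq_integral => w _.
    congr EFin; rewrite indicE; have [/set_mem wcap|/negP wcap] := boolP (w \in cap).
      by rewrite big1// => i _; rewrite indicE mem_set//; apply: wcap; rewrite /= inE.
    apply/eqP/prodf_eq0; apply: contrapT => H; apply: wcap; apply/mem_set => i _ /=.
    apply: contrapT => Ai; apply: H; exists i => //.
    by rewrite indicE memNset.
  rewrite capE (big_morph EFin (@EFinM R) erefl); apply: eq_big => [i|i _].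
    by rewrite inE.
  exact/p/mXA.
pose j := Ordinal mn.
pose G (i : 'I_n) w := if (i < m.+1)%N then F i (X i w) else \1_(A i) (X i w) : R.
pose g (i : 'I_n) := if (i < m.+1)%N then e i else fine (Pr (X i @^-1` A i)).
have g0 i : 0 <= g i by rewrite /g; case: ifP => _; rewrite ?e0 ?fine_ge0.
have ltj i : i != j -> (i < m)%N = (i < m.+1)%N.
  by move=> ij; rewrite ltnS (leq_eqVlt i m) (_ : (nat_of_ord i == m) = false)//; exact/negbTE.
have mG i : measurable_fun setT (G i).
  rewrite /G; case: (i < m.+1)%N; first exact: measurableT_comp.
  by apply: measurableT_comp => //; exact: measurable_indic.
have G0 i w : 0 <= G i w by rewrite /G; case: ifP.
transitivity (\int[Pr]_w ((\prod_(i | i != j) G i w) * F j (X j w))%:E)%E.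
  apply: eq_integral => w _; rewrite (bigD1 j)//= ltnSn mulrC.
  by [].
rewrite (@integral_mul_comp_RV (X j) (fun w => \prod_(i | i != j) G i w) (F j)
  (\prod_(i | i != j) g i)) //.
- by rewrite Fe -EFinM [in RHS](bigD1 j)//= ltnSn mulrC.
- under [X in measurable_fun _ X]eq_fun do rewrite -big_filter.
  exact: measurable_prodr.
- by move=> w; exact: prodr_ge0.
- exact: prodr_ge0.
(* With the test set [B] at index [j = m], the induction hypothesis is exactly the required identity
   on indicators. *)
- move=> B mB; pose A' i := if i == j then B else A i.
  have mA' i : measurable (A' i) by rewrite /A'; case: ifP.
  have := IH (ltnW mn) A' mA'.
  rewrite [in X in _ = X -> _](bigD1 j)//= ltnn {2}/A' eqxx => IHB.
  rewrite (p _ (mXA j B mB)) -EFinM mulrC.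
  transitivity (\int[Pr]_w (\prod_(i < n)
    (if (i < m)%N then F i (X i w) else \1_(A' i) (X i w)))%:E)%E.
    apply: eq_integral => w _; rewrite [in RHS](bigD1 j)//= ltnn {1}/A' eqxx mulrC.
    congr (_ * _)%:E; apply: eq_bigr => i ij.
    by rewrite (ltj i ij) /G /A' (negbTE ij).
  rewrite IHB; congr (_ * _)%:E; apply: eq_bigr => i ij.
  by rewrite (ltj i ij) /g /A' (negbTE ij).
Qed.

(** [exp x <= 1 / (1 - x)], and [(1 + x + 2 x^2) (1 - x) = 1 + x^2 (1 - 2 x) >= 1]. *)
Lemma expR_le_quadratic (x : R) : x <= 1 / 2 -> expR x <= 1 + x + 2 * x ^+ 2.
Proof.
move=> x12; have h : 1 - x <= expR (- x) by have := expR_ge1Dx (- x); lra.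
have e0 := expR_gt0 x.
have : expR x * (1 - x) <= 1.
  by rewrite -[leRHS](expRxMexpNx_1 x) ler_wpM2l// ltW.
have : 1 <= (1 + x + 2 * x ^+ 2) * (1 - x) by have := sqr_ge0 x; nra.
nra.
Qed.

Variable Q : probability T R.

Lemma bounded_integrable (V : T -> R) (c : R) : measurable_fun setT V ->
  (forall x, `|V x| <= c) -> Q.-integrable setT (EFin \o V).
Proof.
move=> mV Vc; apply: measurable_bounded_integrable => //.
  by rewrite (le_lt_trans (probability_le1 Q measurableT))// ltry.
exists c; split; first exact: num_real.
by move=> x cx y _; apply: le_trans (Vc y) (ltW cx).
Qed.

Lemma bounded_Rintegral_le (V : T -> R) (c : R) : measurable_fun setT V ->
  (forall x, `|V x| <= c) -> `|\int[Q]_x V x| <= c.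
Proof.
move=> mV Vc; apply: le_trans (le_normr_Rintegral measurableT (bounded_integrable mV Vc)) _.
have -> : c = \int[Q]_x c.
  by rewrite Rintegral_cst// [X in fine X]probability_setT mulr1.
apply: le_Rintegral => //.
- apply: (@bounded_integrable _ c) => [|x]; last by rewrite normr_id.
  exact: measurableT_comp.
- by apply: (@bounded_integrable _ `|c|).
Qed.

(** The exponent is at most [2 s <= 1/2], so the quadratic bound applies; its linear term integrates
    to 0 and its square term is at most [2 (2 s)^2 = 8 s^2]. *)
Lemma mgf_le (V : T -> R) (s : R) : measurable_fun setT V ->
  (forall x, `|V x| <= 1) -> 0 <= s <= 1 / 4 ->
  \int[Q]_x expR (s * (V x - \int[Q]_y V y)) <= expR (8 * s ^+ 2).
Proof.
move=> mV V1 /andP[s0 s14]; set mu := \int[Q]_y V y.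
have mu1 : `|mu| <= 1 by exact: bounded_Rintegral_le.
have V2 x : `|V x - mu| <= 2.
  by rewrite (le_trans (ler_normB _ _))//; have := V1 x; lra.
have iV := bounded_integrable mV V1.
have ic (c : R) : Q.-integrable setT (EFin \o (fun=> c)).
  by apply: (@bounded_integrable _ `|c|).
have mVmu : measurable_fun setT (fun x => V x - mu) by exact: measurable_funB.
have iVmu : Q.-integrable setT (EFin \o (fun x => V x - mu)).
  exact: bounded_integrable mVmu V2.
have int1 (c : R) : \int[Q]_x c = c.
  by rewrite Rintegral_cst// [X in fine X]probability_setT mulr1.
have isVmu : Q.-integrable setT (EFin \o (fun x => s * (V x - mu))).
  apply: (@bounded_integrable _ (s * 2)) => [|x]; first exact: measurable_funM.
  by rewrite normrM ger0_norm// ler_wpM2l.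
apply: le_trans (_ : \int[Q]_x (s * (V x - mu) + (1 + 8 * s ^+ 2)) <= _).
  apply: le_Rintegral => //.
  - apply: (@bounded_integrable _ (expR (s * 2))) => [|x].
      by apply: measurableT_comp => //; exact: measurable_funM.
    rewrite ger0_norm ?expR_ge0// ler_expR ler_wpM2l//.
    exact: le_trans (ler_norm _) (V2 x).
  - apply: (@bounded_integrable _ (s * 2 + (1 + 8 * s ^+ 2))) => [|x].
      by apply: measurable_funD => //; exact: measurable_funM.
    rewrite (le_trans (ler_normD _ _))// lerD//.
      by rewrite normrM ger0_norm// ler_wpM2l.
    by rewrite ger0_norm//; have := sqr_ge0 s; lra.
  - move=> x _; have := V2 x; rewrite ler_norml => /andP[v1 v2].
    apply: (le_trans (expR_le_quadratic _)); first by nra.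
    have : (V x - mu) ^+ 2 <= 4 by nra.
    have := sqr_ge0 s; rewrite exprMn => ss vv.
    have := ler_wpM2l ss vv; lra.
rewrite RintegralD// RintegralZl// RintegralB// !int1 subrr mulr0 add0r.
exact: expR_ge1Dx.
Qed.

Lemma ge0_integral_RV (X : {RV Pr >-> T}) (F : T -> R) :
  (forall A, measurable A -> distribution Pr X A = Q A) ->
  measurable_fun setT F -> (forall x, 0 <= F x) ->
  (\int[Pr]_w (F (X w))%:E = \int[Q]_x (F x)%:E)%E.
Proof.
move=> XQ mF F0; have mX : measurable_fun setT X by [].
rewrite -(@eq_measure_integral _ _ _ setT Q (distribution Pr X)); last first.
  by move=> A mA _; exact: XQ.
rewrite (ge0_integral_pushforward mX)// ?preimage_setT//.
  exact/measurable_EFinP.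
by move=> y _; rewrite lee_fin.
Qed.

Section sample.
Variables (n : nat) (X : 'I_n -> {RV Pr >-> T}).
Hypothesis iidX : iid X Q.

Definition smean (V : T -> R) (w : Omega) : R := n%:R^-1 * \sum_i V (X i w).

Lemma measurable_smean V : measurable_fun setT V -> measurable_fun setT (smean V).
Proof.
move=> mV; apply: measurable_funM => //; apply: measurable_sum => i.
exact: measurableT_comp.
Qed.

Lemma measurable_deviation (V : T -> R) (t a : R) : measurable_fun setT V ->
  measurable [set w | t <= smean V w - a].
Proof.
move=> mV.
have mS : measurable_fun setT (fun w => smean V w - a).
  by apply: measurable_funB => //; exact: measurable_smean.
exact: measurable_set_ler (measurable_cst t) mS.
Qed.

Lemma hoeffding_upper (V : T -> R) (t : R) : (0 < n)%N -> 0 < t ->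
  measurable_fun setT V -> (forall x, `|V x| <= 1) ->
  (Pr [set w | (t <= smean V w - \int[Q]_x V x)%R] <=
    (expR (- (n%:R * t ^+ 2 / 32)))%:E)%E.
Proof.
move=> n0 t0 mV V1; set mu := \int[Q]_x V x; set A := mkset _.
have mu1 : `|mu| <= 1 by exact: bounded_Rintegral_le.
have nR : 0 < n%:R :> R by rewrite ltr0n.
have mA : measurable A by exact: measurable_deviation.
have S1 w : `|smean V w| <= 1.
  rewrite normrM ger0_norm ?invr_ge0// ler_pdivrMl// mulr1.
  apply: (le_trans (ler_norm_sum _ _ _)); apply: le_trans (ler_sum _ (fun i _ => V1 _)) _.
  by rewrite sumr_const card_ord.
(* Two means of functions bounded by 1 differ by at most 2; for [t <= 2] the parameter [s] below is
   admissible in [mgf_le]. *)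
have [t2|t2] := ltP 2 t.
  rewrite (_ : A = set0) ?measure0 ?lee_fin ?expR_ge0//.
  apply/seteqP; split => // w /=; rewrite /A/=.
  by have := S1 w; move: mu1; rewrite !ler_norml; lra.
(* The minimizer of [8 s^2 - s t], with minimum [- t^2 / 32]. *)
pose s := t / 16.
have s14 : 0 <= s <= 1 / 4 by rewrite /s; lra.
pose F (i : 'I_n) x := expR (s * (V x - mu)).
have mF i : measurable_fun setT (F i).
  apply: measurableT_comp => //; apply: measurable_funM => //; exact: measurable_funB.
have F0 i x : 0 <= F i x by exact: expR_ge0.
have FE i : (\int[Pr]_w (F i (X i w))%:E = (\int[Q]_x F i x)%:E)%E.
  rewrite (ge0_integral_RV (iidX.2 i))// /Rintegral fineK//.
  apply: integrable_fin_num => //; apply: (@bounded_integrable _ (expR (s * 2))) => // x.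
  rewrite ger0_norm// ler_expR ler_wpM2l//; first by case/andP: s14.
  by have := V1 x; move: mu1; rewrite !ler_norml; lra.
have prodE := independent_integral_prod iidX.1 mF F0 FE.
have key : ((expR (s * n%:R * t))%:E * Pr A <= (expR (8 * s ^+ 2) ^+ n)%:E)%E.
  apply: (@le_trans _ _ (\prod_(i < n) \int[Q]_x F i x)%:E); last first.
    rewrite lee_fin -[X in _ ^+ X]card_ord -prodr_const; apply: ler_prod => i _.
    by rewrite Rintegral_ge0//= mgf_le.
  rewrite -prodE -integral_cst//.
  rewrite integral_mkcond; apply: ge0_le_integral => //.
  - by move=> w _; rewrite patchE; case: ifP => _ //; rewrite lee_fin expR_ge0.
  - apply/(measurable_restrictT _ mA); exact: measurable_cst.
  - apply/measurable_EFinP; apply: measurable_prodr => i; exact: measurableT_comp.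
  - move=> w _; rewrite patchE; case: ifP => [/set_mem Aw|_]; last first.
      by rewrite lee_fin prodr_ge0.
    rewrite /= lee_fin /F -expR_sum ler_expR -mulr_sumr -mulrA ler_wpM2l//.
      by case/andP: s14.
    rewrite sumrB sumr_const card_ord -[mu *+ n]mulr_natl -ler_pdivlMl//.
    apply: (le_trans Aw); rewrite /smean mulrBr mulKf ?gt_eqF//.
rewrite -(lee_pmul2l _ (_ : 0 < (expR (s * n%:R * t))%:E)%E)//.
- apply: (le_trans key); rewrite -EFinM lee_fin -expRM_natl -expRD ler_expR.
  by rewrite /s -mulr_natl; lra.
- by rewrite lte_fin expR_gt0.
Qed.

Lemma union_bound (I : finType) (A : I -> set Omega) (c : R) :
  (forall i, measurable (A i)) -> (forall i, Pr (A i) <= c%:E)%E ->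
  measurable [set w | exists i, A i w] /\
  (Pr [set w | exists i, A i w] <= (#|I|%:R * c)%:E)%E.
Proof.
move=> mA Ac.
suff H s : measurable [set w | exists2 i, i \in s & A i w] /\
    (Pr [set w | exists2 i, i \in s & A i w] <= ((size s)%:R * c)%:E)%E.
  have := H (enum I); rewrite -cardE.
  rewrite (_ : [set w | exists2 i, i \in enum I & A i w] = [set w | exists i, A i w])//.
  apply/seteqP; split => [w [i _ Aw]|w [i Aw]]; exists i => //.
  by rewrite mem_enum.
elim: s => [|i s [IHm IH]].
  rewrite (_ : mkset _ = set0); last by apply/seteqP; split => // w [].
  by rewrite measure0 mul0r; split.
rewrite (_ : mkset _ = A i `|` [set w | exists2 i, i \in s & A i w]); last first.
  apply/seteqP; split => [w [j]|w [Aw|[j js Aw]]].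
  - by rewrite inE => /predU1P[->|js Aw]; [left|right; exists j].
  - by exists i => //; rewrite inE eqxx.
  - by exists j => //; rewrite inE js orbT.
split; first exact: measurableU.
apply: (le_trans (measureU2 _ _ _)) => //.
by rewrite /= -natr1 mulrDl mul1r addrC EFinD leeD.
Qed.

Lemma hoeffding_family (I : finType) (V : I -> T -> R) (t : R) : (0 < n)%N -> 0 < t ->
  (forall i, measurable_fun setT (V i)) -> (forall i x, `|V i x| <= 1) ->
  exists B : set Omega, [/\ measurable B,
    (Pr B <= (2 * #|I|%:R * expR (- (n%:R * t ^+ 2 / 32)))%:E)%E &
    forall w, ~ B w -> forall i, `|smean (V i) w - \int[Q]_x V i x| <= t].
Proof.
(* Adding the opposite functions to the family makes the one-sided bound two-sided, whence the
   factor 2. *)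
move=> n0 t0 mV V1; pose sg (b : bool) : R := if b then 1 else - 1.
pose VV (ib : I * bool) x := sg ib.2 * V ib.1 x.
have mVV ib : measurable_fun setT (VV ib) by exact: measurable_funM.
have VV1 ib x : `|VV ib x| <= 1.
  by rewrite normrM /sg; case: ib.2; rewrite ?normrN normr1 mul1r.
pose A ib := [set w | t <= smean (VV ib) w - \int[Q]_x VV ib x].
have mA ib : measurable (A ib).
  exact: measurable_deviation.
have AE ib := hoeffding_upper n0 t0 (mVV ib) (VV1 ib).
have [mB PB] := union_bound mA AE.
exists [set w | exists ib, A ib w]; split => //.
  by move: PB; rewrite card_prod card_bool natrM (mulrC _ 2).
move=> w nB i; rewrite leNgt; apply/negP => ti; apply: nB.
have [d0|d0] := leP 0 (smean (V i) w - \int[Q]_x V i x).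
  exists (i, true); rewrite /A/= /VV /sg/=; move: ti; rewrite ger0_norm// => /ltW.
  by rewrite /smean; under eq_bigr do rewrite -[V i _]mul1r;
    under eq_Rintegral do rewrite -[V i _]mul1r.
exists (i, false); rewrite /A/= /VV /sg/=; move: ti; rewrite ltr0_norm// => /ltW.
rewrite RintegralZl//; last exact: bounded_integrable (mV i) (V1 i).
by rewrite /smean -mulr_sumr; lra.
Qed.

End sample.
End hoeffding.

(** * Sub-Gaussian moments and tails *)

Section sub_gaussian_moments.
Context {R : realType} {d : nat} {dO : measure_display}
  {Omega : measurableType dO} (Pr : probability Omega R).
Local Notation E := 'rV[R]_d.

(* The sum of the series [e^(j + 1) * e^(- 2 j)]. *)
Definition gauss_const : R := expR 1 / (1 - expR (-1)).

Lemma expRN1_lt1 : expR (-1) < 1 :> R.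
Proof. by rewrite -[ltRHS]expR0 ltr_expR ltrN10. Qed.

Lemma gauss_const_ge1 : 1 <= gauss_const.
Proof.
rewrite /gauss_const ler_pdivlMr ?subr_gt0 ?expRN1_lt1// mul1r.
have := expR_gt0 (-1 : R); have := expR_ge1Dx (1 : R); lra.
Qed.

Variables (Z : {RV Pr >-> E}) (sigma : R).
Hypotheses (s0 : 0 < sigma) (Zsg : sub_gaussian sigma (distribution Pr Z)).

Lemma measurable_comp_RV (f : E -> R) : measurable_fun setT f ->
  measurable_fun setT (fun w => f (Z w)).
Proof. by move=> mf; exact: measurableT_comp. Qed.

Lemma sub_gaussian_tail (t : R) : sigma < t ->
  (Pr [set w | (t <= enorm (Z w))%R] <= (expR (- (t ^+ 2 / (2 * sigma ^+ 2))))%:E)%E.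
Proof.
move=> st; apply: le_trans (Zsg st); rewrite le_eqVlt; apply/orP; left.
apply/eqP; congr (Pr _); apply/seteqP; split => w /=; rewrite /oball/= subr0 lte_fin.
- by rewrite ltNge => H; apply/negP; rewrite negbK.
- by move=> /negP; rewrite -leNgt.
Qed.

(** Slice by the integer part [j] of [x = |Z|^2 / (4 sigma^2)]: there [exp x <= exp (j + 1)], while
    [x >= j] has probability at most [exp (- 2 j)]. *)
Lemma sub_gaussian_exp_moment :
  (\int[Pr]_w (expR (sqnorm (Z w) / (4 * sigma ^+ 2)))%:E <= gauss_const%:E)%E.
Proof.
pose x w := sqnorm (Z w) / (4 * sigma ^+ 2).
have s4 : 0 < 4 * sigma ^+ 2 by rewrite mulr_gt0// exprn_gt0.
have mx : measurable_fun setT x.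
  by apply: measurable_funM => //; apply: measurable_comp_RV; exact: measurable_sqnorm.
have x0 w : 0 <= x w by rewrite divr_ge0 ?sqnorm_ge0 ?ltW.
pose A j := [set w | j%:R <= x w].
have mA j : measurable (A j).
  exact: measurable_set_ler (measurable_cst (j%:R : R)) mx.
have PA j : (Pr (A j) <= (expR (- (2 * j%:R)))%:E)%E.
  case: j => [|j]; first by rewrite mulr0 oppr0 expR0; exact: probability_le1.
  (* The radius where [x = j.+1]. It exceeds [sigma], as [sub_gaussian] requires; for [j = 0] the
     trivial bound 1 was used. *)
  pose t := 2 * sigma * Num.sqrt j.+1%:R.
  have j1 : 1 <= Num.sqrt j.+1%:R :> R by rewrite -[leLHS]sqrtr1 ler_wsqrtr// ler1n.
  have st : sigma < t.
    apply: (@lt_le_trans _ _ (2 * sigma)); first by rewrite ltr_pMl// ltr1n.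
    by rewrite ler_peMr// mulr_ge0// ltW.
  have tt : t ^+ 2 = 4 * sigma ^+ 2 * j.+1%:R by rewrite /t !exprMn sqr_sqrtr//; ring.
  have -> : 2 * j.+1%:R = t ^+ 2 / (2 * sigma ^+ 2) by rewrite tt; field; rewrite gt_eqF.
  rewrite (_ : A j.+1 = [set w | t <= enorm (Z w)]); first exact: sub_gaussian_tail.
  have t0 : 0 <= t by rewrite ltW// (lt_trans s0).
  apply/seteqP; split => w; rewrite /A/= /x ler_pdivlMr// mulrC -tt -sqr_enorm.
    by rewrite ler_sqr ?nnegrE ?enorm_ge0.
  by move=> tz; rewrite ler_sqr ?nnegrE ?enorm_ge0.
pose g j w : \bar R := (expR (j%:R + 1) * \1_(A j) w)%:E.
have mg j : measurable_fun setT (g j).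
  by apply/measurable_EFinP; apply: measurable_funM => //; exact: measurable_indic.
have g0 j w : (0 <= g j w)%E by rewrite lee_fin mulr_ge0// expR_ge0.
apply: (@le_trans _ _ (\int[Pr]_w \sum_(0 <= j <oo) g j w)%E).
  apply: ge0_le_integral => //.
  - by apply/measurable_EFinP; apply: measurableT_comp.
  - exact: ge0_emeasurable_sum.
  - move=> w _; pose j := Num.truncn (x w).
    apply: (@le_trans _ _ (g j w)).
      rewrite /g indicE mem_set ?mulr1 ?lee_fin ?ler_expR; last first.
        by rewrite /A/= truncn_le.
      by rewrite natr1 ltW// truncnS_gt.
    apply: le_trans (nneseries_lim_ge j.+1 _) => //.
    by rewrite big_nat_recr//= leeDr// sume_ge0.
rewrite integral_nneseries//.
apply: (@le_trans _ _ (\sum_(0 <= j <oo) (expR 1 * expR (-1) ^+ j)%:E)%E).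
  apply: lee_nneseries => j _; first by move=> _; exact: integral_ge0.
  under eq_integral do rewrite /g EFinM.
  rewrite ge0_integralZl//; last by apply/measurable_EFinP; exact: measurable_indic.
  rewrite integral_indic// setIT.
  apply: le_trans (lee_wpmul2l _ (PA j)) _; first by rewrite lee_fin expR_ge0.
  rewrite -EFinM lee_fin -expRM_natr -!expRD ler_expR mulN1r.
  by move: (j%:R : R) => jR; lra.
have /cvg_lim : ((fun n => \sum_(0 <= j < n) (expR 1 * expR (-1) ^+ j)%:E)%E @ \oo -->
    gauss_const%:E)%E.
  rewrite (_ : (fun n => _) = EFin \o series (geometric (expR 1) (expR (-1)))).
    apply: cvg_EFin; first exact: nearW.
    apply: cvg_geometric_series.
    by rewrite ger0_norm ?expR_ge0// expRN1_lt1.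
  by apply/funext => m /=; rewrite /series/= sumEFin.
by move=> ->.
Qed.

(** [|Z| <= 2 sigma (1 + x) <= 2 sigma exp x] with the same [x]. Being linear in [sigma], this bound
    yields the term [K sigma / sqrt h]. *)
Lemma sub_gaussian_enorm : (\int[Pr]_w (enorm (Z w))%:E <= (2 * sigma * gauss_const)%:E)%E.
Proof.
apply: (@le_trans _ _ (\int[Pr]_w ((2 * sigma)%:E *
    (expR (sqnorm (Z w) / (4 * sigma ^+ 2)))%:E))%E).
  apply: ge0_le_integral => //.
  - by move=> w _; rewrite lee_fin enorm_ge0.
  - by apply/measurable_EFinP; apply: measurable_comp_RV; exact: measurable_enorm.
  - apply: measurable_funeM; apply/measurable_EFinP; apply: measurableT_comp => //.
    by apply: measurable_funM => //; apply: measurable_comp_RV; exact: measurable_sqnorm.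
  - move=> w _; rewrite -EFinM lee_fin.
    have /(le_trans _) : 1 + sqnorm (Z w) / (4 * sigma ^+ 2) <= _ := expR_ge1Dx _.
    set x := _ / _ => H.
    have xE : enorm (Z w) ^+ 2 = x * (4 * sigma ^+ 2).
      by rewrite sqr_enorm /x divfK// gt_eqF// mulr_gt0// exprn_gt0.
    have : enorm (Z w) <= 2 * sigma * (1 + x).
      have := sqr_ge0 (enorm (Z w) - 2 * sigma).
      have := mulr_ge0 (ltW s0) (enorm_ge0 (Z w)).
      move=> h1 h2; rewrite -(ler_pM2l s0); move: h2; rewrite sqrrB xE; lra.
    move=> /le_trans; apply; rewrite ler_pM2l ?mulr_gt0//; exact: H.
rewrite ge0_integralZl//.
- rewrite [leRHS]EFinM lee_wpmul2l ?lee_fin ?mulr_ge0 ?(ltW s0)//.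
  exact: sub_gaussian_exp_moment.
- apply/measurable_EFinP; apply: measurableT_comp => //.
  by apply: measurable_funM => //; apply: measurable_comp_RV; exact: measurable_sqnorm.
- by rewrite lee_fin mulr_ge0// ltW.
Qed.

Variables (X Y : {RV Pr >-> E}) (K : R).
Hypotheses (XYZ : forall w, X w = Y w + Z w) (sK : sigma <= K)
  (YK : Pr [set w | (K <= enorm (Y w))%R] = 0).

Lemma ae_enorm_lt : {ae Pr, forall w, enorm (Y w) < K}.
Proof.
exists [set w | K <= enorm (Y w)]; split => //.
  have mY : measurable_fun setT (fun w => enorm (Y w)).
    by apply: measurableT_comp => //; exact: measurable_enorm.
  exact: measurable_set_ler (measurable_cst K) mY.
by move=> w /= /negP; rewrite -leNgt.
Qed.

Let S w : \bar R := (expR (sqnorm (Z w) / (4 * sigma ^+ 2)))%:E.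

Let mS : measurable_fun setT S.
Proof.
apply/measurable_EFinP; apply: measurableT_comp => //.
by apply: measurable_funM => //; apply: measurable_comp_RV; exact: measurable_sqnorm.
Qed.

Let S0 w : (0 <= S w)%E. Proof. by rewrite lee_fin expR_ge0. Qed.

Let mXc (f : E -> R) : measurable_fun setT f -> measurable_fun setT (fun w => f (X w)).
Proof. by move=> mf; exact: measurableT_comp. Qed.

(** [|X|^2 <= 2 |Y|^2 + 2 |Z|^2 <= 2 K^2 + 8 sigma^2 x], then [x <= exp x] and [sigma <= K]. *)
Lemma noisy_sqnorm : (\int[Pr]_w (sqnorm (X w))%:E <= (10 * gauss_const * K ^+ 2)%:E)%E.
Proof.
have G1 := gauss_const_ge1.
apply: (@le_trans _ _ (\int[Pr]_w ((2 * K ^+ 2)%:E + (8 * sigma ^+ 2)%:E * S w))%E).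
  apply: ae_ge0_le_integral => //.
  - by move=> w _; rewrite lee_fin sqnorm_ge0.
  - by apply/measurable_EFinP; apply: mXc; exact: measurable_sqnorm.
  - by move=> w _; rewrite adde_ge0// ?mule_ge0// lee_fin mulr_ge0// sqr_ge0.
  - by apply: emeasurable_funD => //; exact: measurable_funeM.
  - apply: filterS ae_enorm_lt => w YwK _.
    rewrite -EFinM -EFinD lee_fin XYZ -[X in sqnorm (_ + X)]opprK.
    apply: (le_trans (sqnormB_le _ _)).
    have <- : sqnorm (Z w) = sqnorm (- Z w) by rewrite /sqnorm dotvNl dotvNr opprK.
    apply: lerD; first by rewrite ler_pM2l// le_sqnorm// ltW.
    have := expR_ge1Dx (sqnorm (Z w) / (4 * sigma ^+ 2)).
    set x := _ / _ => H.
    have -> : sqnorm (Z w) = x * (4 * sigma ^+ 2).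
      by rewrite /x divfK// gt_eqF// mulr_gt0// exprn_gt0.
    have := ler_wpM2l (sqr_ge0 sigma) H; have := sqr_ge0 sigma; lra.
rewrite ge0_integralD//; last 3 first.
- by move=> w _; rewrite lee_fin mulr_ge0// sqr_ge0.
- by move=> w _; rewrite mule_ge0// lee_fin mulr_ge0// sqr_ge0.
- exact: measurable_funeM.
rewrite integral_cst// [X in (_ * X + _)%E]probability_setT mule1.
rewrite ge0_integralZl//; last by rewrite lee_fin mulr_ge0// sqr_ge0.
apply: (@le_trans _ _ ((2 * K ^+ 2)%:E + (8 * sigma ^+ 2)%:E * gauss_const%:E)%E).
  rewrite leeD2l// lee_wpmul2l//; last exact: sub_gaussian_exp_moment.
  by rewrite lee_fin mulr_ge0// sqr_ge0.
rewrite -EFinM -EFinD lee_fin.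
have K0 : 0 <= K by rewrite (le_trans _ sK)// ltW.
have sK2 : sigma ^+ 2 <= K ^+ 2 by rewrite ler_sqr ?nnegrE// ltW.
have := ler_pM (sqr_ge0 sigma) (le_trans ler01 G1) sK2 (lexx gauss_const).
by have := ler_wpM2l (sqr_ge0 K) G1; lra.
Qed.

Variables (L B : R).
Hypotheses (L1 : 1 <= L) (B0 : 0 <= B) (BE : B ^+ 2 = 32 * K ^+ 2 * L).

Let K0 : 0 < K. Proof. exact: lt_le_trans s0 sK. Qed.

Let B4K : 4 * K <= B.
Proof.
rewrite -ler_sqr ?nnegrE ?mulr_ge0 ?(ltW K0)// BE.
have := ler_wpM2l (sqr_ge0 K) L1; have := sqr_ge0 K; rewrite exprMn; lra.
Qed.

(** Beyond radius [B >= 4 K] the signal is less than a quarter of [|X|], so the tail of [X] is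
    governed by the noise. *)
Let tailZ w : enorm (Y w) < K -> B < enorm (X w) -> enorm (X w) <= 2 * enorm (Z w).
Proof. by rewrite XYZ; have := enormD (Y w) (Z w); have := enorm_ge0 (Z w); have := B4K; lra. Qed.

(** [|Z| >= B / 2] has probability at most [exp (- B^2 / (8 sigma^2))]; the 32 in [B^2] and
    [sigma <= K] make the exponent at least [4 L]. *)
Lemma noisy_tail : (Pr [set w | (B < enorm (X w))%R] <= (expR (- (4 * L)))%:E)%E.
Proof.
have mX : measurable [set w | B < enorm (X w)].
  have mY := mXc measurable_enorm.
  exact: measurable_set_ltr (measurable_cst B) mY.
have mY : measurable [set w | K <= enorm (Y w)].
  have mY : measurable_fun setT (fun w => enorm (Y w)).
    by apply: measurableT_comp => //; exact: measurable_enorm.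
  exact: measurable_set_ler (measurable_cst K) mY.
have mZ : measurable [set w | B / 2 <= enorm (Z w)].
  have mZ := measurable_comp_RV measurable_enorm.
  exact: measurable_set_ler (measurable_cst (B / 2)) mZ.
apply: (@le_trans _ _ (Pr ([set w | B / 2 <= enorm (Z w)] `|` [set w | K <= enorm (Y w)]))).
  apply: le_measure; rewrite ?inE//; first exact: measurableU.
  move=> w /= Bw; have [Yw|Yw] := ltP (enorm (Y w)) K; last by right.
  by left; have := tailZ Yw Bw; lra.
apply: (@le_trans _ _ (Pr [set w | (B / 2 <= enorm (Z w))%R] +
  Pr [set w | (K <= enorm (Y w))%R])%E); first exact: measureU2.
rewrite YK adde0.
have sB : sigma < B / 2 by have := B4K; have := K0; have := sK; lra.
apply: (le_trans (sub_gaussian_tail sB)); rewrite lee_fin ler_expR lerN2.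
rewrite expr_div_n BE ler_pdivlMr ?mulr_gt0 ?exprn_gt0//.
have sK2 : sigma ^+ 2 <= K ^+ 2 by rewrite ler_sqr ?nnegrE ?(ltW s0) ?(ltW K0).
by have := ler_wpM2l (le_trans ler01 L1) sK2; lra.
Qed.

(** On the tail event [|X|^2 <= 16 sigma^2 x] and [x >= 2 L], so
    [x / 2 <= exp (x / 2) <= exp (- L) exp x]: half of the exponent pays for the factor
    [exp (- L)]. *)
Lemma noisy_tail_sqnorm :
  (\int[Pr]_w (sqnorm (X w) * \1_[set u | (B < enorm u)%R] (X w))%:E <=
   (32 * gauss_const * K ^+ 2 * expR (- L))%:E)%E.
Proof.
have mB : measurable [set u : E | (B < enorm u)%R].
  exact: measurable_set_ltr (measurable_cst B) (@measurable_enorm R d).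
have c0 : 0 <= 32 * sigma ^+ 2 * expR (- L).
  by rewrite mulr_ge0 ?expR_ge0// mulr_ge0// sqr_ge0.
apply: (@le_trans _ _ (\int[Pr]_w ((32 * sigma ^+ 2 * expR (- L))%:E * S w))%E).
  apply: ae_ge0_le_integral => //.
  - by move=> w _; rewrite lee_fin mulr_ge0// sqnorm_ge0.
  - apply/measurable_EFinP; apply: (mXc (f := fun u => sqnorm u * \1_[set u | B < enorm u] u)).
    by apply: measurable_funM; [exact: measurable_sqnorm|exact: measurable_indic].
  - by move=> w _; rewrite mule_ge0.
  - exact: measurable_funeM.
  - apply: filterS ae_enorm_lt => w YwK _; rewrite -EFinM lee_fin indicE.
    have [/set_mem/= Bw|_] := boolP (X w \in _); last by rewrite mulr0 mulr_ge0// expR_ge0.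
    rewrite mulr1; have XZ := tailZ YwK Bw; set x := _ / _.
    have xE : sqnorm (Z w) = x * (4 * sigma ^+ 2).
      by rewrite /x divfK// gt_eqF// mulr_gt0// exprn_gt0.
    have X4 : sqnorm (X w) <= 4 * sqnorm (Z w).
      by have := le_sqnorm XZ; rewrite exprMn sqr_enorm; lra.
    have s2 : 0 < sigma ^+ 2 by rewrite exprn_gt0.
    have sK2 : sigma ^+ 2 <= K ^+ 2 by rewrite ler_sqr ?nnegrE ?(ltW s0) ?(ltW K0).
    have xL : L <= x / 2.
      have : B ^+ 2 <= sqnorm (X w) by rewrite -sqr_enorm ler_sqr ?nnegrE ?enorm_ge0// ltW.
      rewrite BE => h1; have h2 := ler_wpM2l (le_trans ler01 L1) sK2.
      by rewrite -(ler_pM2l s2); move: X4 h1; rewrite xE; lra.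
    have xe : x / 2 <= expR (x / 2) by have := expR_ge1Dx (x / 2); lra.
    have ee : expR (x / 2) <= expR (- L) * expR x.
      by rewrite -expRD ler_expR; lra.
    have : sigma ^+ 2 * (x / 2) <= sigma ^+ 2 * (expR (- L) * expR x).
      by rewrite ler_pM2l// (le_trans xe).
    by move: X4; rewrite xE; lra.
rewrite ge0_integralZl//.
apply: (@le_trans _ _ ((32 * sigma ^+ 2 * expR (- L))%:E * gauss_const%:E)%E).
  by rewrite lee_wpmul2l//; exact: sub_gaussian_exp_moment.
rewrite -EFinM lee_fin.
have sK2 : sigma ^+ 2 <= K ^+ 2 by rewrite ler_sqr ?nnegrE ?(ltW s0) ?(ltW K0).
have ge0 : 0 <= expR (- L) * gauss_const.
  by rewrite mulr_ge0 ?expR_ge0// (le_trans ler01)// gauss_const_ge1.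
by have := ler_wpM2r ge0 sK2; lra.
Qed.

End sub_gaussian_moments.

(** * Integration against the empirical measure *)

Section empirical_integral.
Context {R : realType} {d n : nat} (x : 'I_n -> 'rV[R]_d).
Local Notation E := 'rV[R]_d.
Hypothesis n0 : (0 < n)%N.

Lemma ge0_integral_empirical (f : E -> R) : measurable_fun setT f ->
  (forall u, 0 <= f u) ->
  (\int[empirical x]_u (f u)%:E = (n%:R^-1 * \sum_(i < n) f (x i))%:E)%E.
Proof.
move=> mf f0; pose i0 : 'I_n := Ordinal n0.
(* [msum] sums over natural numbers; the default point of [insubd] is only reached for [j >= n]. *)
pose D (j : nat) : {measure set E -> \bar R} := \d_(x (insubd i0 j)).
have ni : 0 <= n%:R^-1 :> R by rewrite invr_ge0.
have mEf : measurable_fun setT (EFin \o f) by exact/measurable_EFinP.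
rewrite (eq_measure_integral (mscale (NngNum ni) (msum D n))); last first.
  move=> A mA _; rewrite /mscale/= /msum /empirical; congr (_ * _)%E.
  by apply: eq_bigr => i _; rewrite /D valKd.
rewrite ge0_integral_mscale//; last by move=> u _; rewrite lee_fin.
rewrite ge0_integral_measure_sum//; last by move=> u _; rewrite lee_fin.
rewrite EFinM; congr (_ * _)%E; rewrite -sumEFin; apply: eq_bigr => i _.
by rewrite integral_dirac// diracT mul1e valKd.
Qed.

Lemma empirical_unit_mass2 : unit_mass2 (empirical x).
Proof.
split.
  have := @ge0_integral_empirical (fun=> 1) (measurable_cst _) (fun=> ler01).
  rewrite integral_cst// mul1e => ->.
  by rewrite sumr_const card_ord mulVf// pnatr_eq0 -lt0n.
rewrite ge0_integral_empirical ?ltry//; first exact: measurable_sqnorm.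
exact: sqnorm_ge0.
Qed.

Lemma int_empirical (f : E -> R) : qgrowth f ->
  \int[empirical x]_u f u = n%:R^-1 * \sum_(i < n) f (x i).
Proof.
move=> qf; have qn := qgrowth_norm qf.
have h g : qgrowth g -> (forall u, 0 <= g u) ->
    \int[empirical x]_u g u = n%:R^-1 * \sum_(i < n) g (x i).
  by case=> mg _ g0; rewrite /Rintegral ge0_integral_empirical.
transitivity (\int[empirical x]_u ((f u + `|f u|) - `|f u|)).
  by apply: eq_Rintegral => u _; rewrite addrK.
have qD := qgrowthD qf qn.
rewrite (intB empirical_unit_mass2)// h//; last first.
  by move=> u; have := ler_norm (- f u); rewrite normrN; lra.
rewrite h// -mulrBr -sumrB; congr (_ * _); apply: eq_bigr => i _.
by rewrite addrK.
Qed.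

(** Estimates are needed at the sample points only, which is how bounds valid merely on the ball of
    radius [B] come to bear. *)
Lemma le_int_empirical (f g : E -> R) : qgrowth f -> qgrowth g ->
  (forall i, f (x i) <= g (x i)) ->
  \int[empirical x]_u f u <= \int[empirical x]_u g u.
Proof.
move=> qf qg fg; rewrite !int_empirical// ler_wpM2l ?invr_ge0//.
by apply: ler_sum.
Qed.

End empirical_integral.

(** * Correction of the total mass *)

Section adjust.
Context {R : realType} {d : nat}.
Local Notation E := 'rV[R]_d.

(** Shrink [f] towards 0 or push it towards 1. In both cases [w - f] has constant sign, so its L1
    norm is exactly the defect of mass. *)
Lemma adjust_mass (P : {measure set E -> \bar R}) (f : E -> R) (h : R) :
  unit_mass2 P -> measurable_fun setT f -> (forall u, 0 <= f u <= 1) -> 0 < h <= 1 ->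
  exists w : E -> R, [/\ measurable_fun setT w, forall u, 0 <= w u <= 1,
    \int[P]_u w u = h &
    \int[P]_u `|w u - f u| = `|h - \int[P]_u f u|].
Proof.
move=> P2 mf f01 /andP[h0 h1]; set a := \int[P]_u f u.
have f0 u : 0 <= f u by case/andP: (f01 u).
have f1 u : f u <= 1 by case/andP: (f01 u).
have qf : qgrowth f by apply: qgrowth_bounded => //; exists 1 => u; rewrite ger0_norm.
have q1f : qgrowth (fun u => 1 - f u) by apply: qgrowthB => //; exact: qgrowth_cst.
have i1f : \int[P]_u (1 - f u) = 1 - a.
  by rewrite intB// ?int_cst//; exact: qgrowth_cst.
have [ha|ah] := leP h a.
  have a0 : 0 < a by exact: lt_le_trans ha.
  have ha1 : 0 <= 1 - h / a by rewrite subr_ge0 ler_pdivrMr// mul1r.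
  exists (fun u => h / a * f u); split.
  - exact: measurable_funM.
  - move=> u; rewrite mulr_ge0 ?divr_ge0 ?(ltW h0) ?(ltW a0)//=.
    by rewrite mulr_ile1// ?divr_ge0 ?(ltW h0) ?(ltW a0)//; lra.
  - by rewrite intZ// -/a divfK// gt_eqF.
  - transitivity (\int[P]_u ((1 - h / a) * f u)).
      apply: eq_Rintegral => u _.
      have -> : h / a * f u - f u = - ((1 - h / a) * f u) by ring.
      by rewrite normrN ger0_norm// mulr_ge0.
    rewrite intZ// -/a mulrBl mul1r divfK ?gt_eqF//.
    by rewrite ler0_norm ?opprB// subr_le0.
have a1 : 0 < 1 - a by lra.
set b := (h - a) / (1 - a).
have b0 : 0 <= b by rewrite /b divr_ge0// ltW// subr_gt0.
have b1 : b <= 1 by rewrite /b ler_pdivrMr// mul1r; lra.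
exists (fun u => f u + b * (1 - f u)); split.
- by apply: measurable_funD => //; apply: measurable_funM => //; case: q1f.
- move=> u; have := f0 u; have := f1 u; move=> u1 u0.
  have ub : 0 <= b * (1 - f u) by rewrite mulr_ge0// subr_ge0.
  have : b * (1 - f u) <= 1 * (1 - f u) by rewrite ler_wpM2r// subr_ge0.
  by rewrite addr_ge0//=; lra.
- rewrite intD//; last exact: qgrowthZ.
  by rewrite intZ// i1f -/a /b divfK ?gt_eqF//; lra.
- transitivity (\int[P]_u (b * (1 - f u))).
    apply: eq_Rintegral => u _; rewrite [X in `|X|]addrAC subrr add0r ger0_norm//.
    by rewrite mulr_ge0// subr_ge0.
  by rewrite intZ// i1f /b divfK ?gt_eqF// ger0_norm// subr_ge0 ltW.
Qed.

End adjust.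

(** * Comparison of the empirical and the true criterion *)

Section comparison.
Context {R : realType} {d n : nat}.
Local Notation E := 'rV[R]_d.
Variables (Q : probability E R) (x : 'I_n -> E) (B : R).
Hypotheses (n0 : (0 < n)%N) (B0 : 0 < B) (Q2 : unit_mass2 Q)
  (xB : forall i, enorm (x i) <= B).
Local Notation Qn := (empirical x).

Let Qn2 : unit_mass2 Qn. Proof. exact: empirical_unit_mass2. Qed.

(** Truncation and rescaling make [F] bounded by 1, as Hoeffding's inequality requires. *)
Definition ball_part (c : R) (F : E -> R) (u : E) : R :=
  c^-1 * F u * \1_[set v | enorm v <= B] u.

(** The outer bound equals [c] on the sphere of radius [B], so that one scale [c] serves inside and
    outside. *)
Definition growth_bound (c : R) (F : E -> R) :=
  (forall u, enorm u <= B -> `|F u| <= c) /\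
  (forall u, B < enorm u -> `|F u| <= c / B ^+ 2 * sqnorm u).

Lemma measurable_ballB : measurable [set v : E | enorm v <= B].
Proof.
exact: measurable_set_ler (@measurable_enorm R d) (measurable_cst B).
Qed.

Lemma measurable_out : measurable [set v : E | B < enorm v].
Proof.
exact: measurable_set_ltr (measurable_cst B) (@measurable_enorm R d).
Qed.

Lemma measurable_ball_part c F : measurable_fun setT F ->
  measurable_fun setT (ball_part c F).
Proof.
move=> mF; apply: measurable_funM; first exact: measurable_funM.
by apply: measurable_indic; exact: measurable_ballB.
Qed.

Lemma ball_part_le1 c F u : 0 < c -> growth_bound c F -> `|ball_part c F u| <= 1.
Proof.
move=> c0 [Fc _]; rewrite /ball_part indicE.
have [/set_mem/= uB|_] := boolP (u \in _); last by rewrite mulr0 normr0.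
by rewrite mulr1 normrM ger0_norm ?invr_ge0 ?(ltW c0)// ler_pdivrMl// mulr1 Fc.
Qed.

(** The sample lies in the ball, so truncation does not affect the empirical mean; only the integral
    against [Q] has an outer part, bounded by the tail moment [tau]. *)
Lemma deviation_le (F : E -> R) (c t tau : R) : qgrowth F -> 0 < c ->
  growth_bound c F ->
  `|n%:R^-1 * \sum_i ball_part c F (x i) - \int[Q]_u ball_part c F u| <= t ->
  \int[Q]_u (sqnorm u * \1_[set v | B < enorm v] u) <= tau ->
  `|\int[Qn]_u F u - \int[Q]_u F u| <= c * (t + tau / B ^+ 2).
Proof.
move=> qF c0 [Fc Fo] Ht Htau.
have mo := measurable_out.
have qo := qgrowthM_indic mo qF.
have qb : qgrowth (ball_part c F).
  by apply: qgrowthM_indic; [exact: measurable_ballB|exact: qgrowthZ].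
have qs := qgrowthM_indic mo qgrowth_sqnorm.
have FE u : F u = c * ball_part c F u + F u * \1_[set v | B < enorm v] u.
  rewrite /ball_part !indicE; have [uB|uB] := leP (enorm u) B.
    rewrite mem_set// memNset/= ?mulr0 ?addr0 ?mulr1 ?mulrA ?divff ?gt_eqF ?mul1r//.
    by apply/negP; rewrite -leNgt.
  rewrite memNset/= ?mulr0 ?add0r ?mem_set ?mulr1//.
  by apply/negP; rewrite -ltNge.
have QF : \int[Q]_u F u = c * \int[Q]_u ball_part c F u +
    \int[Q]_u (F u * \1_[set v | B < enorm v] u).
  under eq_Rintegral do rewrite FE.
  by rewrite intD// ?intZ//; exact: qgrowthZ.
have QnF : \int[Qn]_u F u = c * (n%:R^-1 * \sum_i ball_part c F (x i)).
  rewrite int_empirical// mulrCA; congr (_ * _); rewrite mulr_sumr.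
  apply: eq_bigr => i _; rewrite {1}FE indicE memNset/= ?mulr0 ?addr0//.
  by apply/negP; rewrite -leNgt.
rewrite QF QnF opprD addrA -mulrBr (le_trans (ler_normB _ _))// [leRHS]mulrDr lerD//.
  by rewrite normrM gtr0_norm// ler_pM2l.
apply: (le_trans (norm_int Q2 qo)).
apply: (@le_trans _ _ (\int[Q]_u ((c / B ^+ 2) * (sqnorm u * \1_[set v | B < enorm v] u)))).
  apply: le_int => //.
  - exact: qgrowth_norm.
  - exact: qgrowthZ.
  - move=> u; rewrite indicE; have [/set_mem/= uB|_] := boolP (u \in _).
      by rewrite !mulr1 Fo.
    by rewrite !mulr0 normr0.
rewrite intZ// -mulrA ler_pM2l// mulrC ler_pM2r ?invr_gt0 ?exprn_gt0//.
Qed.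

Section core.
Variable eta : R.

Definition int_close (c : R) (F : E -> R) :=
  `|\int[Qn]_u F u - \int[Q]_u F u| <= c * eta.

(** [nu] is [Qn] weighted by the mass-corrected [f]. Of the constant, 4 is the price of the
    correction, since [|x_i - u| <= 2 B]; the rest is [1 + 2 d + 1] from the deviations of the
    moments of [f]. *)
Lemma empirical_submeasure (f : E -> R) (h : R) : measurable_fun setT f ->
  (forall u, 0 <= f u <= 1) -> 0 < h <= 1 -> \int[Q]_u f u = h -> int_close 1 f ->
  (forall i, int_close B (fun y => y 0 i * f y)) -> int_close (B ^+ 2) (fun y => sqnorm y * f y) ->
  exists2 nu : probability E R, submeasure h Qn nu &
    forall u, enorm u <= B -> power nu u <=
      h^-1 * \int[Q]_y (sqnorm (y - u) * f y) + h^-1 * ((6 + 2 * d%:R) * B ^+ 2 * eta).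
Proof.
move=> mf f01 h01 fh cf cyf csf; have /andP[h0 h1] := h01.
have qMf g : qgrowth g -> qgrowth (fun y => g y * f y).
  move=> qg; apply: (qgrowthM_bounded qg mf); exists 1 => u.
  by case/andP: (f01 u) => ? ?; rewrite ger0_norm.
have qf : qgrowth f.
  apply: qgrowth_bounded => //; exists 1 => u.
  by case/andP: (f01 u) => ? ?; rewrite ger0_norm.
have [w [mw w01 wh wf]] := adjust_mass Qn2 mf f01 h01.
have w0 u : 0 <= w u by case/andP: (w01 u).
have w1 u : w u <= 1 by case/andP: (w01 u).
have [nu [_ _ subnu nuE]] := weighted_probability mw w0 Qn2 w1 h0 wh.
have nu2 := submeasure_unit_mass2 h0 subnu Qn2.
exists nu => // u uB.
have qw : qgrowth w by apply: qgrowth_bounded => //; exists 1 => v; rewrite ger0_norm.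
have qwf : qgrowth (fun y => `|w y - f y|).
  apply: qgrowth_bounded.
    by apply: measurableT_comp => //; exact: measurable_funB.
  by exists 1 => v; rewrite normr_id; have := f01 v; have := w01 v;
    rewrite ler_norml; lra.
have qu := qgrowth_sqnormB u.
rewrite /power -(int_sqnormB nu2) nuE// -mulrDr ler_pM2l ?invr_gt0//.
have qMw g : qgrowth g -> qgrowth (fun y => g y * w y).
  by move=> qg; apply: (qgrowthM_bounded qg mw); exists 1 => v; rewrite ger0_norm.
have step1 : \int[Qn]_y (sqnorm (y - u) * w y) <=
    \int[Qn]_y (sqnorm (y - u) * f y) + 4 * B ^+ 2 * eta.
  apply: (@le_trans _ _ (\int[Qn]_y (sqnorm (y - u) * f y + 4 * B ^+ 2 * `|w y - f y|))).
    apply: le_int_empirical => //; first exact: qMw.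
    - by apply: qgrowthD; [exact: qMf|exact: qgrowthZ].
    - move=> i; rewrite -lerBlDl -mulrBr.
      have sB : sqnorm (x i - u) <= 4 * B ^+ 2.
        rewrite (_ : 4 * B ^+ 2 = (2 * B) ^+ 2); last by rewrite exprMn; ring.
        by apply: le_sqnorm; rewrite (le_trans (enormB _ _))//; have := xB i; lra.
      apply: (@le_trans _ _ (sqnorm (x i - u) * `|w (x i) - f (x i)|)).
        by rewrite ler_wpM2l ?sqnorm_ge0// ler_norm.
      by rewrite ler_wpM2r.
  rewrite intD//; last exact: qgrowthZ; last exact: qMf.
  rewrite intZ// wf lerD2l ler_pM2l ?mulr_gt0 ?exprn_gt0// -fh distrC.
  by rewrite -[leRHS]mul1r.
(* Expanding the square separates [u] from [y]: uniformity over [u] needs only the [d + 2] moments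
   of [f]. *)
have expand (mu : {measure set E -> \bar R}) : unit_mass2 mu ->
    \int[mu]_y (sqnorm (y - u) * f y) = \int[mu]_y (sqnorm y * f y) -
    2 * \sum_(i < d) u 0 i * \int[mu]_y (y 0 i * f y) + sqnorm u * \int[mu]_y f y.
  move=> mu2; have qi i := qMf _ (qgrowth_coord i).
  transitivity (\int[mu]_y (sqnorm y * f y - 2 * (\sum_(i < d) u 0 i * (y 0 i * f y)) +
      sqnorm u * f y)).
    apply: eq_Rintegral => y _; rewrite sqnormB.
    rewrite (_ : \sum_(i < d) _ = dotv y u * f y); first by ring.
    by rewrite mulr_suml; apply: eq_bigr => i _; ring.
  have qsum : qgrowth (fun y => \sum_(i < d) u 0 i * (y 0 i * f y)).
    by apply: qgrowth_sum => // i; exact: qgrowthZ.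
  have qs := qMf _ qgrowth_sqnorm.
  rewrite intD//; last 2 first.
  - by apply: qgrowthB => //; exact: qgrowthZ.
  - exact: qgrowthZ.
  rewrite intB//; last exact: qgrowthZ.
  rewrite !intZ// int_sum//; last by move=> i; exact: qgrowthZ.
  by congr (_ - 2 * _ + _); apply: eq_bigr => i _; rewrite intZ.
have eta0 : 0 <= eta by move: (le_trans (normr_ge0 _) cf); rewrite mul1r.
apply: (le_trans step1); rewrite !expand//.
move: cf csf; rewrite /int_close mul1r !ler_norml => /andP[_ cf] /andP[_ csf].
have csum : - \sum_(i < d) u 0 i * \int[Qn]_y (y 0 i * f y) <=
    - \sum_(i < d) u 0 i * \int[Q]_y (y 0 i * f y) + d%:R * (B ^+ 2 * eta).
  rewrite -lerBlDl opprK addrC -sumrB.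
  apply: (@le_trans _ _ (\sum_(i < d) B ^+ 2 * eta)); last first.
    by rewrite sumr_const card_ord mulr_natl.
  apply: ler_sum => i _; rewrite -mulrBr (le_trans (ler_norm _))// normrM.
  rewrite expr2 -mulrA distrC ler_pM//.
  - exact: le_trans (coord_le u i) uB.
  - exact: cyf.
have sq1 : sqnorm u * \int[Qn]_y f y <= sqnorm u * \int[Q]_y f y + B ^+ 2 * eta.
  rewrite -lerBlDl -mulrBr; apply: (@le_trans _ _ (sqnorm u * eta)).
    by rewrite ler_wpM2l ?sqnorm_ge0.
  by rewrite ler_wpM2r// le_sqnorm.
lra.
Qed.

End core.
End comparison.

(** * Discretization of minima of affine functions *)

Section net.
Context {R : realType} {d n k : nat}.
Local Notation E := 'rV[R]_d.
Variable (B : R).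
Hypotheses (n0 : (0 < n)%N) (k0 : (0 < k)%N) (B0 : 0 < B).

(** The criterion without the common term [|u|^2], which cancels in every comparison of two families
    under one measure. *)
Definition min_affine (m : 'I_k -> E) (om : 'I_k -> R) (u : E) : R :=
  fmin (fun i => om i - 2 * dotv u (m i)).

Lemma qgrowth_min_affine m om : qgrowth (min_affine m om).
Proof. by apply: qgrowth_fmin => // i; exact: qgrowth_affine. Qed.

(** The sample size also sets the mesh: the error of order [1 / n] stays below the statistical one,
    and the cardinality is polynomial in [n]. *)
Definition grid := {ffun 'I_k -> {ffun 'I_d -> 'I_n.+1} * 'I_n.+1}.

Definition grid_mean (th : grid) (i : 'I_k) : E :=
  \row_j (B * (2 * (((th i).1 j)%:R / n%:R) - 1)).

Definition grid_moment (th : grid) (i : 'I_k) : R :=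
  B ^+ 2 * ((th i).2%:R / n%:R).

Let nR : 0 < n%:R :> R. Proof. by rewrite ltr0n. Qed.

Lemma grid_approx (y : R) : 0 <= y <= 1 -> exists a : 'I_n.+1, `|y - a%:R / n%:R| <= n%:R^-1.
Proof.
move=> /andP[y0 y1]; have yn0 : 0 <= y * n%:R by rewrite mulr_ge0// ltW.
have an : (Num.truncn (y * n%:R) < n.+1)%N.
  rewrite ltnS -(ler_nat R) (le_trans (_ : _ <= y * n%:R))//.
    by rewrite truncn_le.
  by rewrite ler_piMl// ltW.
exists (Ordinal an) => /=; rewrite -[y in `|y - _|](mulfK (lt0r_neq0 nR)) -mulrBl normrM.
rewrite [X in _ * X]ger0_norm ?invr_ge0 ?(ltW nR)// ler_piMl ?invr_ge0 ?(ltW nR)//.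
have := truncn_le (y * n%:R); rewrite yn0 => le1; have := truncnS_gt (y * n%:R).
rewrite -natr1; move: le1; move: (_%:R : R) => a le1 lt1.
by rewrite ger0_norm ?subr_ge0//; lra.
Qed.

Lemma grid_unit (a : 'I_n.+1) : 0 <= (a%:R / n%:R : R) <= 1.
Proof.
by rewrite divr_ge0 ?(ltW nR)//= ler_pdivrMr// mul1r ler_nat -ltnS ltn_ord.
Qed.

(** The grid controls means coordinate by coordinate only, which costs a factor [d] over
    Cauchy-Schwarz. *)
Lemma dotv_le_sum (u v : E) (b : R) : 0 <= b -> (forall j, `|v 0 j| <= b) ->
  `|dotv u v| <= d%:R * (b * enorm u).
Proof.
move=> b0 vb; apply: (le_trans (ler_norm_sum _ _ _)).
apply: (@le_trans _ _ (\sum_(j < d) b * enorm u)); last first.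
  by rewrite sumr_const card_ord mulr_natl.
by apply: ler_sum => j _; rewrite normrM mulrC ler_pM// coord_le.
Qed.

Lemma grid_mean_coord th i j : `|grid_mean th i 0 j| <= B.
Proof.
rewrite mxE normrM (gtr0_norm B0) ler_piMr ?(ltW B0)//.
have := grid_unit ((th i).1 j); move: (_ / _) => y y01.
by rewrite ler_norml; lra.
Qed.

Lemma growth_bound_grid th :
  growth_bound B ((2 * d%:R + 1) * B ^+ 2) (min_affine (grid_mean th) (grid_moment th)).
Proof.
have d0 : 0 <= d%:R :> R by [].
have bnd u i : `|grid_moment th i - 2 * dotv u (grid_mean th i)| <=
    B ^+ 2 + 2 * (d%:R * (B * enorm u)).
  rewrite (le_trans (ler_normB _ _))// lerD//.
    rewrite /grid_moment ger0_norm; last first.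
      by rewrite mulr_ge0 ?(ltW (exprn_gt0 _ B0))//; case/andP: (grid_unit (th i).2).
    by rewrite ler_piMr ?(ltW (exprn_gt0 _ B0))//; case/andP: (grid_unit (th i).2).
  rewrite normrM ger0_norm// ler_pM2l//; apply: dotv_le_sum; first exact: ltW.
  by move=> j; exact: grid_mean_coord.
split=> u uB; apply: fmin_norm_le => // i; apply: (le_trans (bnd u i)).
  have : B * enorm u <= B * B by rewrite ler_pM2l.
  by move=> /(ler_wpM2l d0); rewrite -expr2; lra.
rewrite mulfK ?gt_eqF ?exprn_gt0// -sqr_enorm.
have h1 : B * enorm u <= enorm u ^+ 2 by rewrite expr2 ler_wpM2r ?enorm_ge0// ltW.
have h2 : B ^+ 2 <= enorm u ^+ 2 by rewrite ler_sqr ?nnegrE ?enorm_ge0// ltW.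
by have := ler_wpM2l d0 h1; lra.
Qed.

Lemma min_affine_approx m om : (forall i, enorm (m i) <= B) ->
  (forall i, 0 <= om i <= B ^+ 2) ->
  exists th : grid, forall u,
    `|min_affine m om u - min_affine (grid_mean th) (grid_moment th) u| <=
    B ^+ 2 / n%:R + 2 * d%:R / n%:R * (B ^+ 2 + sqnorm u).
Proof.
move=> mB oB; have B20 : 0 < B ^+ 2 by rewrite exprn_gt0.
have /choice[b bE] i : exists b : 'I_n.+1, `|om i / B ^+ 2 - b%:R / n%:R| <= n%:R^-1.
  apply: grid_approx; have /andP[p0 p1] := oB i.
  by rewrite divr_ge0 ?(ltW B20)//= ler_pdivrMr// mul1r.
(* Coordinates in [[- B, B]] are rescaled to [[0, 1]], inverting [grid_mean]. *)
have /choice[a aE] (ij : 'I_k * 'I_d) : exists a : 'I_n.+1,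
    `|(m ij.1 0 ij.2 / B + 1) / 2 - a%:R / n%:R| <= n%:R^-1.
  apply: grid_approx; have := le_trans (coord_le (m ij.1) ij.2) (mB ij.1).
  rewrite -[X in _ <= X]mul1r -ler_pdivrMr// -[X in _ / X](gtr0_norm B0) -normf_div.
  by rewrite ler_norml; move: (_ / _) => y; lra.
exists [ffun i => ([ffun j => a (i, j)], b i)] => u; set th := finfun _.
have d0 : 0 <= d%:R :> R by [].
set rhs := (X in _ <= X).
have close_i i : `|(om i - 2 * dotv u (m i)) -
    (grid_moment th i - 2 * dotv u (grid_mean th i))| <= rhs.
  have -> : om i - 2 * dotv u (m i) - (grid_moment th i - 2 * dotv u (grid_mean th i)) =
     (om i - grid_moment th i) - 2 * dotv u (m i - grid_mean th i).
    by rewrite dotvDr dotvNr; ring.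
  rewrite (le_trans (ler_normB _ _))// lerD//.
    rewrite /grid_moment /th ffunE/=.
    have -> : om i - B ^+ 2 * ((b i)%:R / n%:R) =
        B ^+ 2 * (om i / B ^+ 2 - (b i)%:R / n%:R).
      by rewrite mulrBr [_ * (om i / _)]mulrC divfK ?gt_eqF.
    by rewrite normrM (gtr0_norm B20) ler_pM2l.
  rewrite normrM ger0_norm//.
  have := @dotv_le_sum u (m i - grid_mean th i) (2 * B / n%:R).
  move=> /(_ _ _)/(le_trans _) H.
  apply: (@le_trans _ _ (2 * (d%:R * (2 * B / n%:R * enorm u)))).
    rewrite ler_pM2l//; apply: dotv_le_sum.
      by rewrite divr_ge0 ?mulr_ge0 ?(ltW B0) ?(ltW nR).
    move=> j; rewrite !mxE /th !ffunE/=.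
    have -> : m i 0 j - B * (2 * ((a (i, j))%:R / n%:R) - 1) =
        2 * B * ((m i 0 j / B + 1) / 2 - (a (i, j))%:R / n%:R).
      by field; rewrite !gt_eqF.
    by rewrite normrM gtr0_norm ?mulr_gt0// ler_pM2l ?mulr_gt0// (aE (i, j)).
  have : 2 * B * enorm u <= B ^+ 2 + sqnorm u.
    by rewrite -sqr_enorm; have := sqr_ge0 (B - enorm u); rewrite sqrrB; lra.
  have dn : 0 <= 2 * d%:R / n%:R :> R by rewrite divr_ge0 ?mulr_ge0 ?(ltW nR).
  by move=> /(ler_wpM2l dn); move: (n%:R^-1) => ni; lra.
rewrite ler_norml; apply/andP; split.
  rewrite lerNl opprB lerBlDr addrC; apply: fmin_le_add => // i.
  by have := close_i i; rewrite ler_norml => /andP[]; lra.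
rewrite lerBlDr addrC; apply: fmin_le_add => // i.
by have := close_i i; rewrite ler_norml => /andP[]; lra.
Qed.

(** Uniform over all bounded parameters, hence applicable to sample-dependent ones. The error
    [1 / n] is doubled because the grid approximation is used under both [Q] and the empirical
    measure. *)
Lemma min_affine_deviation (Q : probability E R) (x : 'I_n -> E) (eta : R) m om :
  unit_mass2 Q -> (forall i, enorm (x i) <= B) -> \int[Q]_u sqnorm u <= B ^+ 2 ->
  (forall th : grid, int_close Q x eta ((2 * d%:R + 1) * B ^+ 2)
     (min_affine (grid_mean th) (grid_moment th))) ->
  (forall i, enorm (m i) <= B) -> (forall i, 0 <= om i <= B ^+ 2) ->
  `|\int[empirical x]_u min_affine m om u - \int[Q]_u min_affine m om u| <=
    (2 * d%:R + 1) * B ^+ 2 * eta + 2 * (4 * d%:R + 1) * B ^+ 2 / n%:R.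
Proof.
move=> Q2 xB QB cl mB oB; have [th H] := min_affine_approx mB oB.
have Qn2 := empirical_unit_mass2 x n0.
pose r (u : E) := B ^+ 2 / n%:R + 2 * d%:R / n%:R * (B ^+ 2 + sqnorm u).
have qr : qgrowth r.
  apply: qgrowthD; first exact: qgrowth_cst.
  by apply: qgrowthZ; apply: qgrowthD; [exact: qgrowth_cst|exact: qgrowth_sqnorm].
have near (mu : {measure set E -> \bar R}) : unit_mass2 mu -> \int[mu]_u sqnorm u <= B ^+ 2 ->
    `|\int[mu]_u min_affine m om u -
      \int[mu]_u min_affine (grid_mean th) (grid_moment th) u| <=
      (4 * d%:R + 1) * B ^+ 2 / n%:R.
  move=> mu2 muB; have q1 := qgrowth_min_affine.
  rewrite -intB//; apply: (le_trans (norm_int mu2 (qgrowthB (q1 _ _) (q1 _ _)))).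
  apply: (@le_trans _ _ (\int[mu]_u r u)).
    by apply: le_int => //; exact: qgrowth_norm (qgrowthB (q1 m om) (q1 _ _)).
  have qc := qgrowth_cst; have qs := @qgrowth_sqnorm R d.
  have qcs := qgrowthD (qc R d (B ^+ 2)) qs.
  rewrite /r (intD mu2 (qc _ _ _) (qgrowthZ _ qcs)) (intZ mu2 _ qcs).
  rewrite (intD mu2 (qc _ _ _) qs) !int_cst//.
  have dn : 0 <= 2 * d%:R / n%:R :> R by rewrite divr_ge0 ?mulr_ge0 ?(ltW nR).
  by have := ler_wpM2l dn muB; move: (n%:R^-1) => ni; lra.
have QnB : \int[empirical x]_u sqnorm u <= B ^+ 2.
  rewrite -[leRHS](int_cst Qn2); apply: le_int_empirical => //.
  - exact: qgrowth_sqnorm.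
  - exact: qgrowth_cst.
  - by move=> i; exact: le_sqnorm.
have := near Q Q2 QB; have := near _ Qn2 QnB; have := cl th; rewrite /int_close.
rewrite !ler_norml; move: (n%:R^-1) => ni; lra.
Qed.

Lemma card_grid : #|grid| = ((n.+1 ^ d * n.+1) ^ k)%N.
Proof. by rewrite card_ffun card_prod card_ffun !card_ord. Qed.

End net.

(** Origin of [12 + 12 d]: [10 d + 3] for the empirical optimum, including the grid error, [6 + 2 d]
    for the reweighted competitor and 3 for the fixed local measures. *)
Lemma excess_arith (R : realFieldType) (D b eta h ni S Sn g gn v vn : R) :
  0 <= D -> 0 <= b -> 0 < h <= 1 -> 0 <= ni -> ni <= eta ->
  Sn + gn <= Sn + vn + h^-1 * ((6 + 2 * D) * b * eta) ->
  - ((2 * D + 1) * b * eta + 2 * (4 * D + 1) * b * ni) <= gn - g ->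
  vn - v <= 3 * b / h * eta ->
  S + g <= S + v + (12 + 12 * D) * b * eta / h.
Proof.
move=> D0 b0 /andP[h0 h1] ni0 ni_eta le1 le2 le3.
have hi : 1 <= h^-1 by rewrite invf_ge1.
have eta0 : 0 <= eta := le_trans ni0 ni_eta.
have Db : 0 <= D * b by rewrite mulr_ge0.
have t1 : 2 * (4 * D + 1) * b * ni <= 2 * (4 * D + 1) * b * eta.
  by rewrite ler_wpM2l//; lra.
have t2 : (10 * D + 3) * b * eta <= (10 * D + 3) * b * eta / h.
  by rewrite ler_peMr// mulr_ge0//; lra.
move: le1 le3 t2; move: (h^-1) => hi' le1 le3 t2; lra.
Qed.

(** * Excess criterion of an empirical optimum *)

Section excess.
Context {R : realType} {d n k : nat}.
Local Notation E := 'rV[R]_d.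
Variables (Q : probability E R) (x : 'I_n -> E) (B h : R).
Hypotheses (n0 : (0 < n)%N) (k0 : (0 < k)%N) (B0 : 0 < B) (h01 : 0 < h <= 1)
  (Q2 : unit_mass2 Q) (xB : forall i, enorm (x i) <= B)
  (QB : \int[Q]_u sqnorm u <= B ^+ 2).
Local Notation Qn := (empirical x).

Let h0 : 0 < h. Proof. by case/andP: h01. Qed.
Let Qn2 : unit_mass2 Qn. Proof. exact: empirical_unit_mass2. Qed.

(** All that is ever used of the local measures of a given optimum; in this way points at infinity
    call for no separate treatment. *)
Lemma local_submeasure (P : {measure set E -> \bar R}) t (mu : probability E R) :
  local_measures P h t mu -> submeasure h P mu.
Proof.
move=> [la [_ laP _ _ muE]] A mA.
by rewrite muE// muleA -EFinM divff ?gt_eqF// mul1e; exact: laP.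
Qed.

(** The mass sits on sample points, all in the ball. The bound is free of [1 / h], so the moments of
    an empirical optimum fall in the range of the grid. *)
Lemma submeasure_support (nu : probability E R) : submeasure h Qn nu ->
  \int[nu]_u sqnorm u <= B ^+ 2.
Proof.
move=> subnu; have nu2 := submeasure_unit_mass2 h0 subnu Qn2.
have qs := @qgrowth_sqnorm R d; have qc := @qgrowth_cst R d (B ^+ 2).
have qo := qgrowthM_indic (measurable_out B) qs.
have nuo : \int[nu]_u (sqnorm u * \1_[set v | B < enorm v] u) <= 0.
  rewrite -(ler_pM2l h0) mulr0.
  apply: le_trans (submeasure_int_le h0 subnu Qn2 qo _) _.
    by move=> u; rewrite mulr_ge0// sqnorm_ge0.
  rewrite int_empirical// big1 ?mulr0// => i _.
  rewrite indicE memNset ?mulr0//=; apply/negP; by rewrite -leNgt.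
apply: (@le_trans _ _ (\int[nu]_u (B ^+ 2 + sqnorm u * \1_[set v | B < enorm v] u))).
  apply: le_int => //; first exact: qgrowthD.
  move=> u; rewrite indicE; have [uB|uB] := leP (enorm u) B.
    by rewrite (le_trans (le_sqnorm uB))// lerDl mulr_ge0// sqnorm_ge0.
  by rewrite mem_set// mulr1 lerDr sqr_ge0.
by rewrite intD// int_cst// gerDl.
Qed.

Let moment (nu : probability E R) := \int[nu]_u sqnorm u.

Lemma power_fminE (m : 'I_k -> probability E R) u :
  fmin (fun i => power (m i) u) =
  sqnorm u + min_affine (fun i => mean (m i)) (fun i => moment (m i)) u.
Proof.
rewrite -fminD//; congr fmin; apply/funext => i; rewrite /power /moment; ring.
Qed.

Lemma int_power_fmin (mu : {measure set E -> \bar R}) (m : 'I_k -> probability E R) :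
  unit_mass2 mu ->
  \int[mu]_u fmin (fun i => power (m i) u) = \int[mu]_u sqnorm u +
    \int[mu]_u min_affine (fun i => mean (m i)) (fun i => moment (m i)) u.
Proof.
move=> mu2; under eq_Rintegral do rewrite power_fminE.
by rewrite intD//; [exact: qgrowth_sqnorm|exact: qgrowth_min_affine].
Qed.

(** Under [Q] only the second moment is bounded, so normalization costs [1 / h]: moments at most
    [B^2 / h], means at most [B / h]. *)
Lemma growth_bound_power (mu : 'I_k -> probability E R) :
  (forall i, submeasure h Q (mu i)) ->
  growth_bound B (3 * B ^+ 2 / h)
    (min_affine (fun i => mean (mu i)) (fun i => moment (mu i))).
Proof.
move=> submu; have h1 : h <= 1 by case/andP: h01.
have momB i : moment (mu i) <= B ^+ 2 / h.
  rewrite ler_pdivlMr// mulrC; apply: le_trans QB.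
  exact: (submeasure_int_le h0 (submu i) Q2 (@qgrowth_sqnorm R d) (@sqnorm_ge0 R d)).
have mom0 i : 0 <= moment (mu i) by apply: int_ge0 => u; exact: sqnorm_ge0.
have meanB i : enorm (mean (mu i)) <= B / h.
  apply: enorm_le; first by rewrite divr_ge0 ?ltW.
  apply: (le_trans (sqnorm_mean_le (submeasure_unit_mass2 h0 (submu i) Q2))).
  apply: (le_trans (momB i)); rewrite expr_div_n ler_pM2l ?exprn_gt0//.
  by rewrite lef_pV2 ?posrE ?exprn_gt0// expr2 ler_piMl// ltW.
have bnd u i : `|moment (mu i) - 2 * dotv u (mean (mu i))| <=
    (B ^+ 2 + 2 * (B * enorm u)) / h.
  rewrite (le_trans (ler_normB _ _))// [leRHS]mulrDl lerD//; first by rewrite ger0_norm.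
  rewrite normrM ger0_norm// -mulrA ler_pM2l// (le_trans (dotv_le _ _))//.
  by rewrite mulrC mulrAC ler_wpM2r ?enorm_ge0.
split=> u uB; apply: fmin_norm_le => // i; apply: (le_trans (bnd u i)).
  rewrite ler_pM2r ?invr_gt0//.
  have : B * enorm u <= B * B by rewrite ler_pM2l.
  by rewrite -expr2; lra.
have -> : 3 * B ^+ 2 / h / B ^+ 2 * sqnorm u = 3 * sqnorm u / h.
  by field; rewrite !gt_eqF.
rewrite ler_pM2r ?invr_gt0// -sqr_enorm.
have p1 : B * enorm u <= enorm u ^+ 2 by rewrite expr2 ler_wpM2r ?enorm_ge0// ltW.
have p2 : B ^+ 2 <= enorm u ^+ 2 by rewrite ler_sqr ?nnegrE ?enorm_ge0// ltW.
lra.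
Qed.

Variable eta : R.
Hypothesis n_eta : n%:R^-1 <= eta.
Local Notation icl := (int_close Q x eta).

Lemma Opt_excess (f : 'I_k -> E -> R) (mu : 'I_k -> probability E R)
    (s : 'I_k -> epoint R d) (m : 'I_k -> probability E R) :
  (forall i, measurable_fun setT (f i) /\ (forall u, 0 <= f i u <= 1)) ->
  (forall i, \int[Q]_u f i u = h) ->
  (forall i, submeasure h Q (mu i)) ->
  (forall i g, qgrowth g -> \int[mu i]_u g u = h^-1 * \int[Q]_u (g u * f i u)) ->
  (forall i, icl 1 (f i)) ->
  (forall i j, icl B (fun y => y 0 j * f i y)) ->
  (forall i, icl (B ^+ 2) (fun y => sqnorm y * f i y)) ->
  icl (3 * B ^+ 2 / h) (min_affine (fun i => mean (mu i)) (fun i => moment (mu i))) ->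
  (forall th : grid, icl ((2 * d%:R + 1) * B ^+ 2)
     (min_affine (grid_mean (n := n) (k := k) B th) (grid_moment B th))) ->
  Opt Qn h s m ->
  \int[Q]_u fmin (fun i => power (m i) u) <=
  \int[Q]_u fmin (fun i => power (mu i) u) + (12 + 12 * d%:R) * B ^+ 2 * eta / h.
Proof.
move=> mf fh submu muE c1 c2 c3 c4 c5 [adm opt].
have h1 : h <= 1 by case/andP: h01.
have subm i : submeasure h Qn (m i) := local_submeasure (adm i).
have m2 i := submeasure_unit_mass2 h0 (subm i) Qn2.
have mu2 i := submeasure_unit_mass2 h0 (submu i) Q2.
pose e1 := h^-1 * ((6 + 2 * d%:R) * B ^+ 2 * eta).
have exnu i : exists nu : probability E R, submeasure h Qn nu /\
    forall u, enorm u <= B -> power nu u <= power (mu i) u + e1.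
  have [mfi f01] := mf i.
  have [nu subnu nuE] := empirical_submeasure n0 B0 Q2 xB mfi f01 h01 (fh i)
    (c1 i) (c2 i) (c3 i).
  exists nu; split => // u uB; apply: (le_trans (nuE u uB)); rewrite lerD2r.
  by rewrite /power -(int_sqnormB (mu2 i)) muE//; exact: qgrowth_sqnormB.
have /choice[nu nuP] := exnu.
(* [nu] is a mere submeasure and no competitor in [Opt]; [mu'] is one, with a criterion that is no
   larger. *)
have [y [ff [mu' [_ _ adm' _ best]]]] :=
  best_local_measures Qn2 h01 k0 (fun i => (nuP i).1).
have mu'2 i := submeasure_unit_mass2 h0 (local_submeasure (adm' i)) Qn2.
have qp (l : 'I_k -> probability E R) : qgrowth (fun u => fmin (fun i => power (l i) u)).
  by apply: qgrowth_fmin => // i; exact: qgrowth_power.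
have optR : \int[Qn]_u fmin (fun i => power (m i) u) <=
    \int[Qn]_u fmin (fun i => power (mu' i) u).
  have := opt _ _ adm'.
  under eq_integral do rewrite power_minE//.
  under [X in (_ <= X)%E]eq_integral do rewrite power_minE//.
  by rewrite -!EFin_int// lee_fin.
have nuR : \int[Qn]_u fmin (fun i => power (nu i) u) <=
    \int[Qn]_u fmin (fun i => power (mu i) u) + e1.
  rewrite -[X in _ + X](int_cst Qn2 e1) -intD//; last exact: qgrowth_cst.
  apply: le_int_empirical => //; first by apply: qgrowthD => //; exact: qgrowth_cst.
  move=> i; apply: fmin_le_add => // j.
  exact: (nuP j).2.
have momB i : 0 <= moment (m i) <= B ^+ 2.
  by rewrite submeasure_support// andbT int_ge0// => u; exact: sqnorm_ge0.
have meanB i : enorm (mean (m i)) <= B.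
  apply: enorm_le; first exact: ltW.
  by apply: (le_trans (sqnorm_mean_le (m2 i))); case/andP: (momB i).
have dev := min_affine_deviation n0 k0 B0 Q2 xB QB c5 meanB momB.
move: dev; rewrite ler_norml => /andP[dev _].
move: c4; rewrite /int_close ler_norml => /andP[_ c4'].
(* Both sides contain [int |u|^2 dQn], so no deviation of this term enters. *)
move: (le_trans optR (le_trans best nuR)); rewrite !int_power_fmin// => key.
have ni0 : 0 <= n%:R^-1 :> R by rewrite invr_ge0.
exact: (excess_arith _ (ler0n R d) (sqr_ge0 B) h01 ni0 n_eta key dev c4').
Qed.

End excess.

(** * Transfer from [Q] to [P] *)

Section transfer.
Context {R : realType} {d k : nat} {dO : measure_display}
  {Omega : measurableType dO} {Pr : probability Omega R}.
Local Notation E := 'rV[R]_d.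

Lemma RV_unit_mass2 (X : {RV Pr >-> E}) (Q : probability E R) (c : R) :
  (forall A, measurable A -> distribution Pr X A = Q A) ->
  (\int[Pr]_w (sqnorm (X w))%:E <= c%:E)%E ->
  unit_mass2 Q /\ \int[Q]_u sqnorm u <= c.
Proof.
move=> XQ Xc.
have intE := ge0_integral_RV XQ (@measurable_sqnorm R d) (@sqnorm_ge0 R d).
have Q2 : unit_mass2 Q.
  by split; [exact: probability_setT|rewrite -intE (le_lt_trans Xc)// ltry].
by split => //; rewrite -lee_fin EFin_int -?intE//; exact: qgrowth_sqnorm.
Qed.

Lemma int_RV (X : {RV Pr >-> E}) (Q : probability E R) (g : E -> R) :
  (forall A, measurable A -> distribution Pr X A = Q A) ->
  unit_mass2 Q -> qgrowth g ->
  Pr.-integrable setT (fun w => (g (X w))%:E) /\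
  \int[Q]_u g u = \int[Pr]_w g (X w).
Proof.
move=> XQ Q2 qg; have mX : measurable_fun setT X by [].
have mg : measurable_fun setT g by case: qg.
have qn := qgrowth_norm qg.
have ig : Pr.-integrable setT (fun w => (g (X w))%:E).
  apply/integrableP; split; first by apply/measurable_EFinP; exact: measurableT_comp.
  rewrite (_ : (fun w => _) = fun w => ((fun u => `|g u|) (X w))%:E)//.
  rewrite (ge0_integral_RV (F := fun u => `|g u|) XQ)//; last by case: qn.
  by rewrite -EFin_int// ltry.
split => //; rewrite /Rintegral; congr fine.
rewrite -(@eq_measure_integral _ _ _ setT Q (distribution Pr X)); last first.
  by move=> A mA _; exact: XQ.
rewrite (integral_pushforward mX)// ?preimage_setT//.
exact/measurable_EFinP.
Qed.

(** [X] and [Y] are a coupling of [Q] and [P] whose transport cost is the mean of [|Z|]. *)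
Lemma min_affine_transfer (X Y Z : {RV Pr >-> E}) (P Q : probability E R)
    (m : 'I_k -> E) (om : 'I_k -> R) (rho e : R) : (0 < k)%N ->
  (forall w, X w = Y w + Z w) ->
  (forall A, measurable A -> distribution Pr Y A = P A) ->
  (forall A, measurable A -> distribution Pr X A = Q A) ->
  unit_mass2 P -> unit_mass2 Q -> 0 <= rho -> (forall i, enorm (m i) <= rho) ->
  (\int[Pr]_w (enorm (Z w))%:E <= e%:E)%E ->
  `|\int[P]_u min_affine m om u - \int[Q]_u min_affine m om u| <= 2 * rho * e.
Proof.
move=> k0 XYZ YP XQ P2 Q2 rho0 mrho Ze.
have qg := qgrowth_min_affine k0 m om.
have [iY ->] := int_RV YP P2 qg; have [iX ->] := int_RV XQ Q2 qg.
have mZ : measurable_fun setT (fun w => enorm (Z w)).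
  by apply: measurableT_comp => //; exact: measurable_enorm.
have iZ : Pr.-integrable setT (fun w => (enorm (Z w))%:E).
  apply/integrableP; split; first exact/measurable_EFinP.
  under eq_integral do rewrite gee0_abs ?lee_fin ?enorm_ge0//.
  by rewrite (le_lt_trans Ze)// ltry.
have Ze' : \int[Pr]_w enorm (Z w) <= e.
  by rewrite -lee_fin /Rintegral fineK//; exact: integrable_fin_num.
rewrite -RintegralB//; apply: (le_trans (le_normr_Rintegral measurableT _)).
  by have := integrableB measurableT iY iX.
apply: (@le_trans _ _ (\int[Pr]_w (2 * rho * enorm (Z w)))); last first.
  by rewrite RintegralZl// ler_wpM2l// mulr_ge0.
apply: le_Rintegral => //.
- have := integrable_norm (integrableB measurableT iY iX); apply.
- by have := integrableZl measurableT (2 * rho) iZ.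
- move=> w _.
  have step i : `|2 * dotv (Z w) (m i)| <= 2 * rho * enorm (Z w).
    rewrite normrM ger0_norm// -mulrA ler_pM2l// (le_trans (dotv_le _ _))//.
    by rewrite mulrC ler_wpM2r ?enorm_ge0.
  have XE i : dotv (X w) (m i) = dotv (Y w) (m i) + dotv (Z w) (m i).
    by rewrite XYZ dotvDl.
  rewrite ler_norml; apply/andP; split.
    rewrite lerNl opprB lerBlDr addrC; apply: fmin_le_add => // i.
    by rewrite XE; have := step i; rewrite ler_norml => /andP[]; lra.
  rewrite lerBlDr addrC; apply: fmin_le_add => // i.
  by rewrite XE; have := step i; rewrite ler_norml => /andP[]; lra.
Qed.

End transfer.

(** * Numerical constants *)

Section constants.
Context {R : realType}.
Implicit Types (K sigma h p : R).

(** [n.+1 <= n ^ 2] bounds the grid; each of the three groups of terms is at most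
    [n ^ ((2 d + 3) k)], and [3 <= n ^ 2]. *)
Lemma family_card_le d n k : (1 < n)%N -> (0 < k)%N ->
  (k + k * d + k + 2 + (n.+1 ^ d * n.+1) ^ k <= n ^ ((2 * d + 5) * k))%N.
Proof.
move=> n1 k0; have n0 : (0 < n)%N by exact: ltnW.
have g : ((n.+1 ^ d * n.+1) ^ k <= n ^ ((2 * d + 3) * k))%N.
  rewrite -expnSr -expnM.
  apply: (@leq_trans ((n ^ 2) ^ (d.+1 * k))).
    by rewrite leq_exp2r ?muln_gt0// -mulnn (leq_trans _ (leq_mul n1 (leqnn n)))// mul2n -addnn -addn1 leq_add2l.
  by rewrite -expnM leq_pexp2l// mulnA leq_mul2r; apply/orP; right; lia.
have a : (k * (d + 2) <= n ^ ((2 * d + 3) * k))%N.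
  apply: (@leq_trans (n ^ k * n ^ (d + 2))).
    apply: leq_mul; first exact: ltnW (ltn_expl _ _).
    exact: ltnW (ltn_expl _ _).
  rewrite -expnD leq_pexp2l//; nia.
have b : (2 <= n ^ ((2 * d + 3) * k))%N.
  by rewrite (leq_trans n1)// -[leqLHS]expn1 leq_pexp2l//; nia.
apply: (@leq_trans (n ^ 2 * n ^ ((2 * d + 3) * k))).
  have n4 : (4 <= n ^ 2)%N by rewrite -mulnn (leq_mul n1 n1).
  move: (n ^ ((2 * d + 3) * k))%N (n ^ 2)%N ((n.+1 ^ d * n.+1) ^ k)%N a b g n4; nia.
by rewrite -expnD leq_pexp2l//; nia.
Qed.

Lemma expRN1_ge : 1 / 7 < expR (-1) :> R.
Proof.
have q : 3 / 4 <= expR (- (1 / 4)) :> R by have := expR_ge1Dx (- (1 / 4) : R); lra.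
have -> : -1 = 4%:R * - (1 / 4) :> R by lra.
rewrite expRM_natl; apply: (@lt_le_trans _ _ ((3 / 4) ^+ 4)); first by lra.
by rewrite lerXn2r ?nnegrE ?expR_ge0//; lra.
Qed.

Lemma powRN_expR n p : (0 < n)%N -> n%:R `^ (- p) = expR (- (p * ln n%:R)) :> R.
Proof. by move=> n0; rewrite /powR pnatr_eq0 gtn_eqF//= mulNr. Qed.

(** [7 n^(-p) <= 1] and [exp 1 < 7] give [p ln n >= 1]. *)
Lemma log_scale_ge1 n p : (1 < n)%N -> 0 < p -> 7 * n%:R `^ (- p) <= 1 ->
  1 <= (p + 1) * ln (n%:R : R) /\ ln (n%:R : R) <= (p + 1) * ln n%:R.
Proof.
move=> n1 p0; rewrite powRN_expR ?(ltnW n1)// => h7.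
have l0 : 0 < ln (n%:R : R) by rewrite ln_gt0// ltr1n.
have pl : 1 <= p * ln (n%:R : R).
  rewrite leNgt; apply/negP => pl1; have := expRN1_ge.
  have : expR (-1) < expR (- (p * ln n%:R)) by rewrite ltr_expR ltrN2.
  lra.
by move: (ln _) l0 pl => l l0 pl; have := mulr_gt0 p0 l0; split; lra.
Qed.

(** [64 d + 192 = 32 (2 d + 6)] gives [n t^2 / 32 = (2 d + 6) k L], which beats the exponent
    [(2 d + 5) k] of the cardinality by [k L]. The outer 64 is 32 from [B^2] times 2 from
    [eta = 2 t]. *)
Definition deviation_const (d : nat) : R := 64 * gauss_const * Num.sqrt (64 * d%:R + 192).

(** The excess under [Q] and the cross term of [transfer_arith], at the deviation scale, plus the
    cost of passing to [P]. *)
Definition pdtm_const (d : nat) : R :=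
  (12 + 12 * d%:R + 2 * gauss_const) * deviation_const d +
  4 * gauss_const * (8 * gauss_const + 1).

Lemma gauss_const_gt0 : 0 < gauss_const :> R.
Proof. exact: lt_le_trans ltr01 gauss_const_ge1. Qed.

Lemma gauss_const_sqr_ge K : 10 * gauss_const * K ^+ 2 <= (4 * gauss_const * K) ^+ 2.
Proof.
have := @gauss_const_ge1 R; move: gauss_const => G G1.
by rewrite [leRHS]exprMn ler_wpM2r ?sqr_ge0//; have := ler_wpM2l (le_trans ler01 G1) G1; lra.
Qed.

Lemma deviation_const_ge0 d : 0 <= deviation_const d.
Proof. by rewrite mulr_ge0 ?sqrtr_ge0// mulr_ge0// ltW// gauss_const_gt0. Qed.

Lemma pdtm_const_gt0 d : 0 < pdtm_const d.
Proof.
have G0 := gauss_const_gt0.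
have d0 : 0 <= d%:R :> R by [].
rewrite ltr_wpDl// ?mulr_gt0// ?mulr_ge0 ?deviation_const_ge0//.
- by lra.
- by lra.
Qed.

(** The cross term is absorbed by [sigma sqrt b <= (sigma^2 + b) / 2 <= (K sigma + b) / 2], and
    [b / sqrt h <= b / h]. *)
Lemma transfer_arith (G K sigma h b : R) : 1 <= G -> 0 < sigma <= K -> 0 < h <= 1 -> 0 <= b ->
  2 * ((4 * G * K + Num.sqrt b) / Num.sqrt h) * (2 * sigma * G) +
  2 * (4 * G * K / Num.sqrt h) * (2 * sigma * G) <=
  4 * G * (8 * G + 1) * (K * sigma / Num.sqrt h) + 2 * G * (b / h).
Proof.
move=> G1 /andP[s0 sK] /andP[h0 h1] b0.
have r0 : 0 < Num.sqrt h by rewrite sqrtr_gt0.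
have hr : h <= Num.sqrt h.
  rewrite -[leLHS](sqr_sqrtr (ltW h0)) expr2 ler_piMr ?(ltW r0)//.
  by rewrite -[leRHS]sqrtr1 ler_wsqrtr.
have bh : b / Num.sqrt h <= b / h by rewrite ler_wpM2l// lef_pV2 ?posrE.
have sb : sigma * Num.sqrt b <= (K * sigma + b) / 2.
  have := sqr_ge0 (sigma - Num.sqrt b); rewrite sqrrB (sqr_sqrtr b0).
  have : sigma ^+ 2 <= K * sigma by rewrite expr2 ler_pM2r.
  lra.
have G0 : 0 < G by exact: lt_le_trans G1.
have i0 : 0 < (Num.sqrt h)^-1 by rewrite invr_gt0.
have sb' := ler_wpM2l (ltW (mulr_gt0 G0 i0)) sb.
have KG : 0 <= G * (Num.sqrt h)^-1 * (K * sigma).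
  by rewrite !mulr_ge0// ?(ltW G0) ?(ltW i0) ?(ltW s0)// (le_trans (ltW s0)).
have := ler_wpM2l (ltW G0) bh.
move: sb' KG; move: (Num.sqrt h)^-1 (Num.sqrt b) (b / h) => i sq bh' sb' KG bG; lra.
Qed.

(** The exponent [3 / 2]: a factor [L] from [B^2] and [sqrt L] from [t]. *)
Lemma deviation_scale d (k n : nat) (K h L : R) : (0 < n)%N -> 0 <= L -> 0 < h ->
  32 * K ^+ 2 * (gauss_const * L) *
    (2 * (Num.sqrt (64 * d%:R + 192) * Num.sqrt k%:R * Num.sqrt L / Num.sqrt n%:R)) / h =
  deviation_const d * (Num.sqrt k%:R * (K ^+ 2 * L `^ (3 / 2) / (h * Num.sqrt n%:R))).
Proof.
move=> n0 L0 h0; have -> : L `^ (3 / 2) = L * Num.sqrt L.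
  have -> : 3 / 2 = 1 + 2^-1 :> R by field.
  by rewrite powRD ?powRr1 ?powR12_sqrt//; apply/implyP; rewrite gt_eqF//; lra.
rewrite /deviation_const; field.
by rewrite !gt_eqF// sqrtr_gt0 ltr0n.
Qed.

(** Each of the two Hoeffding sides and the event that some point leaves the ball cost at most
    [exp (- L) <= n^(-p)], in all 3 of the 7 available. *)
Lemma failure_bound d k n p (L L' : R) : (1 < n)%N -> (0 < k)%N -> 0 < p ->
  L = (p + 1) * ln n%:R -> 1 <= L -> ln (n%:R : R) <= L -> L <= L' ->
  2 * (k + k * d + k + 2 + (n.+1 ^ d * n.+1) ^ k)%N%:R *
    expR (- ((2 * d%:R + 6) * k%:R * L)) + n%:R * expR (- (4 * L')) <
  7 * n%:R `^ (- p).
Proof.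
move=> n1 k0 p0 LE L1 lnL LL'; have n0 : (0 < n)%N by exact: ltnW.
rewrite powRN_expR//; set q := expR (- (p * ln n%:R)).
have q0 : 0 < q by exact: expR_gt0.
have nE : n%:R = expR (ln n%:R) :> R by rewrite lnK// posrE ltr0n.
have l0 : 0 <= ln (n%:R : R) by rewrite ln_ge0// ler1n.
have k1 : 1 <= k%:R :> R by rewrite ler1n.
have Lq : expR (- L) <= q by rewrite ler_expR LE; lra.
have h2 : n%:R * expR (- (4 * L')) <= q.
  by rewrite {1}nE -expRD; apply: le_trans Lq; rewrite ler_expR; lra.
have h1 : (k + k * d + k + 2 + (n.+1 ^ d * n.+1) ^ k)%N%:R *
    expR (- ((2 * d%:R + 6) * k%:R * L)) <= q.
  apply: (@le_trans _ _ ((n ^ ((2 * d + 5) * k))%N%:R * expR (- ((2 * d%:R + 6) * k%:R * L)))).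
    by rewrite ler_wpM2r ?expR_ge0// ler_nat family_card_le.
  rewrite natrX {1}nE -expRM_natl -expRD; apply: le_trans Lq; rewrite ler_expR.
  rewrite !natrM natrD natrM.
  have dk : 0 <= (2 * d%:R + 5) * k%:R :> R by rewrite mulr_ge0// addr_ge0// mulr_ge0.
  have := ler_wpM2l dk lnL; have := ler_wpM2r (le_trans ler01 L1) k1.
  lra.
apply: (@le_lt_trans _ _ (2 * q + q)).
  by rewrite lerD// -mulrA ler_pM2l.
by move: q q0 {Lq h1 h2} => q q0; lra.
Qed.

Lemma sqrt_scale_sqr d k n (L : R) : (0 < n)%N -> 0 <= L ->
  n%:R * (Num.sqrt (64 * d%:R + 192) * Num.sqrt k%:R * Num.sqrt L / Num.sqrt n%:R) ^+ 2 / 32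
  = (2 * d%:R + 6) * k%:R * L :> R.
Proof.
move=> n0 L0; rewrite !exprMn exprVn !sqr_sqrtr//.
by field; rewrite pnatr_eq0 -lt0n.
Qed.

Lemma inv_le_scale d k n (L : R) : (0 < n)%N -> (0 < k)%N -> 1 <= L ->
  n%:R^-1 <= Num.sqrt (64 * d%:R + 192) * Num.sqrt k%:R * Num.sqrt L / Num.sqrt n%:R :> R.
Proof.
move=> n0 k0 L1; have nR : 0 < n%:R :> R by rewrite ltr0n.
have s1 (y : R) : 1 <= y -> 1 <= Num.sqrt y.
  by move=> y1; rewrite -[leLHS]sqrtr1 ler_wsqrtr.
have rn : 0 < Num.sqrt (n%:R : R) by rewrite sqrtr_gt0.
apply: (@le_trans _ _ (Num.sqrt n%:R)^-1).
  rewrite lef_pV2 ?posrE// -[leRHS](sqr_sqrtr (ltW nR)) expr2 ler_peMr ?(ltW rn)//.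
  by rewrite s1// ler1n.
rewrite ler_peMl ?invr_ge0 ?(ltW rn)//.
have d0 : 0 <= d%:R :> R by [].
rewrite !mulr_ege1 ?s1 ?ler1n//; lra.
Qed.

(** The factor [gauss_const] in [L'] cancels the one in the tail moment. *)
Lemma tail_ratio (K L L' : R) n p : (1 < n)%N -> 0 < p -> L = (p + 1) * ln n%:R ->
  1 <= L -> L' = gauss_const * L -> L <= L' -> 0 < K ->
  32 * gauss_const * K ^+ 2 * expR (- L') / (32 * K ^+ 2 * L') <= n%:R^-1.
Proof.
move=> n1 p0 LE L1 L'E LL' K0; have n0 : (0 < n)%N by exact: ltnW.
have G0 := gauss_const_gt0; have L0 : 0 < L by exact: lt_le_trans L1.
have L'0 : 0 < L' by exact: lt_le_trans LL'.
have nE : n%:R^-1 = expR (- ln n%:R) :> R by rewrite expRN lnK// posrE ltr0n.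
have l0 : 0 <= ln (n%:R : R) by rewrite ln_ge0// ler1n.
have -> : 32 * gauss_const * K ^+ 2 * expR (- L') / (32 * K ^+ 2 * L') = expR (- L') / L.
  by rewrite L'E; field; rewrite !gt_eqF.
rewrite ler_pdivrMr// (@le_trans _ _ n%:R^-1)// ?ler_peMr ?invr_ge0//.
rewrite nE ler_expR lerN2 (le_trans _ LL')// LE.
by have := mulr_ge0 (ltW p0) l0; lra.
Qed.

End constants.

(** * The finite family of controlled functions *)

Section comparison_family.
Context {R : realType} {d n k : nat}.
Local Notation E := 'rV[R]_d.

(** A single index type allows a single union bound. The boolean [true] stands for the second
    moment, [false] for the criterion of the fixed local measures. *)
Definition family_index : finType :=
  ('I_k + 'I_k * 'I_d + 'I_k + bool + grid (d := d) (n := n) (k := k))%type.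

Variables (Q : probability E R) (B h : R) (f : 'I_k -> E -> R) (mu : 'I_k -> probability E R).
Hypotheses (n0 : (0 < n)%N) (k0 : (0 < k)%N) (B0 : 0 < B) (h01 : 0 < h <= 1)
  (Q2 : unit_mass2 Q) (QB : \int[Q]_u sqnorm u <= B ^+ 2)
  (mf : forall i, measurable_fun setT (f i) /\ (forall u, 0 <= f i u <= 1))
  (submu : forall i, submeasure h Q (mu i)).

Definition family_fun (l : family_index) : E -> R :=
  match l with
  | inl (inl (inl (inl i))) => f i
  | inl (inl (inl (inr (i, j)))) => fun y => y 0 j * f i y
  | inl (inl (inr i)) => fun y => sqnorm y * f i y
  | inl (inr true) => sqnorm
  | inl (inr false) => min_affine (fun i => mean (mu i)) (fun i => \int[mu i]_u sqnorm u)
  | inr th => min_affine (grid_mean B th) (grid_moment B th)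
  end.

Definition family_scale (l : family_index) : R :=
  match l with
  | inl (inl (inl (inl i))) => 1
  | inl (inl (inl (inr ij))) => B
  | inl (inl (inr i)) => B ^+ 2
  | inl (inr true) => B ^+ 2
  | inl (inr false) => 3 * B ^+ 2 / h
  | inr th => (2 * d%:R + 1) * B ^+ 2
  end.

Lemma family_scale_gt0 l : 0 < family_scale l.
Proof.
have B2 : 0 < B ^+ 2 by rewrite exprn_gt0.
have h0 : 0 < h by case/andP: h01.
case: l => [[[[i|ij]|i]|[]]|th] //=; first by rewrite divr_gt0// mulr_gt0.
by rewrite mulr_gt0// ltr_wpDl// mulr_ge0.
Qed.

Lemma qgrowth_family l : qgrowth (family_fun l).
Proof.
have qM g i : qgrowth g -> qgrowth (fun y => g y * f i y).
  move=> qg; have [mfi fi] := mf i; apply: (qgrowthM_bounded qg mfi); exists 1 => u.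
  by have /andP[? ?] := fi u; rewrite ger0_norm.
case: l => [[[[i|[i j]]|i]|[]]|th] /=.
- have [mfi fi] := mf i; apply: qgrowth_bounded => //; exists 1 => u.
  by have /andP[? ?] := fi u; rewrite ger0_norm.
- by apply: qM; exact: qgrowth_coord.
- by apply: qM; exact: qgrowth_sqnorm.
- exact: qgrowth_sqnorm.
- exact: qgrowth_min_affine.
- exact: qgrowth_min_affine.
Qed.

Lemma growth_bound_family l : growth_bound B (family_scale l) (family_fun l).
Proof.
have B2 : 0 < B ^+ 2 by rewrite exprn_gt0.
have outB (u : E) : B < enorm u -> B ^+ 2 <= sqnorm u.
  by move=> uB; rewrite -sqr_enorm ler_sqr ?nnegrE ?enorm_ge0 ?(ltW B0)// ltW.
have weight (g : E -> R) i u : `|g u * f i u| <= `|g u|.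
  by have [_ /(_ u)/andP[? ?]] := mf i; rewrite normrM (ger0_norm (x := f i u))// ler_piMr.
case: l => [[[[i|[i j]]|i]|[]]|th] /=.
- have f1 u : `|f i u| <= 1.
    by have [_ /(_ u)/andP[? ?]] := mf i; rewrite ger0_norm.
  split=> u uB //; apply: (le_trans (f1 u)).
  by rewrite mul1r ler_pdivlMl// mulr1 outB.
- split=> u uB; apply: (le_trans (weight (fun y => y 0 j) i u)).
    exact: le_trans (coord_le u j) uB.
  apply: (le_trans (coord_le u j)).
  have -> : B / B ^+ 2 * sqnorm u = enorm u ^+ 2 / B.
    by rewrite sqr_enorm; field; rewrite gt_eqF.
  by rewrite ler_pdivlMr// expr2 ler_wpM2l ?enorm_ge0// ltW.
- split=> u uB; apply: (le_trans (weight sqnorm i u)); rewrite ger0_norm ?sqnorm_ge0//.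
    exact: le_sqnorm.
  by rewrite divff ?gt_eqF// mul1r.
- split=> u uB; rewrite ger0_norm ?sqnorm_ge0//; first exact: le_sqnorm.
  by rewrite divff ?gt_eqF// mul1r.
- exact: (growth_bound_power k0 B0 h01 Q2 QB submu).
- exact: growth_bound_grid.
Qed.

Lemma card_family : #|family_index| = (k + k * d + k + 2 + (n.+1 ^ d * n.+1) ^ k)%N.
Proof. by rewrite !card_sum card_prod !card_ord card_bool card_grid. Qed.

End comparison_family.

Lemma final_arith (R : realType) (d : nat) (T S SP SQ bh gP gQ vP vQ r1 r2 : R) :
  1 <= gauss_const :> R -> 0 <= T -> 0 <= S ->
  SQ + gQ <= SQ + vQ + (12 + 12 * d%:R) * bh ->
  gP - gQ <= r1 -> - r2 <= vP - vQ ->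
  r1 + r2 <= 4 * gauss_const * (8 * gauss_const + 1) * S + 2 * gauss_const * bh ->
  bh = deviation_const d * T ->
  SP + gP - (SP + vP) <= pdtm_const d * T + pdtm_const d * S.
Proof.
move=> G1 T0 S0 le1 le2 le3 le4 bhE.
have G0 : 0 <= gauss_const :> R by exact: le_trans G1.
have c0 := deviation_const_ge0 (R := R) d; have d0 : 0 <= d%:R :> R by [].
have e1 : 0 <= 4 * gauss_const * (8 * gauss_const + 1) * T.
  by rewrite mulr_ge0// mulr_ge0//; lra.
have e2 : 0 <= (12 + 12 * d%:R + 2 * gauss_const) * deviation_const d * S.
  by rewrite mulr_ge0// mulr_ge0//; lra.
by move: le1 le4; rewrite bhE /pdtm_const; lra.
Qed.

(** * The deviation event and the final bound *)

Section main.
Context {R : realType} {d : nat}.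
Local Notation E := 'rV[R]_d.

Lemma kPDTM_sqr k (Q : {measure set E -> \bar R}) (h : R) s (m : 'I_k -> probability E R)
    (f : E -> R) : (0 < k)%N -> 0 < h <= 1 -> unit_mass2 Q -> Opt Q h s m ->
  (forall u, ((f u) ^+ 2)%:E = power_min m u) ->
  forall u, (f u) ^+ 2 = fmin (fun i => power (m i) u).
Proof.
move=> k0 h01 Q2 [adm _] fE u; apply: EFin_inj; rewrite fE power_minE// => i.
have /andP[h0 _] := h01.
exact: (submeasure_unit_mass2 h0 (local_submeasure h01 (adm i)) Q2).
Qed.

(** Links the optimum fixed before the event to the arbitrary one behind a given PDTM of [Q]. *)
Lemma Opt_value k (Q : probability E R) (h : R) s s' (m m' : 'I_k -> probability E R) :
  (0 < k)%N -> 0 < h <= 1 -> unit_mass2 Q -> Opt Q h s m -> Opt Q h s' m' ->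
  \int[Q]_u fmin (fun i => power (m i) u) <= \int[Q]_u fmin (fun i => power (m' i) u).
Proof.
move=> k0 h01 Q2 [adm opt] [adm' _]; have := opt _ _ adm'.
have u2 (l : 'I_k -> probability E R) t : admissible Q h t l -> forall i, unit_mass2 (l i).
  move=> al i; have /andP[h0 _] := h01.
  exact: (submeasure_unit_mass2 h0 (local_submeasure h01 (al i)) Q2).
under eq_integral do rewrite (power_minE _ k0 (u2 _ _ adm)).
under [X in (_ <= X)%E]eq_integral do rewrite (power_minE _ k0 (u2 _ _ adm')).
have qp (l : 'I_k -> probability E R) : qgrowth (fun u => fmin (fun i => power (l i) u)).
  by apply: qgrowth_fmin => // i; exact: qgrowth_power.
by rewrite -!EFin_int// lee_fin.
Qed.

(** Origin of [sqrt h]: a submeasure has second moment at most [r^2 / h], and Jensen's inequality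
    takes the root. *)
Lemma mean_le (h r : R) (P : {measure set E -> \bar R}) (nu : probability E R) :
  0 < h -> unit_mass2 P -> submeasure h P nu -> 0 <= r ->
  \int[P]_u sqnorm u <= r ^+ 2 -> enorm (mean nu) <= r / Num.sqrt h.
Proof.
move=> h0 P2 subnu r0 Pr2; have nu2 := submeasure_unit_mass2 h0 subnu P2.
apply: enorm_le; first by rewrite divr_ge0 ?sqrtr_ge0.
apply: (le_trans (sqnorm_mean_le nu2)); rewrite expr_div_n (sqr_sqrtr (ltW h0)).
rewrite ler_pdivlMr// mulrC; apply: le_trans Pr2.
exact: (submeasure_int_le h0 subnu P2 (@qgrowth_sqnorm R d) (@sqnorm_ge0 R d)).
Qed.

Lemma measurable_enorm_ge (c : R) : measurable [set u : E | c <= enorm u].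
Proof.
exact: measurable_set_ler (measurable_cst c) (@measurable_enorm R d).
Qed.

Lemma bounded_unit_mass2 (K : R) (P : probability E R) :
  0 < K -> P [set u | (K <= enorm u)%R] = 0 -> unit_mass2 P.
Proof.
move=> K0 PK; split; first exact: probability_setT.
apply: (@le_lt_trans _ _ (\int[P]_u (K ^+ 2)%:E)%E); last first.
  by rewrite integral_cst// [X in (_ * X)%E]probability_setT mule1 ltry.
apply: ae_ge0_le_integral => //.
- by move=> u _; rewrite lee_fin sqnorm_ge0.
- by apply/measurable_EFinP; exact: measurable_sqnorm.
- by move=> u _; rewrite lee_fin sqr_ge0.
- exists [set u | K <= enorm u]; split => //; first exact: measurable_enorm_ge.
  move=> u /= nu; rewrite leNgt; apply/negP => uK; apply: nu => _.
  by rewrite lee_fin le_sqnorm// ltW.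
Qed.

(* The optimum [m0] is fixed before the event: the latter depends on the
   densities of the local measures derived from [m0], but not on [m']. *)
Lemma pdtm_deviation_event (K h sigma : R) (k n : nat)
    (P Q : probability E R) (dO : measure_display) (Omega : measurableType dO)
    (Pr : probability Omega R) (X Y Z : 'I_n -> {RV Pr >-> E}) (p : R)
    (s0 : 'I_k -> epoint R d) (m0 : 'I_k -> probability E R) :
  0 < K -> 0 < h <= 1 -> (0 < k)%N -> (1 < n)%N ->
  P [set u | (K <= enorm u)%R] = 0 ->
  0 < sigma <= K -> (forall i w, X i w = Y i w + Z i w) ->
  iid Y P -> (forall i, sub_gaussian sigma (distribution Pr (Z i))) -> iid X Q ->
  0 < p -> 7 * n%:R `^ (- p) <= 1 -> Opt Q h s0 m0 ->
  exists A : set Omega,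
    [/\ measurable A, ((1 - 7 * n%:R `^ (- p))%:E < Pr A)%E &
      forall w, A w -> forall (s s' : 'I_k -> epoint R d) (m m' : 'I_k -> probability E R),
        Opt (empirical (fun i => X i w)) h s m -> Opt Q h s' m' ->
        \int[P]_u fmin (fun i => power (m i) u) - \int[P]_u fmin (fun i => power (m' i) u) <=
        pdtm_const d * (Num.sqrt k%:R * (K ^+ 2 * ((p + 1) * ln n%:R) `^ (3 / 2)
          / (h * Num.sqrt n%:R))) + pdtm_const d * (K * sigma / Num.sqrt h)].
Proof.
move=> K0 h01 k0 n1 PK /andP[s_gt0 sK] XYZ iidY Zsg iidX p0 n7 opt0.
have n0 : (0 < n)%N by exact: ltnW.
have /andP[h0 h1] := h01.
pose i0 : 'I_n := Ordinal n0.
have G1 : 1 <= gauss_const :> R by exact: gauss_const_ge1.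
have G0 : 0 < gauss_const :> R by exact: gauss_const_gt0.
have [L1 lnL] := log_scale_ge1 n1 p0 n7; set L := (p + 1) * ln n%:R in L1 lnL *.
have nR : 0 < n%:R :> R by rewrite ltr0n.
have YK i : Pr [set w | K <= enorm (Y i w)] = 0.
  by have := iidY.2 i _ (measurable_enorm_ge K); rewrite PK.
(* The enlarged scale makes [tail_ratio] free of [gauss_const] and the second moment of [Q] at most
   [B^2]. *)
pose L' := gauss_const * L : R.
have L'L : L <= L' by rewrite ler_peMl// (le_trans ler01).
have L'1 : 1 <= L' by exact: le_trans L'L.
pose B := Num.sqrt (32 * K ^+ 2 * L').
have K2 : 0 < K ^+ 2 by rewrite exprn_gt0.
have L'0 : 0 < L' by exact: lt_le_trans L'1.
have B2pos : 0 < 32 * K ^+ 2 * L' by rewrite mulr_gt0// mulr_gt0.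
have B0 : 0 < B by rewrite sqrtr_gt0.
have BE : B ^+ 2 = 32 * K ^+ 2 * L' by rewrite sqr_sqrtr// ltW.
have [Q2 QK] := RV_unit_mass2 (iidX.2 i0)
  (noisy_sqnorm s_gt0 (Zsg i0) (XYZ i0) sK (YK i0)).
have GK : gauss_const * K ^+ 2 <= K ^+ 2 * L'.
  by rewrite mulrC ler_pM2l// ler_peMr// ltW.
have QB : \int[Q]_u sqnorm u <= B ^+ 2.
  apply: (le_trans QK); rewrite BE.
  have := ltW (mulr_gt0 G0 K2); move: GK; lra.
have P2 := bounded_unit_mass2 K0 PK.
have subm0 i : submeasure h Q (m0 i) := local_submeasure h01 (opt0.1 i).
(* [m0] comes without explicit densities and possibly at infinity; [mu] is no worse and has finite
   centres and densities [f]. *)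
have [c [f [mu [mf fh adm muE best]]]] := best_local_measures Q2 h01 k0 subm0.
have submu i : submeasure h Q (mu i) := local_submeasure h01 (adm i).
pose t : R := Num.sqrt (64 * d%:R + 192) * Num.sqrt k%:R * Num.sqrt L / Num.sqrt n%:R.
have tE : n%:R * t ^+ 2 / 32 = (2 * d%:R + 6) * k%:R * L.
  by apply: sqrt_scale_sqr => //; exact: le_trans L1.
have nt : n%:R^-1 <= t by exact: inv_le_scale.
have t0 : 0 < t by apply: lt_le_trans nt; rewrite invr_gt0.
pose V (l : family_index) := ball_part B (family_scale B h l) (family_fun (n := n) B f mu l).
have mV l : measurable_fun setT (V l).
  by apply: measurable_ball_part; case: (qgrowth_family B mu k0 mf l).
have V1 l u : `|V l u| <= 1.
  apply: ball_part_le1; first exact: family_scale_gt0.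
  exact: (growth_bound_family n0 k0 B0 h01 Q2 QB mf submu l).
have [Bh [mBh PBh HBh]] := hoeffding_family iidX n0 t0 mV V1.
have mX i : measurable [set w | B < enorm (X i w)].
  have me : measurable_fun setT (fun w => enorm (X i w)).
    by apply: measurableT_comp => //; exact: measurable_enorm.
  exact: measurable_set_ltr (measurable_cst B) me.
have tailX i : (Pr [set w | (B < enorm (X i w))%R] <= (expR (- (4 * L')))%:E)%E.
  exact: (noisy_tail s_gt0 (Zsg i) (XYZ i) sK (YK i) L'1 (ltW B0) BE).
have [mBo PBo] := union_bound mX tailX.
set Bo := mkset _ in mBo PBo.
exists (~` (Bh `|` Bo)); split.
- by apply: measurableC; exact: measurableU.
- rewrite probability_setC; last exact: measurableU.
  have /le_lt_trans lt7 : (Pr (Bh `|` Bo) <= (2 * #|@family_index d n k|%:R *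
      expR (- (n%:R * t ^+ 2 / 32)) + n%:R * expR (- (4 * L')))%:E)%E.
    apply: (@le_trans _ _ (Pr Bh + Pr Bo)%E); first exact: measureU2.
    by rewrite EFinD leeD//; move: PBo; rewrite card_ord.
  have {}lt7 : (Pr (Bh `|` Bo) < (7 * n%:R `^ (- p))%:E)%E.
    by apply: lt7; rewrite lte_fin tE card_family; exact: failure_bound.
  have : Pr (Bh `|` Bo) \is a fin_num by apply: fin_num_measure; exact: measurableU.
  move=> /fineK Pf; move: lt7; rewrite -Pf -EFinB !lte_fin ltrD2l ltrN2.
  by [].
move=> w wA s s' m m' optn opt'.
pose x i := X i w.
have xB i : enorm (x i) <= B.
  by rewrite leNgt; apply/negP => Bx; apply: wA; right; exists i.
have wBh : ~ Bh w by move=> wb; apply: wA; left.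
(* One [t] for Hoeffding's deviation, one for the part outside the ball, which is at most
   [1 / n <= t]. *)
pose eta := 2 * t.
have Q_out : \int[Q]_u (sqnorm u * \1_[set v | B < enorm v] u) <=
    32 * gauss_const * K ^+ 2 * expR (- L').
  have mo := measurable_out (d := d) B.
  have qo := qgrowthM_indic mo (@qgrowth_sqnorm R d).
  have := noisy_tail_sqnorm s_gt0 (Zsg i0) (XYZ i0) sK (YK i0) L'1 (ltW B0) BE.
  rewrite (ge0_integral_RV (F := fun u => sqnorm u * \1_[set v | B < enorm v] u) (iidX.2 i0)).
  + by rewrite -EFin_int// lee_fin.
  + by case: qo.
  + by move=> u; rewrite mulr_ge0// sqnorm_ge0.
have close l : int_close Q x eta (family_scale B h l) (family_fun (n := n) B f mu l).
  apply: le_trans (deviation_le n0 B0 Q2 xB (qgrowth_family B mu k0 mf l)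
    (family_scale_gt0 B0 h01 l) (growth_bound_family n0 k0 B0 h01 Q2 QB mf submu l)
    (HBh w wBh l) Q_out) _.
  have -> : eta = t + t by rewrite /eta mulr_natl.
  rewrite ler_pM2l ?family_scale_gt0// lerD2l.
  by apply: le_trans nt; rewrite BE; exact: (tail_ratio n1 p0 (erefl L) L1 (erefl L') L'L K0).
have excess : \int[Q]_u fmin (fun i => power (m i) u) <=
    \int[Q]_u fmin (fun i => power (m' i) u) + (12 + 12 * d%:R) * B ^+ 2 * eta / h.
  have neta : n%:R^-1 <= eta by rewrite (le_trans nt)// ler_peMl ?(ltW t0)// ler1n.
  have step := Opt_excess n0 k0 B0 h01 Q2 xB QB neta mf fh submu muE
    (fun i => close (inl (inl (inl (inl i)))))
    (fun i j => close (inl (inl (inl (inr (i, j))))))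
    (fun i => close (inl (inl (inr i))))
    (close (inl (inr false))) (fun th => close (inr th)) optn.
  apply: (le_trans step); rewrite lerD2r (le_trans best)//.
  exact: Opt_value opt0 opt'.
have Qn2 : unit_mass2 (empirical x) by exact: empirical_unit_mass2.
have subm i : submeasure h (empirical x) (m i) := local_submeasure h01 (optn.1 i).
have subm' i : submeasure h Q (m' i) := local_submeasure h01 (opt'.1 i).
pose b := B ^+ 2 * eta.
have b0 : 0 <= b by rewrite mulr_ge0 ?sqr_ge0// mulr_ge0// ltW.
have GK0 : 0 <= 4 * gauss_const * K by rewrite !mulr_ge0// ltW.
have Qr : \int[Q]_u sqnorm u <= (4 * gauss_const * K) ^+ 2 by exact: le_trans QK (gauss_const_sqr_ge K).
(* The index [true] gives [int |u|^2 dQn <= int |u|^2 dQ + b], and [r^2 + b <= (r + sqrt b)^2]. *)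
have Qnr : \int[empirical x]_u sqnorm u <= (4 * gauss_const * K + Num.sqrt b) ^+ 2.
  have /= := close (inl (inr true)); rewrite /int_close ler_norml => /andP[_ cl].
  rewrite sqrrD (sqr_sqrtr b0); move: cl; rewrite lerBlDl => /le_trans; apply.
  by rewrite lerD2r (le_trans Qr)// lerDl mulrn_wge0// mulr_ge0 ?sqrtr_ge0.
have meann i := mean_le h0 Qn2 (subm i) (addr_ge0 GK0 (sqrtr_ge0 b)) Qnr.
have meanQ i := mean_le h0 Q2 (subm' i) GK0 Qr.
have Zle := sub_gaussian_enorm s_gt0 (Zsg i0).
have rn0 : 0 <= (4 * gauss_const * K + Num.sqrt b) / Num.sqrt h.
  by rewrite divr_ge0 ?sqrtr_ge0// addr_ge0 ?sqrtr_ge0.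
have rQ0 : 0 <= 4 * gauss_const * K / Num.sqrt h by rewrite divr_ge0 ?sqrtr_ge0.
have trn := min_affine_transfer (fun i => \int[m i]_u sqnorm u) k0 (XYZ i0)
  (iidY.2 i0) (iidX.2 i0) P2 Q2 rn0 meann Zle.
have trQ := min_affine_transfer (fun i => \int[m' i]_u sqnorm u) k0 (XYZ i0)
  (iidY.2 i0) (iidX.2 i0) P2 Q2 rQ0 meanQ Zle.
have arith := transfer_arith G1 (introT andP (conj s_gt0 sK)) h01 b0.
have scale : b / h = deviation_const d *
    (Num.sqrt k%:R * (K ^+ 2 * L `^ (3 / 2) / (h * Num.sqrt n%:R))).
  by rewrite -deviation_scale// ?(le_trans _ L1)// /b BE.
move: excess; rewrite !int_power_fmin// => excess.
have excess' : (12 + 12 * d%:R) * B ^+ 2 * eta / h = (12 + 12 * d%:R) * (b / h).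
  by rewrite /b; ring.
rewrite excess' in excess.
have {}trn := le_trans (ler_norm _) trn.
have {}trQ := lerNnormlW trQ.
have T0 : 0 <= Num.sqrt k%:R * (K ^+ 2 * L `^ (3 / 2) / (h * Num.sqrt n%:R)).
  apply: mulr_ge0; first exact: sqrtr_ge0.
  apply: divr_ge0; apply: mulr_ge0.
  - exact: sqr_ge0.
  - exact: powR_ge0.
  - exact: ltW.
  - exact: sqrtr_ge0.
have S0 : 0 <= K * sigma / Num.sqrt h.
  by rewrite divr_ge0 ?sqrtr_ge0// mulr_ge0 ?(ltW K0) ?(ltW s_gt0).
exact: (final_arith _ G1 T0 S0 excess trn trQ arith scale).
Qed.

End main.

Theorem theorem24 (R : realType) (d : nat) (d_gt0 : (0 < d)%N) :
  exists C : R, 0 < C /\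
  forall (K h sigma : R) (k n : nat)
    (M : set 'rV[R]_d) (P Q : probability 'rV[R]_d R)
    (dO : measure_display) (Omega : measurableType dO)
    (Pr : probability Omega R)
    (X Y Z : 'I_n -> {RV Pr >-> 'rV[R]_d}),
    0 < K -> 0 < h <= 1 -> (0 < k)%N -> (0 < n)%N ->
    P.-negligible (~` M) -> M `<=` oball 0 K%:E ->
    0 < sigma <= K ->
    (forall i w, X i w = Y i w + Z i w) ->
    iid Y P ->
    (forall i, sub_gaussian sigma (distribution Pr (Z i))) ->
    iid X Q ->
  forall p : R, 0 < p ->
  exists A : set Omega,
    [/\ measurable A,
        ((1 - 7 * n%:R `^ (- p))%:E < Pr A)%E &
        forall w, A w -> forall dQn dQ : 'rV[R]_d -> R,
          is_kPDTM (empirical (fun i => X i w)) h k dQn ->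
          is_kPDTM Q h k dQ ->
          (\int[P]_u (dQn u ^+ 2 - dQ u ^+ 2)%:E <=
             (C * Num.sqrt k%:R *
                (K ^+ 2 * ((p + 1) * ln n%:R) `^ (3 / 2)
                  / (h * Num.sqrt n%:R))
              + C * (K * sigma / Num.sqrt h))%:E)%E].
Proof.
exists (pdtm_const d); split; first exact: pdtm_const_gt0.
move=> K h sigma k n M P Q dO Omega Pr X Y Z K0 h01 k0 n0 PM MK sK XYZ iidY Zsg iidX p p0.
have q0 : 0 < n%:R `^ (- p) :> R by rewrite powR_gt0// ltr0n.
(* When the claimed probability is negative the empty event will do; this also disposes of
   [n = 1]. *)
have [n7|n7] := ltP 1 (7 * n%:R `^ (- p)).
  by exists set0; split => //; rewrite measure0 lte_fin subr_lt0.
have n1 : (1 < n)%N.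
  rewrite ltn_neqAle n0 andbT; apply/eqP => nE; move: n7.
  by rewrite -nE powR1; lra.
have PK : P [set u | (K <= enorm u)%R] = 0.
  apply/eqP; rewrite -measure_le0; case: PM => N [mN PN MN].
  rewrite -PN le_measure ?inE//; first exact: measurable_enorm_ge.
  move=> u /= Ku; apply: MN => /= /MK; rewrite /oball/= subr0 lte_fin ltNge.
  by rewrite Ku.
(* Without a minimizer for [Q] there is no PDTM of [Q]. *)
have [[s0 [m0 opt0]]|noOpt] := pselect (exists s (m : 'I_k -> _), Opt Q h s m); last first.
  exists setT; split => //; first by rewrite probability_setT lte_fin; move: q0; lra.
  by move=> w _ dQn dQ _ [_ [s [m [opt _]]]]; case: noOpt; exists s, m.
have [A [mA PA HA]] := pdtm_deviation_event K0 h01 k0 n1 PK sK XYZ iidY Zsg iidX p0 n7 opt0.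
exists A; split => // w Aw dQn dQ [_ [s [m [opt sE]]]] [_ [s' [m' [opt' sE']]]].
have Q2 : unit_mass2 Q.
  have /andP[s_gt0 sigK] := sK; pose i0 : 'I_n := Ordinal n0.
  have YK : Pr [set w | K <= enorm (Y i0 w)] = 0.
    by have := iidY.2 i0 _ (measurable_enorm_ge K); rewrite PK.
  exact: (RV_unit_mass2 (iidX.2 i0) (noisy_sqnorm s_gt0 (Zsg i0) (XYZ i0) sigK YK)).1.
have P2 := bounded_unit_mass2 K0 PK.
have Qn2 : unit_mass2 (empirical (fun i => X i w)) by exact: empirical_unit_mass2.
have qf (l : 'I_k -> probability 'rV[R]_d R) : qgrowth (fun u => fmin (fun i => power (l i) u)).
  by apply: qgrowth_fmin => // i; exact: qgrowth_power.
under eq_integral do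
  rewrite (kPDTM_sqr k0 h01 Qn2 opt sE) (kPDTM_sqr k0 h01 Q2 opt' sE').
rewrite -EFin_int//; last exact: qgrowthB.
by rewrite lee_fin intB// -mulrA; exact: HA Aw _ _ _ _ opt opt'.
Qed.
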